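(* Assume the standing setting and Hypothesis $(H_a)$. Then $\tau$ is in the limit circle case at $a$ if and only if its regularization index at $a$ satisfies $\ell_a=0$.
   Context: Standing setting: Let $-\infty\le a<b\le\infty$ and let $p,q,r$ be Lebesgue measurable functions on $(a,b)$ with $r>0$ a.e., $r\in L^1_{loc}((a,b))$; $p>0$ a.e., $1/p\in L^1_{loc}((a,b))$; $q$ real-valued a.e., $q\in L^1_{loc}((a,b))$. Let $\tau f=\frac1r\big[-(pf')'+qf\big]$ act on functions $f$ with $f,pf'\in AC_{loc}((a,b))$; write $f^{[1]}=pf'$ and $W(f,g)=fg^{[1]}-f^{[1]}g$. For $\lambda\in\mathbb R$, the equation $\tau f=\lambda f$ is nonoscillatory at $a$ if its nontrivial real solutions have finitely many zeros near $a$; then there is a solution $u_a$, unique up to constant multiples, with $\lim_{x\to a^+}u_a(x)/v_a(x)=0$ for every solution $v_a$ linearly independent of $u_a$; $u_a$ is called principal at $a$ and any such $v_a$ nonprincipal at $a$. $\tau$ is in the limit circle case at $a$ if for some (equivalently all) $\mu\in\mathbb C$ all solutions of $\tau f=\mu f$ lie in $L^2((a,c);r(x)dx)$ for $c\in(a,b)$; otherwise it is in the limit point case at $a$. Hypothesis $(H_a)$: there exist $\lambda\in\mathbb R$ such that $\tau f=\lambda f$ is nonoscillatory at $a$, and $c\in(a,b)$, such that $\int_a^c|u_a(x)v_a(x)r(x)|\,dx<\infty$, where $u_a$, $v_a$ are principal resp. nonprincipal solutions of $\tau f=\lambda f$ at $a$. Construction (C): fix $\lambda\in\mathbb R$ as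 in $(H_a)$ and let $u_a$ (principal) and $v_a$ (nonprincipal) be solutions of $\tau f=\lambda f$ with $W(v_a,u_a)=1$. Set $\varphi_0=u_a$, $\varphi_n(x)=\int_a^x[u_a(t)v_a(x)-v_a(t)u_a(x)]\varphi_{n-1}(t)r(t)\,dt$ for $n\ge1$, $x\in(a,b)$, and $\varphi(z,x)=\sum_{n\ge0}\varphi_n(x)(z-\lambda)^n$; this series converges for all $z\in\mathbb C$, $x\in(a,b)$, is entire in $z$ and solves $\tau\varphi(z,\cdot)=z\varphi(z,\cdot)$. Definition (RI): let $\theta(z,x)$ be any solution of $\tau\theta(z,\cdot)=z\theta(z,\cdot)$, entire in $z$ for each $x$, real for real $z$, with $W(\theta(z,\cdot),\varphi(z,\cdot))=1$, and write $\theta(z,x)=\sum_{n\ge0}\theta_n(x)(z-\lambda)^n$ (same $\lambda$ as in (C)). The limits $\lim_{x\to a^+}\varphi_0(x)/\theta_n(x)$ exist in $\mathbb R\cup\{\pm\infty\}$. The regularization index $\ell_a\in\mathbb N_0\cup\{\infty\}$ at $a$ is the smallest integer $\ell\ge0$ with $\lim_{x\to a^+}\varphi_0(x)/\theta_n(x)=0$ for $n=0,\dots,\ell$ and $\lim_{x\to a^+}\varphi_0(x)/\theta_{\ell+1}(x)\neq0$; if $\lim_{x\to a^+}\varphi_0(x)/\theta_n(x)=0$ for all $n\ge0$, then $\ell_a=\infty$. ($\ell_a$ does not depend on the choice of $\theta$ or of the constant normalization of $\varphi$.) *)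

(* Defs.v *)
(* MathComp 2.5 + MathComp-Analysis 1.16 (+ real_closed's complex R[i]). *)
From HB Require Import structures.
From mathcomp Require Import all_boot all_order all_algebra.
From mathcomp Require Import all_classical all_reals all_analysis.
From mathcomp.real_closed Require Import complex.
Import Order.TTheory GRing.Theory Num.Theory numFieldNormedType.Exports.

Set Implicit Arguments.
Unset Strict Implicit.
Unset Printing Implicit Defensive.

Local Open Scope classical_set_scope.
Local Open Scope ring_scope.

(* The real line equipped with the (complete) Lebesgue sigma-algebra, i.e. the
   domain of [completed_lebesgue_measure]. *)
Definition LebT (R : realType) := caratheodory_type ((@wlength R idfun)^*)%mu.

Section SturmLiouville.
Context {R : realType}.
Local Notation C := R[i].
Local Notation mu := (@completed_lebesgue_measure R).

(* the open interval (a,b), a b extended reals *)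
Definition oo_itv (a b : \bar R) : set (LebT R) :=
  [set x : R | (a < x%:E)%E /\ (x%:E < b)%E].

(* modulus of a complex number and the embedding R -> C *)
Definition cmod (z : C) : R :=
  Num.sqrt (complex.Re z ^+ 2 + complex.Im z ^+ 2).
Definition RC (x : R) : C := (x%:C)%C.
Definition cf (f : R -> R) : R -> C := fun x => RC (f x).

(* absolute continuity on the compact interval [c,d] (epsilon-delta definition,
   finite families of non-overlapping subintervals [s k, t k]) *)
Definition AC_on (f : R -> C) (c d : R) : Prop :=
  forall e : R, 0 < e -> exists2 del : R, 0 < del &
    forall (n : nat) (s t : 'I_n -> R),
      (forall k, c <= s k /\ s k <= t k /\ t k <= d) ->
      (forall k l, k != l -> t k <= s l \/ t l <= s k) ->
      \sum_(k < n) (t k - s k) < del ->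
      \sum_(k < n) cmod (f (t k) - f (s k)) < e.

(* local absolute continuity on an (open) interval I *)
Definition AC_loc (I : set R) (f : R -> C) : Prop :=
  forall c d : R, I c -> I d -> c <= d -> AC_on f c d.

(* L is the derivative at x of the complex valued function f of a real variable *)
Definition has_cderiv (f : R -> C) (x : R) (L : C) : Prop :=
  forall e : R, 0 < e -> exists2 del : R, 0 < del &
    forall h : R, h != 0 -> `|h| < del -> cmod ((f (x + h) - f x) / RC h - L) < e.

(* Lebesgue local integrability on I *)
Definition L1loc (I : set (LebT R)) (f : R -> R) : Prop :=
  forall c d : R, I c -> I d ->
    mu.-integrable (`[c, d]%classic : set (LebT R)) (EFin \o f).

(* Standing setting *)
Definition standing (a b : \bar R) (p q r : R -> R) : Prop :=
  (a < b)%E /\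
  measurable_fun (oo_itv a b) p /\ measurable_fun (oo_itv a b) q /\
  measurable_fun (oo_itv a b) r /\
  {ae mu, forall x : LebT R, oo_itv a b x -> 0 < r x} /\ L1loc (oo_itv a b) r /\
  {ae mu, forall x : LebT R, oo_itv a b x -> 0 < p x} /\
  L1loc (oo_itv a b) (fun x => (p x)^-1) /\
  L1loc (oo_itv a b) q.

(* f1 is the quasi-derivative f^[1] = p f' of f on I (f, p f' in AC_loc) *)
Definition qderiv (I : set (LebT R)) (p : R -> R) (f f1 : R -> C) : Prop :=
  AC_loc I f /\ AC_loc I f1 /\
  {ae mu, forall x : LebT R, I x ->
     exists2 L : C, has_cderiv f x L & f1 x = RC (p x) * L}.

(* f (with quasi-derivative f1) solves tau f = z f on I *)
Definition is_sol (I : set (LebT R)) (p q r : R -> R) (z : C) (f f1 : R -> C) : Prop :=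
  qderiv I p f f1 /\
  {ae mu, forall x : LebT R, I x ->
     exists2 L : C, has_cderiv f1 x L & (- L + RC (q x) * f x) / RC (r x) = z * f x}.

(* real solutions of tau f = lam f, lam real *)
Definition is_rsol (I : set (LebT R)) (p q r : R -> R) (lam : R) (f f1 : R -> R) : Prop :=
  is_sol I p q r (RC lam) (cf f) (cf f1).

Definition nontriv (I : set (LebT R)) (f : R -> R) : Prop := exists x, I x /\ f x != 0.

Definition lin_indep (I : set (LebT R)) (f g : R -> R) : Prop :=
  forall al be : R, (forall x, I x -> al * f x + be * g x = 0) -> al = 0 /\ be = 0.

(* the filter x -> a+ *)
Definition at_a (a : \bar R) : set_system R :=
  match a with
  | EFin r0 => at_right r0
  | -oo%E => -oo
  | +oo%E => +oo
  end.

(* tau f = lam f is nonoscillatory at a *)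
Definition nonosc_at_a (a b : \bar R) (p q r : R -> R) (lam : R) : Prop :=
  forall f f1 : R -> R, is_rsol (oo_itv a b) p q r lam f f1 ->
    nontriv (oo_itv a b) f ->
    exists2 c : R, oo_itv a b c &
      finite_set [set x : R | (a < x%:E)%E /\ x < c /\ f x = 0].

(* u is a principal solution of tau f = lam f at a *)
Definition principal_at_a (a b : \bar R) (p q r : R -> R) (lam : R) (u : R -> R) : Prop :=
  (exists u1, is_rsol (oo_itv a b) p q r lam u u1) /\ nontriv (oo_itv a b) u /\
  forall v v1 : R -> R, is_rsol (oo_itv a b) p q r lam v v1 ->
    lin_indep (oo_itv a b) u v -> (fun x => u x / v x) @ at_a a --> (0 : R).

(* Wronskian W(f,g) = f g^[1] - f^[1] g *)
Definition wr (f f1 g g1 : R -> C) (x : R) : C := f x * g1 x - f1 x * g x.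

(* the open interval (a,x) *)
Definition oo_ax (a : \bar R) (x : R) : set (LebT R) := [set t : R | (a < t%:E)%E /\ t < x].

(* Construction (C): phi_n *)
Fixpoint phin (a : \bar R) (r u v : R -> R) (n : nat) : R -> R :=
  match n with
  | 0 => u
  | n'.+1 => fun x =>
      Rintegral mu (oo_ax a x) (fun t => (u t * v x - v t * u x) * phin a r u v n' t * r t)
  end.

(* convergence of a complex series, and its sum *)
Definition cseries_to (s : nat -> C) (w : C) : Prop :=
  forall e : R, 0 < e -> exists N : nat, forall m : nat, (N <= m)%N ->
    cmod (\sum_(n < m) s n - w) < e.
Definition csum (s : nat -> C) : C :=
  (limn (fun m => complex.Re (\sum_(n < m) s n)) +i*
   limn (fun m => complex.Im (\sum_(n < m) s n)))%C.

(* phi(z,x) = sum_n phi_n(x) (z - lam)^n *)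
Definition phiz (a : \bar R) (r u v : R -> R) (lam : R) (z : C) (x : R) : C :=
  csum (fun n => RC (phin a r u v n x) * (z - RC lam) ^+ n).

(* g : C -> C is entire (complex differentiable at every point) *)
Definition entire (g : C -> C) : Prop :=
  forall z : C, exists L : C, forall e : R, 0 < e -> exists2 del : R, 0 < del &
    forall h : C, h != 0 -> cmod h < del -> cmod ((g (z + h) - g z) / h - L) < e.

(* Definition (RI): th is an admissible theta, with Taylor coefficients thn at lam *)
Definition theta_admissible (a b : \bar R) (p q r u v : R -> R) (lam : R)
    (th : C -> R -> C) (thn : nat -> R -> R) : Prop :=
  (forall z : C, exists th1 phi1 : R -> C,
      is_sol (oo_itv a b) p q r z (th z) th1 /\
      qderiv (oo_itv a b) p (phiz a r u v lam z) phi1 /\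
      forall x, oo_itv a b x -> wr (th z) th1 (phiz a r u v lam z) phi1 x = 1) /\
  (forall x, oo_itv a b x -> entire (fun z => th z x)) /\
  (forall (s : R) x, oo_itv a b x -> complex.Im (th (RC s) x) = 0) /\
  (forall (z : C) x, oo_itv a b x ->
      cseries_to (fun n => RC (thn n x) * (z - RC lam) ^+ n) (th z x)).

(* lim_{x -> a+} f x / g x = l in R u {+-oo} *)
Definition ratio_lim (a : \bar R) (f g : R -> R) (l : \bar R) : Prop :=
  (fun x => (f x / g x)%:E) @ at_a a --> l.

(* the regularization index at a equals the integer l *)
Definition reg_index (a : \bar R) (phi0 : R -> R) (thn : nat -> R -> R) (l : nat) : Prop :=
  (forall n, (n <= l)%N -> ratio_lim a phi0 (thn n) 0%E) /\
  exists2 L : \bar R, L != 0%E & ratio_lim a phi0 (thn l.+1) L.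

(* tau is in the limit circle case at a *)
Definition limit_circle_at_a (a b : \bar R) (p q r : R -> R) : Prop :=
  exists z : C, forall f f1 : R -> C, is_sol (oo_itv a b) p q r z f f1 ->
    forall c : R, oo_itv a b c ->
      (\int[mu]_(x in oo_ax a c) ((cmod (f x)) ^+ 2 * r x)%:E < +oo)%E.

End SturmLiouville.

(* Main.v *)
Require Import Defs.
From HB Require Import structures.
From mathcomp Require Import all_boot all_order all_algebra.
From mathcomp Require Import all_classical all_reals all_analysis.
From mathcomp.real_closed Require Import complex.
From mathcomp Require Import measurable_realfun ring lra.
Import Order.TTheory GRing.Theory Num.Theory numFieldNormedType.Exports.
Local Open Scope classical_set_scope.
Local Open Scope ring_scope.

Set Implicit Arguments.
Unset Strict Implicit.
Unset Printing Implicit Defensive.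

(** Near [a] the solutions [u], [v] do not vanish and [u / v] increases strictly
    from [0].  Writing [phi(z)] and [theta(z)], for real [z] close to [lam], in the
    basis [u], [v] by variation of constants, and differentiating at [z = lam], one
    gets [theta_0 = v + al u] and, for [y < x0],
      [theta_1(y) / u(y) = A + int_y^x0 v theta_0 r + (v/u)(y) int_a^y u theta_0 r].
    If [u / theta_1] has a nonzero limit, the left-hand side is bounded near [a];
    both integrals being nonnegative there, [v] lies in [L^2(r)] near [a].
    Conversely, if [v] is in [L^2(r)] the right-hand side tends to a finite limit
    strictly from below, so that [u / theta_1] has a nonzero limit.  Finally [v] is
    in [L^2(r)] near [a] iff all solutions are, for one and hence any spectral
    parameter (Weyl).

    The only analytic tool is the fundamental theorem for absolutely continuous
    functions; it is derived from Cousin's lemma on gauges, hence without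
    Lebesgue's differentiation theorem. *)

(** The difficulty is that [theta_admissible] controls only the values of theta as z varies: a
    quasi-derivative is supplied for each z separately, without any regularity in z. Hence the
    differentiation at [lam] runs along a real sequence [lam + d n], and the coordinates of theta in
    the basis [u], [v] are recovered from two scalar facts at one point [x0]: the value of theta
    there and its unit Wronskian with phi. The second fact is usable because the bound
    [|phi - u| <= 2 |s - lam| om |u|] pins the coordinates of phi to (1, 0) at [a]; this is where
    the integrability of [u v r] enters. From [x0] to other points, convergence is transported by a
    contraction with factor 1/2. The same device carries square integrability from one spectral
    parameter to another, with theta(z) and phi(z) themselves as fundamental system. As everything
    happens near [a], the right end point is moved to some [b'] such that [u] and [v] have no zeros
    in (a, b'). *)

Section ComplexModulus.
Context {R : realType}.
Implicit Types z w : R[i].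

Lemma cmodE z : cmod z = Normc.normc z.
Proof. by case: z. Qed.

Lemma cmod0 : cmod (0 : R[i]) = 0.
Proof. by rewrite cmodE Normc.normc0. Qed.

Lemma cmod_ge0 z : 0 <= cmod z.
Proof. exact: sqrtr_ge0. Qed.

Lemma cmod_eq0 z : cmod z = 0 -> z = 0.
Proof. by rewrite cmodE => /Normc.eq0_normc. Qed.

Lemma cmod_gt0 z : z != 0 -> 0 < cmod z.
Proof. by move=> z0; rewrite lt_def cmod_ge0 andbT; apply: contra z0 => /eqP/cmod_eq0 ->. Qed.

Lemma cmodM z w : cmod (z * w) = cmod z * cmod w.
Proof. by rewrite !cmodE Normc.normcM. Qed.

Lemma cmodV z : cmod z^-1 = (cmod z)^-1.
Proof. by rewrite !cmodE Normc.normcV. Qed.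

Lemma cmodN z : cmod (- z) = cmod z.
Proof. by rewrite !cmodE normcN. Qed.

Lemma cmodD z w : cmod (z + w) <= cmod z + cmod w.
Proof. by rewrite !cmodE le_normcD. Qed.

Lemma cmodB z w : cmod (z - w) <= cmod z + cmod w.
Proof. by rewrite (le_trans (cmodD _ _))// cmodN. Qed.

Lemma cmodBC z w : cmod (z - w) = cmod (w - z).
Proof. by rewrite -cmodN opprB. Qed.

Lemma cmod_RC (x : R) : cmod (RC x) = `|x|.
Proof. by rewrite /cmod /RC /= expr0n addr0 sqrtr_sqr. Qed.

Lemma Re_le_cmod z : `|complex.Re z| <= cmod z.
Proof. by rewrite -sqrtr_sqr ler_wsqrtr// lerDl sqr_ge0. Qed.

Lemma RCD (x y : R) : RC (x + y) = RC x + RC y.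
Proof. by rewrite /RC rmorphD. Qed.
Lemma RCN (x : R) : RC (- x) = - RC x.
Proof. by rewrite /RC rmorphN. Qed.
Lemma RCB (x y : R) : RC (x - y) = RC x - RC y.
Proof. by rewrite /RC rmorphB. Qed.
Lemma RCM (x y : R) : RC (x * y) = RC x * RC y.
Proof. by rewrite /RC rmorphM. Qed.
Lemma RCV (x : R) : RC x^-1 = (RC x)^-1.
Proof. by rewrite /RC fmorphV. Qed.
Lemma RCX (x : R) n : RC (x ^+ n) = RC x ^+ n.
Proof. by rewrite /RC rmorphXn. Qed.
Lemma RC_eq0 (x : R) : (RC x == 0) = (x == 0).
Proof. by rewrite /RC fmorph_eq0. Qed.

Lemma ReD z w : complex.Re (z + w) = complex.Re z + complex.Re w.
Proof. by case: z w => ? ? []. Qed.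
Lemma ReN z : complex.Re (- z) = - complex.Re z.
Proof. by case: z. Qed.
Lemma ReB z w : complex.Re (z - w) = complex.Re z - complex.Re w.
Proof. by rewrite ReD ReN. Qed.
Lemma ReMRC (x : R) z : complex.Re (RC x * z) = x * complex.Re z.
Proof. by case: z => a b /=; rewrite mul0r subr0. Qed.
Lemma Im_real z : complex.Im z = 0 -> z = RC (complex.Re z).
Proof. by case: z => a b /= ->. Qed.

End ComplexModulus.

(** * Increment bounds by gauges *)

Section Cousin.
Context {R : realType}.
Implicit Types (c d : R).

(** Cousin's lemma recast as an induction on the right end point, which spares explicit tagged
    partitions: the supremum of the points satisfying [P] is itself a tag, so [P] is carried past it
    unless it equals [d]. *)
Lemma cousin_induction (P : R -> Prop) c d : c <= d ->
  (forall x, c <= x -> x <= d -> exists2 g : R, 0 < g & forall s t,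
     c <= s -> s <= x -> x <= t -> t <= d -> x - g < s -> t < x + g ->
     P s -> P t) ->
  P c -> P d.
Proof.
move=> cd step Pc.
pose S := [set y | c <= y <= d /\ P y].
have Sc : S c by split=> //; rewrite lexx.
have Sub : ubound S d by move=> y [/andP[]].
have hS : has_sup S by split; [exists c|exists d].
have cS : c <= sup S by apply: ub_le_sup => //; exists d.
have Sd : sup S <= d by apply: ge_sup => //; exists c.
have [g g0 gP] := step _ cS Sd.
have [s [sS Ps] gs] := sup_adherent g0 hS.
have sS' : s <= sup S by apply: ub_le_sup; [exists d|split].
have [cs sd] := andP sS.
(* Half the gauge keeps [t] strictly within the gauge of [sup S]; as [P t] forces [t <= sup S], the
   minimum must be [d]. *)
pose t := Num.min d (sup S + g / 2).
have St : sup S <= t by rewrite le_min Sd lerDl divr_ge0// ltW.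
have td : t <= d by rewrite ge_min lexx.
have tg : t < sup S + g.
  by rewrite gt_min; apply/orP; right; rewrite ltrD2l ltr_pdivrMr// mulr2n mulrDr mulr1 ltrDl.
have Pt : P t by apply: (gP s t).
have tS : t <= sup S.
  by apply: ub_le_sup; [exists d|split=> //; rewrite td (le_trans cS)].
move: tS; rewrite /t ge_min => /orP[dS|].
  by have -> : d = t by apply/le_anti; rewrite td (le_trans dS).
by rewrite leNgt ltrDl divr_gt0.
Qed.

(* An interval tagged by [x] in the bad set [N] is stored in a list, whose
   total length is controlled by [B]; absolute continuity then disposes of it. *)
Lemma cmod_increment_gauge (F : R -> R[i]) (N : set R) (G : R -> R) c d :
  c <= d -> AC_on F c d ->
  (forall x, c <= x -> x <= d -> ~ N x -> exists2 L, has_cderiv F x L &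
    exists2 g : R, 0 < g & forall s t,
     c <= s -> s <= x -> x <= t -> t <= d -> x - g < s -> t < x + g ->
     cmod L * (t - s) <= G t - G s) ->
  (forall del : R, 0 < del -> exists2 B : R -> R, B d - B c < del &
    (forall s t, c <= s -> s <= t -> t <= d -> B s <= B t) /\
    forall x, c <= x -> x <= d -> N x ->
    exists2 g : R, 0 < g & forall s t,
     c <= s -> s <= x -> x <= t -> t <= d -> x - g < s -> t < x + g ->
     t - s <= B t - B s) ->
  (forall s t, c <= s -> s <= t -> t <= d -> G s <= G t) ->
  cmod (F d - F c) <= G d - G c.
Proof.
move=> cd FAC good bad Gnd.
apply/ler_addgt0Pr => e e0.
(* One half of [e] is spent on the slope excess [e1] at good tags, the other on the increments over
   the stored intervals; the [+ 1] keeps the divisor positive when [c = d]. *)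
pose e1 := e / 2 / (d - c + 1).
have dc0 : 0 < d - c + 1 by rewrite ltr_wpDl ?subr_ge0.
have e10 : 0 < e1 by rewrite !divr_gt0.
have e20 : 0 < e / 2 by rewrite divr_gt0.
have [del del0 ACF] := FAC _ e20.
have [B Bdel [Bnd Bbad]] := bad _ del0.
pose inc (l : seq (R * R)) := \sum_(p <- l) cmod (F p.2 - F p.1).
pose len (l : seq (R * R)) := \sum_(p <- l) (p.2 - p.1).
pose ok (l : seq (R * R)) y := all (fun p => [&& c <= p.1, p.1 <= p.2 & p.2 <= y]) l.
pose P y := exists l : seq (R * R), [/\ ok l y,
  pairwise (fun p q => (p.2 <= q.1) || (q.2 <= p.1)) l,
  len l <= B y - B c &
  cmod (F y - F c) <= G y - G c + e1 * (y - c) + inc l].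
have : P d; last first.
  move=> [l [okl pl lenl incl]].
  apply: (le_trans incl); rewrite -addrA lerD2l.
  apply: (@le_trans _ _ (e / 2 + e / 2)); last by rewrite -splitr.
  apply: lerD.
    rewrite /e1 mulrAC ler_pdivrMr// ler_wpM2l ?(ltW e20)//.
    by rewrite lerDl.
  apply: ltW; rewrite /inc (big_nth (0, 0)) big_mkord.
  apply: ACF (fun k => (nth (0, 0) l k).1) (fun k => (nth (0, 0) l k).2) _ _ _.
  - by move=> k; have /(all_nthP (0, 0))/(_ k (ltn_ord k))/and3P[] := okl.
  - move=> k k' kk'.
    have /(pairwiseP (0, 0)) pl' := pl.
    case: (ltngtP k k') => [lt|lt|/ord_inj eq]; last by rewrite eq eqxx in kk'.
      by have /orP[] := pl' k k' (ltn_ord k) (ltn_ord k') lt; [left|right].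
    by have /orP[] := pl' k' k (ltn_ord k') (ltn_ord k) lt; [right|left].
  - rewrite (le_lt_trans _ (le_lt_trans lenl Bdel))//.
    by rewrite /len (big_nth (0, 0)) big_mkord.
apply: (cousin_induction cd); last first.
  exists [::]; split => //=; first by rewrite /len big_nil subrr.
  by rewrite /inc big_nil !subrr mulr0 !addr0 cmod0.
move=> x cx xd; have [Nx|Nx] := pselect (N x).
  have [g g0 gP] := Bbad _ cx xd Nx.
  exists g => // s t cs sx xt td gs tg [l [okl pl lenl incl]].
  have st : s <= t by exact: le_trans xt.
  exists ((s, t) :: l); split.
  - rewrite /ok /= cs st lexx /=; apply: sub_all okl => p /and3P[-> -> ps] /=.
    exact: le_trans st.
  - rewrite /= pl andbT; apply/allP => p pl' /=.
    by have /allP/(_ _ pl')/and3P[_ _ ->] := okl; rewrite orbT.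
  - rewrite /len big_cons /=.
    by have := gP s t cs sx xt td gs tg; rewrite -/(len l); move: lenl; lra.
  - rewrite /inc big_cons /= -/(inc l).
    have := cmodD (F t - F s) (F s - F c); rewrite subrKA.
    have := Gnd s t cs st td.
    have : e1 * (s - c) <= e1 * (t - c) by rewrite ler_wpM2l ?(ltW e10)// lerD2r.
    by lra.
have [L FL [g g0 gP]] := good _ cx xd Nx.
have [del1 del10 del1P] := FL _ e10.
exists (Num.min g del1); first by rewrite lt_min g0.
(* Increments are measured from the tag and added over its two sides; [h = 0] must be allowed
   because the tag may be an end point of [[s, t]]. *)
have key h : `|h| < del1 -> cmod (F (x + h) - F x) <= (cmod L + e1) * `|h|.
  move=> hdel; have [->|h0] := eqVneq h 0.
    by rewrite addr0 subrr cmod0 mulr_ge0// addr_ge0 ?cmod_ge0 ?ltW.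
  have hh : RC h != 0 by rewrite RC_eq0.
  rewrite -ler_pdivrMr ?normr_gt0// -cmod_RC -cmodV -cmodM.
  have -> : (F (x + h) - F x) * (RC h)^-1 = L + ((F (x + h) - F x) / RC h - L) by ring.
  by rewrite (le_trans (cmodD _ _))// lerD2l ltW// del1P.
move=> s t cs sx xt td gs tg [l [okl pl lenl incl]].
have st : s <= t by exact: le_trans xt.
exists l; split => //.
- by apply: sub_all okl => p /and3P[-> -> ps] /=; exact: le_trans st.
- by have := Bnd s t cs st td; move: lenl; lra.
- have /= Gst := gP s t cs sx xt td.
  have gm : Num.min g del1 <= g by rewrite ge_min lexx.
  have dm : Num.min g del1 <= del1 by rewrite ge_min lexx orbT.
  have {}Gst : cmod L * (t - s) <= G t - G s by apply: Gst; lra.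
  have k1 : cmod (F t - F x) <= (cmod L + e1) * (t - x).
    have := key (t - x); rewrite (_ : x + (t - x) = t); last by ring.
    rewrite ger0_norm ?subr_ge0//; apply.
    by lra.
  have k2 : cmod (F s - F x) <= (cmod L + e1) * (x - s).
    have := key (s - x); rewrite (_ : x + (s - x) = s); last by ring.
    rewrite distrC ger0_norm ?subr_ge0//; apply.
    by lra.
  have k3 := cmodD (F t - F x) (F x - F s); rewrite subrKA in k3.
  have k4 := cmodD (F t - F s) (F s - F c); rewrite subrKA in k4.
  rewrite cmodBC in k2.
  by lra.
Qed.

End Cousin.

(** * Lebesgue measure of intervals, open covers, and the gauges built from them *)

Section LebesgueBasics.
Context {R : realType}.
Local Notation mu := (@completed_lebesgue_measure R).
Local Notation LT := (LebT R).

Lemma leb_measurable (A : set R) : measurable A -> measurable (A : set LT).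
Proof. exact: sub_caratheodory. Qed.

Lemma leb_measurable_itv (i : interval R) : measurable ([set` i] : set LT).
Proof. by apply: leb_measurable; exact: measurable_itv. Qed.

Lemma leb_measurable_fun (D : set R) (f : R -> R) :
  measurable D -> measurable_fun D f -> measurable_fun (D : set LT) f.
Proof. by move=> mD mf _ Y mY; apply: leb_measurable; exact: mf. Qed.

Lemma leb_mu_itv (i : interval R) : mu [set` i] = lebesgue_measure [set` i].
Proof. by []. Qed.

Lemma leb_mu_oc (s t : R) : s <= t -> mu `]s, t]%classic = (t - s)%:E.
Proof.
move=> st; rewrite leb_mu_itv lebesgue_measure_itv/= lte_fin -EFinD.
by case: ltP => // ts; rewrite (_ : t = s) ?subrr//; apply/le_anti/andP.
Qed.

Lemma leb_mu_cc (s t : R) : s <= t -> mu `[s, t]%classic = (t - s)%:E.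
Proof.
move=> st; rewrite leb_mu_itv lebesgue_measure_itv/= lte_fin -EFinD.
by case: ltP => // ts; rewrite (_ : t = s) ?subrr//; apply/le_anti/andP.
Qed.

Lemma leb_open_cover (A : set LT) (e : R) : 0 < e ->
  exists U : set R, [/\ open U, A `<=` U & (mu U <= mu A + e%:E)%E].
Proof. exact: outer_measure_open_le. Qed.

Local Open Scope ereal_scope.

Lemma leb_oc_split (A : set LT) (c s t : R) : measurable A ->
  (c <= s)%R -> (s <= t)%R ->
  mu (A `&` `]c, t]) = mu (A `&` `]c, s]) + mu (A `&` `]s, t]).
Proof.
move=> mA cs st; rewrite -measureU//.
- rewrite -setIUr; congr (mu (_ `&` _)); apply/seteqP; split => x /=;
    rewrite !in_itv/=.
    by move=> /andP[cx xt]; case: (leP x s) => xs; [left|right]; apply/andP.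
  move=> [/andP[cx xs]|/andP[sx xt]]; apply/andP; split => //.
    exact: le_trans st.
  exact: le_lt_trans sx.
- by apply: measurableI => //; exact: leb_measurable_itv.
- by apply: measurableI => //; exact: leb_measurable_itv.
- apply/seteqP; split => x //= [[_ +] [_ +]]; rewrite !in_itv/= => /andP[_ xs].
  by rewrite ltNge xs.
Qed.

Lemma leb_oc_lt_pinfty (A : set LT) (c t : R) : (c <= t)%R -> measurable A ->
  mu (A `&` `]c, t]) <= (t - c)%:E.
Proof.
move=> ct mA; rewrite -leb_mu_oc// le_measure ?inE//.
- by apply: measurableI => //; exact: leb_measurable_itv.
- exact: leb_measurable_itv.
Qed.

Lemma leb_oc_sub (A : set LT) (s t : R) : (s <= t)%R ->
  `]s, t] `<=` A -> mu (A `&` `]s, t]) = (t - s)%:E.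
Proof. by move=> st sA; rewrite setIidr// leb_mu_oc. Qed.

Lemma leb_integrable_cst (s t k : R) :
  mu.-integrable (`[s, t]%classic : set LT) (EFin \o cst k).
Proof.
have mI : measurable (`[s, t]%classic : set LT) := leb_measurable_itv _.
apply/integrableP; split; first by apply/measurable_EFinP; exact: measurable_cst.
rewrite /= (integral_cst mu mI `|k%:E|). set m := (X in _ * X); have -> : m = lebesgue_measure `[s, t]%classic by []. rewrite lebesgue_measure_itv/=.
by case: ifP => _; rewrite ?mule0 ?ltry// lte_mul_pinfty ?ltry.
Qed.

Lemma leb_integral_cst (s t k : R) : (s <= t)%R ->
  \int[mu]_(x in (`[s, t]%classic : set LT)) k%:E = (k * (t - s))%:E.
Proof.
move=> st; have mI : measurable (`[s, t]%classic : set LT) := leb_measurable_itv _.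
rewrite (integral_cst mu mI k%:E); set m := (X in _ * X).
by have -> : m = (t - s)%:E by exact: leb_mu_cc.
Qed.

(* As in the Vitali--Caratheodory theorem, [G] is the indefinite integral of a
   lower semicontinuous majorant of [H], built from open covers of its level sets. *)
Lemma integrable_gauge (H : R -> R) (c d e : R) : (c <= d)%R -> (0 < e)%R ->
  mu.-integrable (`[c, d]%classic : set LT) (EFin \o H) ->
  (forall x, (c <= x)%R -> (x <= d)%R -> (0 <= H x)%R) ->
  exists G : R -> R, [/\ 
   (forall s t, (c <= s)%R -> (s <= t)%R -> (t <= d)%R -> (G s <= G t)%R),
   ((G d - G c)%:E <= \int[mu]_(x in (`[c, d]%classic : set LT)) (H x)%:E + e%:E) &
   forall x, (c <= x)%R -> (x <= d)%R ->
    exists2 g : R, (0 < g)%R & forall s t,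
     (c <= s)%R -> (s <= x)%R -> (x <= t)%R -> (t <= d)%R ->
     (x - g < s)%R -> (t < x + g)%R -> (H x * (t - s) <= G t - G s)%R].
Proof.
move=> cd e0 iH H0.
have dc0 : (0 < d - c + 1)%R by rewrite ltr_wpDl ?subr_ge0.
pose e1 := (e / 2 / (d - c + 1))%R.
have e20 : (0 < e / 2)%R by rewrite divr_gt0.
have e10 : (0 < e1)%R by rewrite divr_gt0.
pose I : set LT := `[c, d]%classic.
have mI : measurable I := leb_measurable_itv _.
(* [w k] is the upper value of the layer [E k], on which [H] lies between [k e1] and [(k + 1) e1];
   thus [w k <= H + e1] there, and the total excess [e1 (d - c)] is at most [e / 2]. *)
pose w (k : nat) : R := (k.+1%:R * e1)%R.
have w0 k : (0 < w k)%R by rewrite mulr_gt0.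
pose E (k : nat) : set LT := I `&` H @^-1` `[(k%:R * e1)%R, w k[.
have mH : measurable_fun I (H : LT -> R).
  by apply/measurable_EFinP; exact: measurable_int iH.
have mE k : measurable (E k) by apply: mH => //; exact: measurable_itv.
(* The excess measure of [U k] is divided by [w k] so that the weighted excesses sum to [e / 2]. *)
have /choice[U UP] : forall k, exists U : set R, [/\ open U, E k `<=` U &
    mu U <= mu (E k) + (e / 2 / (2 ^ k.+1)%:R / w k)%:E].
  by move=> k; apply: leb_open_cover; rewrite !divr_gt0.
have mU k : measurable (U k : set LT).
  by apply: leb_measurable; apply: open_measurable; case: (UP k).
(* [nu A] is the integral over [A] of the lower semicontinuous function that sums [w k] times the
   indicator of [U k]; it exceeds [H] on [[c, d]]. *)
pose nu (A : set LT) := \sum_(k <oo) ((w k)%:E * mu (U k `&` A)).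
have nu_ge0 A : 0 <= nu A.
  by apply: nneseries_ge0 => k _ _; rewrite mule_ge0// lee_fin ltW.
have nuD s t : (c <= s)%R -> (s <= t)%R ->
    nu `]c, t]%classic = nu `]c, s]%classic + nu `]s, t]%classic.
  move=> cs st; rewrite /nu -nneseriesD//.
  - by apply: eq_eseriesr => k _; rewrite (@leb_oc_split _ c s t)// ge0_muleDr.
  - by move=> k _ _; rewrite mule_ge0// lee_fin ltW.
  - by move=> k _ _; rewrite mule_ge0// lee_fin ltW.
have tE : trivIset setT E.
  apply/trivIsetP => i j _ _; wlog ij : i j / (i < j)%N => [hw|_].
    move=> /[dup] + ij; rewrite neq_ltn => /orP[/hw|/hw]; first exact.
    by rewrite setIC eq_sym; exact.
  apply/seteqP; split => x //= [[_ +] [_ +]]; rewrite /= !in_itv/=.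
  move=> /andP[_ Hi] /andP[jH _].
  have : (w i <= j%:R * e1)%R by rewrite ler_pM2r// ler_nat.
  by move=> /(lt_le_trans Hi); rewrite ltNge jH.
have iHe : mu.-integrable I (EFin \o (fun x => H x + e1)%R).
  have ic : mu.-integrable I (EFin \o cst e1).
    exact: leb_integrable_cst.
  exact: eq_integrable (integrableD mI iH ic).
have nud : nu `]c, d]%classic <= \int[mu]_(x in I) (H x)%:E + e%:E.
  have h1 : nu `]c, d]%classic <= \sum_(k <oo) ((w k)%:E * mu (E k) + (e / 2 / (2 ^ k.+1)%:R)%:E).
    apply: lee_nneseries => [k _ _|k _]; first by rewrite mule_ge0// lee_fin ltW.
    have [oU EU muU] := UP k.
    apply: (@le_trans _ _ ((w k)%:E * (mu (E k) + (e / 2 / (2 ^ k.+1)%:R / w k)%:E))).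
      rewrite lee_pmul2l ?lte_fin//; apply: le_trans muU.
      rewrite le_measure ?inE//.
      by apply: measurableI => //; exact: leb_measurable_itv.
    rewrite ge0_muleDr//; last by rewrite lee_fin divr_ge0 ?(ltW (w0 _))// divr_ge0// ltW.
    by rewrite -EFinM mulrC divfK// gt_eqF.
  apply: (le_trans h1); apply: (le_trans (epsilon_trick _ _ _)).
  - by move=> k; rewrite mule_ge0// lee_fin ltW.
  - exact: ltW.
  have h2 : \sum_(k <oo) ((w k)%:E * mu (E k)) <= \int[mu]_(x in I) (H x + e1)%:E.
    apply: (@le_trans _ _ (\sum_(k <oo) \int[mu]_(x in E k) (H x + e1)%:E)).
      apply: lee_nneseries => [k _ _|k _]; first by rewrite mule_ge0// lee_fin ltW.
      rewrite -(integral_cst mu (mE k)); apply: ge0_le_integral; first exact: mE.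
      - by move=> x _; rewrite lee_fin ltW.
      - exact: measurable_cst.
      - by apply: measurable_funS (measurable_int _ iHe); [exact: mI|move=> x []].
      - move=> x [_ +]; rewrite /= in_itv/= => /andP[+ _]; rewrite lee_fin /w.
        by rewrite -natr1 mulrDl mul1r lerD2r.
    have He0 x : I x -> 0 <= (H x + e1)%:E.
      by rewrite /I /= in_itv/= => /andP[cx xd]; rewrite lee_fin addr_ge0 ?H0// ltW.
    have EI : \bigcup_k E k `<=` I by move=> x [k _ []].
    rewrite -ge0_integral_bigcup; last 4 first.
    - exact: mE.
    - by apply: measurable_funS (measurable_int _ iHe); [exact: mI|].
    - by move=> x /EI/He0.
    - exact: tE.
    apply: ge0_subset_integral.
    - exact: bigcupT_measurable.
    - exact: mI.
    - exact: measurable_int iHe.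
    - exact: He0.
    - exact: EI.
  apply: (le_trans (leeD2r _ h2)).
  under eq_integral do rewrite EFinD.
  rewrite integralD_EFin//; last exact: leb_integrable_cst.
  rewrite -addeA leeD2l// leb_integral_cst// -EFinD lee_fin.
  rewrite [leRHS]splitr lerD2r /e1 mulrAC ler_pdivrMr// ler_wpM2l ?(ltW e20)//.
  by rewrite lerDl.
have fin_d : nu `]c, d]%classic \is a fin_num.
  rewrite ge0_fin_numE//; apply: (le_lt_trans nud).
  rewrite lte_add_pinfty ?ltry//.
  apply: (@le_lt_trans _ _ `|\int[mu]_(x in I) (H x)%:E|); first exact: lee_abs.
  by have := integrable_fin_num mI iH; rewrite fin_num_abs.
have fin s : (c <= s)%R -> (s <= d)%R -> nu `]c, s]%classic \is a fin_num.
  move=> cs sd; rewrite ge0_fin_numE//.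
  apply: (@le_lt_trans _ _ (nu `]c, d]%classic)); last by rewrite -ge0_fin_numE.
  by rewrite (nuD s d)// leeDl.
exists (fun y => fine (nu `]c, y]%classic)); split.
- move=> s t cs st td; apply: fine_le; rewrite ?fin// ?(le_trans st)// ?(le_trans cs)//.
  by rewrite (nuD s t)// leeDl.
- have -> : nu `]c, c]%classic = 0.
    rewrite /nu eseries0// => k _ _.
    by rewrite set_itvoc0// setI0 measure0 mule0.
  by rewrite subr0 fineK.
- move=> x cx xd.
  (* The layer containing [x]: since [U k] is a neighbourhood of [x], the term of index [k] alone
     already contributes the slope [w k > H x] on short intervals around [x]. *)
  pose k := Num.truncn (H x / e1).
  have Ek : E k x.
    split; first by rewrite /I /= in_itv/= cx.
    have /truncn_itv/andP[k1 k2] : (0 <= H x / e1)%R.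
      by rewrite divr_ge0 ?H0// ltW.
    by rewrite /preimage /= in_itv/= -ler_pdivlMr// k1/= /w -ltr_pdivrMr.
  have [oU EU _] := UP k.
  have /= : nbhs x (U k) by apply: open_nbhs_nbhs; split => //; exact: EU.
  move=> /nbhs_ballP[g /= g0 gU].
  exists g => // s t cs sx xt td gs tg.
  have st : (s <= t)%R := le_trans sx xt.
  rewrite -lee_fin EFinB !fineK ?fin// ?(le_trans cs)// ?(le_trans st)//.
  rewrite (nuD s t)// addeAC subee ?fin// ?(le_trans st)// add0e.
  apply: (@le_trans _ _ ((w k)%:E * mu (U k `&` `]s, t]))).
    rewrite leb_oc_sub//.
      rewrite -EFinM lee_fin ler_wpM2r ?subr_ge0// ltW//.
      by case: Ek => _; rewrite /= in_itv/= => /andP[].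
    move=> y /=; rewrite in_itv/= => /andP[sy yt]; apply: gU.
    by rewrite /ball/= ltr_norml; apply/andP; split; lra.
  rewrite /nu (@nneseriesD1 _ _ k)//; first by rewrite leeDl// nneseries_ge0// => *;
    rewrite mule_ge0// lee_fin ltW.
  by move=> j _; rewrite mule_ge0// lee_fin ltW.
Qed.

(** [B y] is the measure of the part of [U] between [c] and [y], where [U] is an open cover of the
    null set of measure at most [del / 2]: short intervals around a point of the set lie inside [U],
    where [B] has slope one. *)
Lemma negligible_gauge (N : set LT) (c d : R) : (c <= d)%R ->
  mu.-negligible N ->
  forall del : R, (0 < del)%R -> exists2 B : R -> R, (B d - B c < del)%R &
    (forall s t, (c <= s)%R -> (s <= t)%R -> (t <= d)%R -> (B s <= B t)%R) /\
    forall x, (c <= x)%R -> (x <= d)%R -> N x ->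
    exists2 g : R, (0 < g)%R & forall s t,
     (c <= s)%R -> (s <= x)%R -> (x <= t)%R -> (t <= d)%R ->
     (x - g < s)%R -> (t < x + g)%R -> (t - s <= B t - B s)%R.
Proof.
move=> cd [A [mA A0 NA]] del del0.
have del20 : (0 < del / 2)%R by rewrite divr_gt0.
have [U [oU AU muU]] := leb_open_cover A del20.
rewrite A0 add0e in muU.
have mU : measurable (U : set LT) by apply: leb_measurable; exact: open_measurable.
pose m y := mu (U `&` `]c, y]).
have mfin y : (c <= y)%R -> m y \is a fin_num.
  move=> cy; rewrite ge0_fin_numE//; apply: le_lt_trans (ltry (y - c)).
  exact: leb_oc_lt_pinfty.
exists (fun y => fine (m y)); last split.
- rewrite /m set_itvoc0// setI0 measure0 subr0 -lte_fin fineK ?mfin//.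
  apply: (@le_lt_trans _ _ (del / 2)%:E).
    apply: le_trans muU; apply: le_measure; rewrite ?inE//.
    by apply: measurableI => //; exact: leb_measurable_itv.
  by rewrite lte_fin ltr_pdivrMr// mulr2n mulrDr mulr1 ltrDl.
- move=> s t cs st td; apply: fine_le; rewrite ?mfin ?(le_trans cs)//.
  by rewrite /m (@leb_oc_split _ c s t)// leeDl.
- move=> x cx xd Nx.
  have /= : nbhs x U by apply: open_nbhs_nbhs; split => //; exact/AU/NA.
  move=> /nbhs_ballP[g /= g0 gU].
  exists g => // s t cs sx xt td gs tg.
  have st : (s <= t)%R := le_trans sx xt.
  rewrite -lee_fin [leRHS]EFinB !fineK ?mfin// ?(le_trans cs)//.
  rewrite /m (@leb_oc_split _ c s t)// addeAC subee ?mfin// add0e.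
  rewrite leb_oc_sub// => y /=; rewrite in_itv/= => /andP[sy yt]; apply: gU.
  by rewrite /ball/= ltr_norml; apply/andP; split; lra.
Qed.

(** A mean value inequality with an integrable bound: [integrable_gauge] serves the points where the
    derivative is bounded by [H], [negligible_gauge] the exceptional null set, and the slack [e] is
    arbitrary. *)
Lemma cmod_increment_le (F : R -> R[i]) (H : R -> R) (c d : R) : (c <= d)%R ->
  AC_on F c d ->
  mu.-integrable (`[c, d]%classic : set LT) (EFin \o H) ->
  (forall x, (c <= x)%R -> (x <= d)%R -> (0 <= H x)%R) ->
  {ae mu, forall x : LT, (c <= x)%R -> (x <= d)%R ->
     exists2 L, has_cderiv F x L & (cmod L <= H x)%R} ->
  (cmod (F d - F c) <= Rintegral mu (`[c, d]%classic : set LT) H)%R.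
Proof.
move=> cd FAC iH H0 aeF; apply/ler_addgt0Pr => e e0.
have mI : measurable (`[c, d]%classic : set LT) := leb_measurable_itv _.
have [G [Gnd Gle GH]] := integrable_gauge cd e0 iH H0.
have : (G d - G c <= Rintegral mu (`[c, d]%classic : set LT) H + e)%R.
  by rewrite -lee_fin [leRHS]EFinD /Rintegral fineK//; exact: integrable_fin_num iH.
apply: le_trans; apply: cmod_increment_gauge (negligible_gauge cd aeF) Gnd => //.
move=> x cx xd /= /contrapT /(_ cx xd)[L FL LH].
exists L => //; have [g g0 gP] := GH _ cx xd.
exists g => // s t cs sx xt td gs tg; apply: le_trans (gP _ _ cs sx xt td gs tg).
by rewrite ler_wpM2r// subr_ge0 (le_trans sx).
Qed.

End LebesgueBasics.

(** * Derivatives of complex valued functions of a real variable *)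

Section ComplexCalculus.
Context {R : realType}.
Implicit Types (f g q : R -> R[i]).

(** Written with the very quantifiers of [has_cderiv], so that a derivative is definitionally the
    [clim] of difference quotients and the limit rules apply to it without conversion. *)
Definition clim q (L : R[i]) : Prop := forall e : R, 0 < e -> exists2 del : R,
  0 < del & forall h : R, h != 0 -> `|h| < del -> cmod (q h - L) < e.

Lemma climP q L : clim q L <-> cmod (q h - L) @[h --> 0^'] --> (0 : R).
Proof.
split.
- move=> qL; apply/cvgrPdist_lt => e e0.
  have [del del0 delP] := qL _ e0.
  near=> h; rewrite sub0r normrN ger0_norm ?cmod_ge0//; apply: delP.
    by near: h; exact: nbhs_dnbhs_neq.
  by near: h; exact: dnbhs0_lt.
- move=> /cvgrPdist_lt qL e e0; have := qL _ e0.
  rewrite near_withinE => /nbhs_ballP[del /= del0 delP].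
  exists del => // h h0 hdel; have := delP h.
  rewrite /ball /= sub0r normrN => /(_ hdel h0).
  by rewrite sub0r normrN ger0_norm// cmod_ge0.
Unshelve. all: by end_near. Qed.

Lemma cvg0_dominated (u v : R -> R) : (forall h, 0 <= u h <= v h) ->
  v h @[h --> 0^'] --> (0 : R) -> u h @[h --> 0^'] --> (0 : R).
Proof.
move=> uv /cvgrPdist_lt v0; apply/cvgrPdist_lt => e /v0; apply: filterS => h.
have /andP[u0 uh] := uv h; rewrite !sub0r !normrN !ger0_norm//.
  exact: le_lt_trans.
exact: le_trans uh.
Qed.

Lemma clim_ext q q' L : (forall h, h != 0 -> q h = q' h) -> clim q L -> clim q' L.
Proof.
move=> qq' qL e e0; have [del del0 delP] := qL e e0.
by exists del => // h h0 hd; rewrite -qq'//; exact: delP.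
Qed.

Lemma clim_cst (c : R[i]) : clim (fun=> c) c.
Proof. by move=> e e0; exists 1 => // h _ _; rewrite subrr cmod0. Qed.

Lemma climD q q' L L' : clim q L -> clim q' L' -> clim (fun h => q h + q' h) (L + L').
Proof.
move=> /climP qL /climP qL'; apply/climP.
apply: (cvg0_dominated (v := fun h => cmod (q h - L) + cmod (q' h - L'))).
- move=> h; rewrite cmod_ge0/=.
  by rewrite (_ : _ - _ = (q h - L) + (q' h - L')) ?cmodD//; ring.
- by rewrite -[X in _ --> X]addr0; exact: cvgD.
Qed.

Lemma climM q q' L L' : clim q L -> clim q' L' -> clim (fun h => q h * q' h) (L * L').
Proof.
move=> /climP qL /climP qL'; apply/climP.
apply: (cvg0_dominated (v := fun h => cmod (q h - L) * cmod (q' h - L')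
   + (cmod (q h - L) * cmod L' + cmod L * cmod (q' h - L')))).
- move=> h; rewrite cmod_ge0/=.
  rewrite (_ : _ - _ = (q h - L) * (q' h - L') + ((q h - L) * L' + L * (q' h - L'))); last by ring.
  rewrite (le_trans (cmodD _ _))// cmodM lerD2l (le_trans (cmodD _ _))//.
  by rewrite !cmodM.
- rewrite -[X in _ --> X]addr0 -[X in _ + X]addr0; apply: cvgD; last apply: cvgD.
  + by rewrite -[X in _ --> X](mulr0 0); exact: cvgM.
  + by rewrite -[X in _ --> X](mul0r (cmod L')); apply: cvgM => //; exact: cvg_cst.
  + by rewrite -[X in _ --> X](mulr0 (cmod L)); apply: cvgM => //; exact: cvg_cst.
Qed.

Lemma climN q L : clim q L -> clim (fun h => - q h) (- L).
Proof.
move=> qL; have := climM (clim_cst (-1)) qL; rewrite mulN1r.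
by apply: clim_ext => h _; rewrite mulN1r.
Qed.

Lemma climV q L : L != 0 -> clim q L -> clim (fun h => (q h)^-1) L^-1.
Proof.
move=> L0 qL e e0; have L0' := cmod_gt0 L0.
(* The first bound keeps [cmod (q h)] above [cmod L / 2]; the second then absorbs the denominator
   [q h * L] of the difference of the inverses. *)
pose m := Num.min (cmod L / 2) (e * (cmod L / 2) * cmod L).
have m0 : 0 < m by rewrite lt_min divr_gt0//= !mulr_gt0// divr_gt0.
have [del del0 delP] := qL _ m0; exists del => // h h0 hd.
have := delP h h0 hd; rewrite lt_min => /andP[k1 k2].
have k3 : cmod L <= cmod (q h) + cmod (q h - L).
  by rewrite -{1}(subKr (q h) L) cmodB.
have k4 : cmod L / 2 < cmod (q h).
  by move: k1 k3; rewrite ltr_pdivlMr// ltr_pdivrMr//; lra.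
have q0 : q h != 0.
  apply: contraTneq k4 => ->; rewrite cmod0 -leNgt divr_ge0//; exact: cmod_ge0.
have -> : (q h)^-1 - L^-1 = (L - q h) / (q h * L).
  by field; rewrite q0 L0.
rewrite cmodM cmodV cmodM cmodBC ltr_pdivrMr ?mulr_gt0 ?cmod_gt0//.
apply: (lt_le_trans k2); rewrite [leRHS]mulrA ler_pM2r// ler_pM2l//; exact: ltW.
Qed.

Lemma has_cderivE f x L : has_cderiv f x L <-> clim (fun h => (f (x + h) - f x) / RC h) L.
Proof. by []. Qed.

Lemma has_cderiv_cvg f x L : has_cderiv f x L -> clim (fun h => f (x + h)) (f x).
Proof.
move=> fL; have hid : clim (fun h : R => RC h) 0.
  by move=> e e0; exists e => // h _; rewrite subr0 cmod_RC.
have := climD (clim_cst (f x)) (climM hid fL); rewrite mul0r addr0.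
apply: clim_ext => h h0; rewrite mulrC divfK ?RC_eq0//; by rewrite addrC subrK.
Qed.

Lemma has_cderiv_cst (c : R[i]) x : has_cderiv (fun=> c) x 0.
Proof. by apply/has_cderivE/(clim_ext (q := fun=> 0)) => [h _|]; [rewrite subrr mul0r|exact: clim_cst]. Qed.

Lemma has_cderiv_id (x : R) : has_cderiv (fun t => RC t) x 1.
Proof.
apply/has_cderivE/(clim_ext (q := fun=> 1)); last exact: clim_cst.
by move=> h h0; rewrite -RCB addrC addKr divff ?RC_eq0.
Qed.

Lemma has_cderivD f g x L M : has_cderiv f x L -> has_cderiv g x M ->
  has_cderiv (fun t => f t + g t) x (L + M).
Proof.
move=> fL gM; apply/has_cderivE; apply: clim_ext (climD fL gM) => h _.
by rewrite -mulrDl; congr (_ * _); ring.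
Qed.

Lemma has_cderivM f g x L M : has_cderiv f x L -> has_cderiv g x M ->
  has_cderiv (fun t => f t * g t) x (L * g x + f x * M).
Proof.
move=> fL gM; apply/has_cderivE.
apply: clim_ext (climD (climM fL (has_cderiv_cvg gM)) (climM (clim_cst (f x)) gM)) => h h0.
by have : RC h != 0 by [rewrite RC_eq0]; move: (f (x + h)) (g (x + h)) => fh gh h0'; field.
Qed.

Lemma has_cderivN f x L : has_cderiv f x L -> has_cderiv (fun t => - f t) x (- L).
Proof.
move=> fL; apply/has_cderivE; apply: clim_ext (climN fL) => h _.
by rewrite -mulNr; congr (_ * _); ring.
Qed.

Lemma has_cderivV f x L : f x != 0 -> has_cderiv f x L ->
  has_cderiv (fun t => (f t)^-1) x (- L / f x ^+ 2).
Proof.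
move=> f0 fL; apply/has_cderivE => e e0.
have fc := has_cderiv_cvg fL.
have [d1 d10 d1P] := fc _ (cmod_gt0 f0).
have fh0 h : h != 0 -> `|h| < d1 -> f (x + h) != 0.
  move=> h0 hd; apply: contraTneq (d1P h h0 hd) => ->.
  by rewrite sub0r cmodN ltxx.
have := climM (climN fL) (climM (climV f0 fc) (clim_cst (f x)^-1)).
rewrite -invfM => /(_ e e0)[d2 d20 d2P].
exists (Num.min d1 d2); first by rewrite lt_min d10.
move=> h h0; rewrite lt_min => /andP[hd1 hd2].
have := d2P h h0 hd2.
have hh : RC h != 0 by rewrite RC_eq0.
have := fh0 h h0 hd1; move: (f (x + h)) => w w0.
have -> : - ((w - f x) / RC h) * (w^-1 / f x) = (w^-1 - (f x)^-1) / RC h.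
  by field; rewrite hh f0 w0.
by rewrite expr2.
Qed.

Lemma has_cderiv_near f g x L (d : R) : 0 < d -> (forall h, `|h| < d -> f (x + h) = g (x + h)) ->
  has_cderiv f x L -> has_cderiv g x L.
Proof.
move=> d0 fg fL e e0; have [d1 d10 d1P] := fL _ e0.
exists (Num.min d d1); first by rewrite lt_min d0.
move=> h h0; rewrite lt_min => /andP[hd hd1].
rewrite -fg// -[g x]/(g x) -(addr0 x) -fg ?normr0// !addr0; exact: d1P.
Qed.

Lemma has_cderiv_Re f x L : has_cderiv f x L ->
  has_cderiv (cf (fun t => complex.Re (f t))) x (RC (complex.Re L)).
Proof.
move=> fL e e0; have [d d0 dP] := fL _ e0; exists d => // h h0 hd.
apply: le_lt_trans (dP h h0 hd).
have -> : (cf (fun t => complex.Re (f t)) (x + h) - cf (fun t => complex.Re (f t)) x) / RC h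
    - RC (complex.Re L) = RC (complex.Re ((f (x + h) - f x) / RC h - L)).
  rewrite /cf -RCB -RCV -RCM -RCB; congr RC.
  by rewrite [in RHS]ReB (mulrC (f (x + h) - f x)) ReMRC mulrC ReB.
by rewrite cmod_RC Re_le_cmod.
Qed.

End ComplexCalculus.

(** * Absolutely continuous functions on compact intervals *)

Section AbsoluteContinuity.
Context {R : realType}.
Implicit Types (f g : R -> R[i]) (c d : R).

Lemma AC_on_continuous f c d : AC_on f c d -> forall e : R, 0 < e -> exists2 del : R, 0 < del &
  forall x y, c <= x -> x <= d -> c <= y -> y <= d -> `|x - y| < del -> cmod (f x - f y) < e.
Proof.
move=> fAC e e0; have [del del0 delP] := fAC e e0; exists del => //.
have key x y : c <= x -> y <= d -> x <= y -> `|y - x| < del -> cmod (f y - f x) < e.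
  move=> cx yd xy xyd.
  have := delP 1%N (fun=> x) (fun=> y); rewrite !big_ord_recl !big_ord0 !addr0; apply.
  - by move=> _; rewrite cx.
  - by move=> k l; rewrite (ord1 k) (ord1 l) eqxx.
  - by apply: le_lt_trans xyd; exact: ler_norm.
move=> x y cx xd cy yd xyd; case: (leP x y) => xy; first by rewrite cmodBC key// distrC.
by rewrite key// ltW.
Qed.

Lemma AC_on_bounded f c d : AC_on f c d -> exists2 M : R, 0 < M &
  forall x, c <= x -> x <= d -> cmod (f x) <= M.
Proof.
move=> fAC; have [del del0 delP] := AC_on_continuous fAC (@ltr01 R).
case: (leP c d) => [cd|dc]; last first.
  by exists 1 => // x cx xd; move: (le_trans cx xd); rewrite leNgt dc.
pose P y := exists2 M : R, 0 < M & forall x, c <= x -> x <= y -> x <= d -> cmod (f x) <= M.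
have : P d; last by move=> [M M0 MP]; exists M => // x cx xd; exact: MP.
apply: (cousin_induction cd); last first.
  exists (cmod (f c) + 1); first by rewrite ltr_wpDl ?cmod_ge0.
  move=> x cx xc xd; rewrite (_ : x = c) ?lerDl//; apply/le_anti; rewrite cx xc//.
move=> x cx xd; exists del => // s t cs sx xt td gs tg [M M0 MP].
exists (M + (cmod (f x) + 1)).
  by rewrite ltr_pwDl// addr_ge0 ?cmod_ge0.
move=> y cy yt yd; case: (leP y s) => ys.
  by rewrite (le_trans (MP _ cy ys yd))// lerDl addr_ge0 ?cmod_ge0.
have : cmod (f y - f x) < 1.
  by apply: delP => //; rewrite ltr_norml; apply/andP; split; lra.
have := cmodD (f y - f x) (f x); rewrite subrK; lra.
Qed.

(** Common source of the closure properties (sums, products, inverses, real part, modulus), since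
    absolute continuity speaks of increments only. A statement about a single function takes
    [g := f], the second term being harmless slack. *)
Lemma AC_on_dominated f g h c d (M N : R) : 0 < M -> 0 < N ->
  AC_on f c d -> AC_on g c d ->
  (forall s t, c <= s -> s <= t -> t <= d ->
     cmod (h t - h s) <= M * cmod (f t - f s) + N * cmod (g t - g s)) ->
  AC_on h c d.
Proof.
move=> M0 N0 fAC gAC hfg e e0.
have eM : 0 < e / 2 / M by rewrite !divr_gt0.
have eN : 0 < e / 2 / N by rewrite !divr_gt0.
have [d1 d10 d1P] := fAC _ eM; have [d2 d20 d2P] := gAC _ eN.
exists (Num.min d1 d2); first by rewrite lt_min d10.
move=> n s t st ov; rewrite lt_min => /andP[sd1 sd2].
have := d1P n s t st ov sd1; have := d2P n s t st ov sd2.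
rewrite !ltr_pdivlMr// => k2 k1.
apply: (@le_lt_trans _ _ (\sum_(k < n) (M * cmod (f (t k) - f (s k)) + N * cmod (g (t k) - g (s k))))).
  by apply: ler_sum => k _; have [? [? ?]] := st k; exact: hfg.
rewrite big_split/= -!mulr_sumr.
by move: k1 k2; rewrite !(mulrC _ M) !(mulrC _ N); lra.
Qed.

Lemma AC_onD f g c d : AC_on f c d -> AC_on g c d -> AC_on (fun x => f x + g x) c d.
Proof.
move=> fAC gAC; apply: (AC_on_dominated ltr01 ltr01 fAC gAC) => s t _ _ _.
by rewrite !mul1r (_ : _ - _ = (f t - f s) + (g t - g s)) ?cmodD//; ring.
Qed.

Lemma AC_onN f c d : AC_on f c d -> AC_on (fun x => - f x) c d.
Proof.
move=> fAC; apply: (AC_on_dominated ltr01 ltr01 fAC fAC) => s t _ _ _.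
by rewrite !mul1r -opprD cmodN lerDl cmod_ge0.
Qed.

Lemma AC_onM f g c d : AC_on f c d -> AC_on g c d -> AC_on (fun x => f x * g x) c d.
Proof.
move=> fAC gAC; have [M M0 MP] := AC_on_bounded fAC; have [N N0 NP] := AC_on_bounded gAC.
apply: (AC_on_dominated N0 M0 fAC gAC) => s t cs st td.
rewrite (_ : _ - _ = g t * (f t - f s) + f s * (g t - g s)); last by ring.
rewrite (le_trans (cmodD _ _))// !cmodM lerD// ler_wpM2r ?cmod_ge0//.
  by rewrite NP// (le_trans cs).
by rewrite MP// (le_trans st).
Qed.

Lemma AC_on_lipschitz f c d (M : R) : 0 < M ->
  (forall s t, c <= s -> s <= t -> t <= d -> cmod (f t - f s) <= M * (t - s)) -> AC_on f c d.
Proof.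
move=> M0 fM e e0; exists (e / M); first exact: divr_gt0.
move=> n s t st ov; rewrite ltr_pdivlMr// mulrC => sd; apply: le_lt_trans sd.
by rewrite mulr_sumr; apply: ler_sum => k _; have [? [? ?]] := st k; exact: fM.
Qed.

Lemma AC_on_cst (z : R[i]) c d : AC_on (fun=> z) c d.
Proof.
by apply: (AC_on_lipschitz ltr01) => s t _ st _; rewrite subrr cmod0 mul1r subr_ge0.
Qed.

Lemma AC_on_id c d : AC_on (fun x : R => RC x) c d.
Proof.
apply: (AC_on_lipschitz ltr01) => s t _ st _.
by rewrite -RCB cmod_RC ger0_norm ?subr_ge0// mul1r.
Qed.

Lemma AC_on_Re f c d : AC_on f c d -> AC_on (cf (fun x => complex.Re (f x))) c d.
Proof.
move=> fAC; apply: (AC_on_dominated ltr01 ltr01 fAC fAC) => s t _ _ _.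
rewrite !mul1r /cf -RCB cmod_RC -ReB; apply: (le_trans (Re_le_cmod _)).
by rewrite lerDl cmod_ge0.
Qed.

Lemma AC_onV f c d (m : R) : 0 < m -> (forall x, c <= x -> x <= d -> m <= cmod (f x)) ->
  AC_on f c d -> AC_on (fun x => (f x)^-1) c d.
Proof.
move=> m0 fm fAC; have mm : 0 < m^-1 * m^-1 by rewrite mulr_gt0 ?invr_gt0.
apply: (AC_on_dominated mm mm fAC fAC) => s t cs st td.
have fs := fm s cs (le_trans st td); have ft := fm t (le_trans cs st) td.
have f0 x : m <= cmod (f x) -> f x != 0.
  by move=> mx; apply: contraTneq mx => ->; rewrite cmod0 -ltNge.
have s0 := f0 _ fs; have t0 := f0 _ ft.
have -> : (f t)^-1 - (f s)^-1 = (f s - f t) * ((f t)^-1 * (f s)^-1).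
  by field; rewrite s0 t0.
rewrite cmodM cmodBC mulrC (@le_trans _ _ (m^-1 * m^-1 * cmod (f t - f s)))//.
  rewrite ler_wpM2r ?cmod_ge0// cmodM !cmodV.
  by rewrite ler_pM ?invr_ge0 ?cmod_ge0// lef_pV2// ?posrE ?cmod_gt0.
by rewrite lerDl mulr_ge0 ?cmod_ge0// ltW.
Qed.

End AbsoluteContinuity.

(** * Real Lebesgue integrals *)

Section RealIntegral.
Context {R : realType}.
Local Notation mu := (@completed_lebesgue_measure R).
Local Notation LT := (LebT R).
Implicit Types (D E : set LT) (f g h : R -> R) (a : \bar R) (c d x y : R).

(** Membership in L^1(D); no logarithm is meant. *)
Definition Ln D f : Prop := mu.-integrable D (EFin \o f).
Local Notation Rint D f := (Rintegral mu D f).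

Lemma oo_axE c d : oo_ax c%:E d = `]c, d[%classic.
Proof.
by apply/seteqP; split => x; rewrite /oo_ax /= in_itv/= lte_fin; [case=> -> ->|move/andP].
Qed.

Lemma measurable_oo_ax a d : measurable (oo_ax a d).
Proof.
case: a => [c||].
- rewrite oo_axE; exact: leb_measurable_itv.
- rewrite (_ : oo_ax _ _ = set0); first exact: measurable0.
  by apply/seteqP; split => x //= [].
- rewrite (_ : oo_ax _ _ = `]-oo, d[%classic); first exact: leb_measurable_itv.
  apply/seteqP; split => x; rewrite /oo_ax /= in_itv/=; first by case.
  by rewrite ltNyr.
Qed.

Lemma Ln_measurable D f : Ln D f -> measurable_fun D (f : LT -> R).
Proof. by move=> fi; apply/measurable_EFinP; exact: measurable_int fi. Qed.

Lemma LnS D E f : measurable D -> measurable E -> E `<=` D -> Ln D f -> Ln E f.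
Proof. by move=> mD mE ED; exact: integrableS. Qed.

Lemma Ln_eq D f g : measurable D -> (forall x, D x -> f x = g x) -> Ln D f -> Ln D g.
Proof.
by move=> mD fg; apply: eq_integrable => // x; rewrite inE => /fg /= ->.
Qed.

Lemma LnD D f g : measurable D -> Ln D f -> Ln D g -> Ln D (fun x => f x + g x).
Proof. by move=> mD fi gi; exact: eq_integrable (integrableD mD fi gi). Qed.

Lemma LnZ D f k : measurable D -> Ln D f -> Ln D (fun x => k * f x).
Proof. by move=> mD fi; exact: eq_integrable (integrableZl mD k fi). Qed.

Lemma LnN D f : measurable D -> Ln D f -> Ln D (fun x => - f x).
Proof. by move=> mD fi; apply: Ln_eq (LnZ (-1) mD fi) => // x _; rewrite mulN1r. Qed.

Lemma LnB D f g : measurable D -> Ln D f -> Ln D g -> Ln D (fun x => f x - g x).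
Proof. by move=> mD fi gi; apply: LnD => //; exact: LnN. Qed.

Lemma Ln_norm D f : measurable D -> Ln D f -> Ln D (fun x => `|f x|).
Proof. by move=> mD fi; exact: integrable_norm. Qed.

Lemma Ln_le D f g : measurable D -> measurable_fun D (f : LT -> R) ->
  (forall x, D x -> `|f x| <= g x) -> Ln D g -> Ln D f.
Proof.
move=> mD mf fg gi; apply: (le_integrable mD _ _ gi).
- exact/measurable_EFinP.
- move=> x Dx /=; rewrite lee_fin (le_trans (fg _ Dx))//; exact: ler_norm.
Qed.

Lemma LnM D f h (M : R) : measurable D -> measurable_fun D (h : LT -> R) ->
  (forall x, D x -> `|h x| <= M) -> Ln D f -> Ln D (fun x => h x * f x).
Proof.
move=> mD mh hM fi; apply: (Ln_le (g := fun x => M * `|f x|) mD).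
- by apply: (measurable_funM mh); exact: Ln_measurable.
- by move=> x Dx; rewrite normrM ler_wpM2r// hM.
- by apply: (LnZ _ mD); exact: Ln_norm.
Qed.

Lemma Ln_lty D f : measurable D -> measurable_fun D (f : LT -> R) ->
  (\int[mu]_(x in D) `|f x|%:E < +oo)%E -> Ln D f.
Proof. by move=> mD mf fi; apply/integrableP; split => //; exact/measurable_EFinP. Qed.

Lemma Rint_null D E f : measurable D -> measurable E -> mu E = 0%E -> Ln D f ->
  Rint D f = Rint (D `\` E) f.
Proof.
by move=> mD mE E0 fi; congr fine; exact: negligible_integral.
Qed.

Lemma leb_mu_countable E : countable E -> mu E = 0%E.
Proof. exact: countable_lebesgue_measure0. Qed.

Lemma Rint_cc c d f : Ln `[c, d]%classic f -> Rint `[c, d]%classic f = Rint (oo_ax c%:E d) f.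
Proof.
move=> fi; have mI : measurable (`[c, d]%classic : set LT) := leb_measurable_itv _.
have mc : countable ([set c; d] : set R) by exact/finite_set_countable/finite_set2.
rewrite (@Rint_null _ [set c; d])//.
- congr Rintegral; apply/seteqP; split => x; rewrite oo_axE /= !in_itv/=.
    move=> [/andP[cx xd] /not_orP[/eqP xc /eqP xd']].
    by rewrite !lt_neqAle xd' xd cx eq_sym xc.
  move=> /andP[cx xd]; split; first by rewrite !ltW.
  by move=> [] xE; move: cx xd; rewrite xE ltxx.
- by apply: leb_measurable; apply: countable_measurable.
- exact: leb_mu_countable.
Qed.

Lemma Ln_cc_oo c d f : Ln `[c, d]%classic f -> Ln (oo_ax c%:E d) f.
Proof.
apply: LnS; [exact: leb_measurable_itv|exact: measurable_oo_ax|].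
by rewrite oo_axE => x /=; rewrite !in_itv/= => /andP[/ltW -> /ltW ->].
Qed.

Lemma Rint_split a y x f : (a < y%:E)%E -> y < x -> Ln (oo_ax a x) f ->
  Rint (oo_ax a x) f = Rint (oo_ax a y) f + Rint (oo_ax y%:E x) f.
Proof.
move=> ay yx fi; have mo := measurable_oo_ax.
rewrite (@Rint_null _ [set y])//; last 2 first.
- by apply: leb_measurable; exact: measurable_set1.
- exact: leb_mu_countable.
have -> : oo_ax a x `\ y = oo_ax a y `|` oo_ax y%:E x.
  apply/seteqP; split => t /=; rewrite /oo_ax /=.
    move=> [[at_ tx] /eqP ty]; case: (ltgtP t y) => tyy.
    - by left.
    - by right; rewrite lte_fin.
    - by rewrite tyy eqxx in ty.
  move=> [[at_ ty]|[yt tx]].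
    by split; [split => //; exact: lt_trans yx|move=> E; rewrite E ltxx in ty].
  rewrite lte_fin in yt; split; last by move=> E; rewrite E ltxx in yt.
  by split => //; apply: lt_trans ay _; rewrite lte_fin.
rewrite Rintegral_setU//.
- apply: LnS fi => //; first exact: measurableU.
  move=> t [[at_ ty]|[yt tx]]; split => //; first exact: lt_trans yx.
  exact: lt_trans yt.
- apply/disj_set2P/seteqP; split => t //= [[_ ty] [yt _]].
  by move: yt; rewrite lte_fin ltNge ltW.
Qed.

Lemma Ln_sub a x y f : y <= x -> Ln (oo_ax a x) f -> Ln (oo_ax a y) f.
Proof.
move=> yx; apply: LnS; try exact: measurable_oo_ax.
by move=> t [at_ ty]; split => //; exact: lt_le_trans yx.
Qed.

Lemma normrB_le_bound (s t m : R) : 0 <= s -> s <= m -> 0 <= t -> t <= m ->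
  `|s - t| <= m.
Proof. by move=> *; rewrite ler_norml; apply/andP; split; lra. Qed.

(* [integral] is monotone even on non-measurable functions, so the measurability
   of the iterates [phin] never has to be established. *)
Lemma normr_Rint_le D f g : (forall x, D x -> `|f x| <= g x) -> Ln D g -> measurable D ->
  `|Rint D f| <= Rint D g.
Proof.
move=> fg gi mD.
(* The integral of a nonnegative function is a supremum over the simple functions below it, and a
   larger integrand admits more of them. *)
have nn (k l : LT -> \bar R) : (forall x, D x -> 0 <= k x)%E -> (forall x, D x -> k x <= l x)%E ->
    (\int[mu]_(x in D) k x <= \int[mu]_(x in D) l x)%E.
  move=> k0 kl; have l0 x : D x -> (0 <= l x)%E by move=> Dx; apply: le_trans (kl _ Dx); exact: k0.
  rewrite !ge0_integralE//; apply: ge_ereal_sup => _ [h /= hk <-].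
  apply: ereal_sup_ubound; exists h => //= x; apply: (le_trans (hk x)).
  by apply: lee_restrict.
have gfin : (\int[mu]_(x in D) (g x)%:E)%E \is a fin_num by exact: integrable_fin_num gi.
have g0 x : D x -> 0 <= g x by move=> Dx; exact: le_trans (fg _ Dx).
have bnd (k : LT -> \bar R) : (forall x, D x -> 0 <= k x <= (g x)%:E)%E ->
    (0 <= \int[mu]_(x in D) k x <= \int[mu]_(x in D) (g x)%:E)%E.
  move=> kg; apply/andP; split; first by apply: integral_ge0 => x /kg/andP[].
  by apply: nn => x /kg/andP[].
have /bnd/andP[p0 pg] : forall x, D x -> (0 <= (EFin \o f)^\+ x <= (g x)%:E)%E.
  move=> x Dx; rewrite funepos_ge0 funeposE /= -EFin_max lee_fin ge_max g0// andbT.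
  exact: le_trans (ler_norm _) (fg _ Dx).
have /bnd/andP[n0 ng] : forall x, D x -> (0 <= (EFin \o f)^\- x <= (g x)%:E)%E.
  move=> x Dx; rewrite funeneg_ge0 funenegE /= -EFin_max lee_fin ge_max g0// andbT.
  by rewrite (le_trans _ (fg _ Dx))// -normrN ler_norm.
have pfin : (\int[mu]_(x in D) (EFin \o f)^\+ x)%E \is a fin_num.
  by rewrite ge0_fin_numE// (le_lt_trans pg)// -ge0_fin_numE// integral_ge0// => x Dx; rewrite lee_fin g0.
have nfin : (\int[mu]_(x in D) (EFin \o f)^\- x)%E \is a fin_num.
  by rewrite ge0_fin_numE// (le_lt_trans ng)// -ge0_fin_numE// integral_ge0// => x Dx; rewrite lee_fin g0.
have -> : Rint D f = fine (\int[mu]_(x in D) (EFin \o f)^\+ x)%E - fine (\int[mu]_(x in D) (EFin \o f)^\- x)%E.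
  by rewrite -fineB// /Rintegral integralE.
apply: normrB_le_bound; rewrite ?fine_ge0//; exact: fine_le.
Qed.

End RealIntegral.

(** * The fundamental theorem of calculus for absolutely continuous functions *)

Section FundamentalTheorem.
Context {R : realType}.
Local Notation mu := (@completed_lebesgue_measure R).
Local Notation LT := (LebT R).
Local Notation Rint D f := (Rintegral mu (D : set LT) f).

(* The modulus bound is applied to [F + n x]; as [n] grows [|G + n| - n] tends
   to [G] dominatedly. *)
Lemma FTC_AC_le (F G : R -> R) (c d : R) : c <= d -> AC_on (cf F) c d ->
  Ln (`[c, d]%classic : set LT) G ->
  {ae mu, forall x : LT, c <= x -> x <= d -> has_cderiv (cf F) x (RC (G x))} ->
  F d - F c <= Rint `[c, d]%classic G.
Proof.
move=> cd FAC iG aeF; have mI : measurable (`[c, d]%classic : set LT) := leb_measurable_itv _.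
have icst k : Ln (`[c, d]%classic : set LT) (fun=> k) := leb_integrable_cst c d k.
have Rcst k : Rint `[c, d]%classic (fun=> k) = k * (d - c).
  by rewrite /Rintegral leb_integral_cst.
pose Gn (n : nat) x := `|G x + n%:R| - n%:R.
have iabs n : Ln (`[c, d]%classic : set LT) (fun x => `|G x + n%:R|).
  by apply: (Ln_norm mI); exact: LnD.
have iGn n : Ln (`[c, d]%classic : set LT) (Gn n).
  by apply: (LnB mI) (icst _).
have step n : F d - F c <= Rint `[c, d]%classic (Gn n).
  rewrite (RintegralB mI (iabs n) (icst n%:R)) Rcst.
  have Fn : AC_on (fun x => cf F x + RC n%:R * RC x) c d.
    by apply: AC_onD => //; apply: AC_onM; [exact: AC_on_cst|exact: AC_on_id].
  have : cmod ((cf F d + RC n%:R * RC d) - (cf F c + RC n%:R * RC c)) <=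
      Rint `[c, d]%classic (fun x => `|G x + n%:R|).
    apply: (cmod_increment_le cd Fn).
    - exact: iabs.
    - by move=> x _ _.
    - apply: filterS aeF => x Fx cx xd; exists (RC (G x + n%:R)); last by rewrite cmod_RC.
      rewrite RCD; apply: has_cderivD; first exact: Fx.
      have := has_cderivM (has_cderiv_cst (RC n%:R) x) (has_cderiv_id x).
      by rewrite mul0r add0r mulr1.
  rewrite /cf -!RCM -!RCD -RCB cmod_RC => h.
  have := le_trans (ler_norm _) h; lra.
have Gcvg : (fun n => Rint `[c, d]%classic (Gn n)) @ \oo --> Rint `[c, d]%classic G.
  apply: fine_cvg; rewrite [X in _ --> X]fineK; last exact: integrable_fin_num iG.
  have [] := @dominated_convergence _ _ _ mu _ mI (fun n x => (Gn n x)%:E) (EFin \o G) (fun x => `|G x|%:E).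
  - by move=> n; exact: measurable_int (iGn n).
  - exact: measurable_int iG.
  (* At a fixed [x] the sequence is eventually constant: once [n >= - G x] the modulus opens and
     [Gn n x = G x]. *)
  - apply: aeW => x _; apply: cvg_near_cst; near=> n.
    rewrite /Gn /= ger0_norm ?addrK//.
    have : - G x <= n%:R by near: n; exact: nbhs_infty_ger.
    lra.
  - exact: Ln_norm.
  - apply: aeW => x n _; rewrite /Gn /= lee_fin.
    have h1 := ler_normD (G x) n%:R; have h2 := ler_normB (G x + n%:R) (G x).
    move: h1 h2; rewrite addrAC subrr add0r normr_nat => h1 h2.
    by rewrite ler_norml; apply/andP; split; lra.
  - by move=> _ _.
apply: cvgr_to_ge Gcvg _; exact: nearW.
Unshelve. all: by end_near. Qed.

(** The one-sided bound is applied to [F] and to [- F]; dropping the end points of [[c, d]] does not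
    change the integral. *)
Lemma FTC_AC (F G : R -> R) (c d : R) : c <= d -> AC_on (cf F) c d ->
  Ln (`[c, d]%classic : set LT) G ->
  {ae mu, forall x : LT, c <= x -> x <= d -> has_cderiv (cf F) x (RC (G x))} ->
  F d - F c = Rint (oo_ax c%:E d) G.
Proof.
move=> cd FAC iG aeF; have mI : measurable (`[c, d]%classic : set LT) := leb_measurable_itv _.
rewrite -Rint_cc//; apply/le_anti/andP; split; first exact: FTC_AC_le.
have cfN : (fun x => - cf F x) = cf (fun x => - F x) by apply/funext => x; rewrite /cf RCN.
have := @FTC_AC_le (fun x => - F x) (fun x => - G x) c d cd.
have -> : Rint `[c, d]%classic (fun x => - G x) = - Rint `[c, d]%classic G.
  by rewrite -[RHS]mulN1r -RintegralZl//; apply: eq_Rintegral => x _; rewrite mulN1r.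
rewrite -cfN => /(_ (AC_onN FAC) (LnN mI iG)) h.
rewrite -lerN2; apply: le_trans (h _); first by lra.
by apply: filterS aeF => x Fx cx xd; rewrite RCN; apply: has_cderivN; exact: Fx.
Qed.

End FundamentalTheorem.

(** * The interval (a, b) and locally absolutely continuous functions on it *)

Section OpenInterval.
Context {R : realType} (a b : \bar R).
Local Notation mu := (@completed_lebesgue_measure R).
Local Notation LT := (LebT R).
Local Notation I := (@oo_itv R a b).
Local Notation Rint D f := (Rintegral mu (D : set LT) f).

Lemma oo_itv_between c d x : I c -> I d -> c <= x -> x <= d -> I x.
Proof.
move=> [ac _] [_ db] cx xd; split; first by apply: (lt_le_trans ac); rewrite lee_fin.
by apply: le_lt_trans db; rewrite lee_fin.
Qed.

Lemma oo_itv_lt x : I x -> exists2 c, I c & c < x.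
Proof.
move=> [ax xb]; have key c : c < x -> (a < c%:E)%E -> exists2 c, I c & c < x.
  by move=> cx ac; exists c => //; split => //; apply: lt_trans xb; rewrite lte_fin.
case: a ax key => [r||] //= ax key.
- rewrite lte_fin in ax; apply: (key ((r + x) / 2)); rewrite ?lte_fin;
    by rewrite ?ltr_pdivrMr ?ltr_pdivlMr//; lra.
- by apply: (key (x - 1)); rewrite ?ltNyr//; lra.
Qed.

Lemma oo_itv_gt x : I x -> exists2 d, I d & x < d.
Proof.
move=> [ax xb]; have key d : x < d -> (d%:E < b)%E -> exists2 d, I d & x < d.
  by move=> cx ac; exists d => //; split => //; apply: (lt_trans ax); rewrite lte_fin.
case: b xb key => [r||] //= xb key.
- rewrite lte_fin in xb; apply: (key ((r + x) / 2)); rewrite ?lte_fin;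
    by rewrite ?ltr_pdivrMr ?ltr_pdivlMr//; lra.
- by apply: (key (x + 1)); rewrite ?ltry//; lra.
Qed.

Lemma oo_itv_open : open (I : set R).
Proof.
rewrite openE => x Ix; have [c Ic cx] := oo_itv_lt Ix; have [d Id xd] := oo_itv_gt Ix.
apply: (@filterS _ _ _ `]c, d[%classic).
  by move=> y /=; rewrite in_itv/= => /andP[/ltW cy /ltW yd]; exact: oo_itv_between cy yd.
by apply: open_nbhs_nbhs; split; [exact: itv_open|rewrite /= in_itv/= cx].
Qed.

Lemma measurable_oo_itv : measurable (I : set LT).
Proof. by apply: leb_measurable; apply: open_measurable; exact: oo_itv_open. Qed.

Lemma AC_loc_continuous (f : R -> R[i]) : AC_loc I f -> forall x, I x -> forall e : R, 0 < e ->
  exists2 del : R, 0 < del & forall y, `|y - x| < del -> I y /\ cmod (f y - f x) < e.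
Proof.
move=> fAC x Ix e e0.
have [c Ic cx] := oo_itv_lt Ix; have [d Id xd] := oo_itv_gt Ix.
have cd := ltW (lt_trans cx xd).
have [del del0 delP] := AC_on_continuous (fAC c d Ic Id cd) e0.
exists (Num.min del (Num.min (x - c) (d - x))).
  by rewrite !lt_min del0 !subr_gt0 cx.
move=> y; rewrite !lt_min => /and3P[y1 y2 y3].
have [cy yd] : c <= y /\ y <= d.
  by move: y2 y3; rewrite !ltr_norml => /andP[? _] /andP[_ ?]; split; lra.
split; first exact: oo_itv_between cy yd.
by apply: delP => //; exact: ltW.
Qed.

Lemma AC_loc_cvg (f : R -> R) : AC_loc I (cf f) -> forall x, I x -> {for x, continuous f}.
Proof.
move=> fAC x Ix; apply/cvgrPdist_lt => e e0.
have [del del0 delP] := AC_loc_continuous fAC Ix e0.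
apply/nbhs_ballP; exists del => // y /=; rewrite /ball /= distrC => /delP[_].
by rewrite /cf -RCB cmod_RC distrC.
Qed.

Lemma AC_loc_measurable (f : R -> R) : AC_loc I (cf f) -> measurable_fun (I : set LT) (f : LT -> R).
Proof.
move=> fAC; apply: leb_measurable_fun; first by apply: open_measurable; exact: oo_itv_open.
apply: open_continuous_measurable_fun; first exact: oo_itv_open.
by move=> x /set_mem; exact: AC_loc_cvg.
Qed.

Lemma AC_locD (f g : R -> R[i]) : AC_loc I f -> AC_loc I g -> AC_loc I (fun x => f x + g x).
Proof. by move=> fAC gAC c d Ic Id cd; apply: AC_onD; [exact: fAC|exact: gAC]. Qed.

Lemma AC_locN (f : R -> R[i]) : AC_loc I f -> AC_loc I (fun x => - f x).
Proof. by move=> fAC c d Ic Id cd; apply: AC_onN; exact: fAC. Qed.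

Lemma AC_locM (f g : R -> R[i]) : AC_loc I f -> AC_loc I g -> AC_loc I (fun x => f x * g x).
Proof. by move=> fAC gAC c d Ic Id cd; apply: AC_onM; [exact: fAC|exact: gAC]. Qed.

Lemma AC_loc_Re (f : R -> R[i]) : AC_loc I f -> AC_loc I (cf (fun x => complex.Re (f x))).
Proof. by move=> fAC c d Ic Id cd; apply: AC_on_Re; exact: fAC. Qed.

Lemma AC_loc_cmod (f : R -> R[i]) : AC_loc I f -> AC_loc I (cf (fun x => cmod (f x))).
Proof.
move=> fAC c d Ic Id cd; have := fAC c d Ic Id cd => fcd.
apply: (AC_on_dominated ltr01 ltr01 fcd fcd) => s t _ _ _.
rewrite !mul1r /cf -RCB cmod_RC ler_norml.
have h1 := cmodD (f t - f s) (f s); have h2 := cmodB (f t - f s) (f t).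
have := cmod_ge0 (f t - f s).
move: h1 h2; rewrite subrK addrAC subrr sub0r cmodN => h1 h2 h3.
by apply/andP; split; lra.
Qed.

Lemma AC_locM_real (f g : R -> R) : AC_loc I (cf f) -> AC_loc I (cf g) ->
  AC_loc I (cf (fun x => f x * g x)).
Proof.
move=> fAC gAC; have := AC_locM fAC gAC.
by congr AC_loc; apply/funext => x; rewrite /cf RCM.
Qed.

Lemma AC_loc_bounded (f : R -> R) c d : AC_loc I (cf f) -> I c -> I d ->
  exists2 M : R, 0 < M & forall x, c <= x -> x <= d -> `|f x| <= M.
Proof.
move=> fAC Ic Id; have [cd|dc] := leP c d; last first.
  by exists 1 => // x cx xd; move: (le_trans cx xd); rewrite leNgt dc.
have [M M0 MP] := AC_on_bounded (fAC c d Ic Id cd).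
by exists M => // x cx xd; rewrite -cmod_RC; exact: MP.
Qed.

Lemma Ln_AC_mul (h r : R -> R) c d : AC_loc I (cf h) -> L1loc I r -> I c -> I d ->
  Ln (`[c, d]%classic : set LT) (fun x => h x * r x).
Proof.
move=> hAC ri Ic Id; have [M M0 MP] := AC_loc_bounded hAC Ic Id.
apply: (LnM (M := M)); first exact: leb_measurable_itv.
- apply: measurable_funS (AC_loc_measurable hAC); first exact: measurable_oo_itv.
  by move=> x /=; rewrite in_itv/= => /andP[cx xd]; exact: oo_itv_between cx xd.
- by move=> x /=; rewrite in_itv/= => /andP[]; exact: MP.
- exact: ri.
Qed.

End OpenInterval.

(** * Lagrange's identity for Wronskians *)

Section Lagrange.
Context {R : realType} (a b : \bar R) (p q r : R -> R).
Local Notation mu := (@completed_lebesgue_measure R).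
Local Notation LT := (LebT R).
Local Notation I := (@oo_itv R a b).
Local Notation Rint D f := (Rintegral mu (D : set LT) f).

Lemma standing_ae : standing a b p q r ->
  {ae mu, forall x : LT, I x -> 0 < p x /\ 0 < r x}.
Proof.
move=> [_ [_ [_ [_ [r0 [_ [p0 _]]]]]]].
apply: (filterS _ (filterI r0 p0)) => x [rx px] Ix.
by split; [exact: px|exact: rx].
Qed.

Lemma standing_r : standing a b p q r -> L1loc I r.
Proof. by move=> [_ [_ [_ [_ [_ [? _]]]]]]. Qed.

Lemma AC_loc_wr (f f1 g g1 : R -> R[i]) : AC_loc I f -> AC_loc I f1 -> AC_loc I g ->
  AC_loc I g1 -> AC_loc I (wr f f1 g g1).
Proof.
by move=> ? ? ? ?; apply: AC_locD; [exact: AC_locM|apply: AC_locN; exact: AC_locM].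
Qed.

(** In the product rule the terms [f1 * g1 / p] cancel, and so do the terms with [q]; only the
    difference of the spectral parameters survives. *)
Lemma wr_deriv z w f f1 g g1 : standing a b p q r ->
  is_sol I p q r z f f1 -> is_sol I p q r w g g1 ->
  {ae mu, forall x : LT, I x ->
     has_cderiv (wr f f1 g g1) x ((z - w) * RC (r x) * (f x * g x))}.
Proof.
move=> st [[fAC [f1AC fd]] f1d] [[gAC [g1AC gd]] g1d].
apply: (filterS _ (filterI (standing_ae st) (filterI (filterI fd f1d) (filterI gd g1d)))) => x [pr [[xfd xf1d] [xgd xg1d]]] Ix.
have [p0 r0] := pr Ix; have [Lf hf ef] := xfd Ix; have [Lf1 hf1 ef1] := xf1d Ix.
have [Lg hg eg] := xgd Ix; have [Lg1 hg1 eg1] := xg1d Ix.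
have rr : RC (r x) != 0 by rewrite RC_eq0 gt_eqF.
have pp : RC (p x) != 0 by rewrite RC_eq0 gt_eqF.
have -> : (z - w) * RC (r x) * (f x * g x) =
    (Lf * g1 x + f x * Lg1) + - (Lf1 * g x + f1 x * Lg).
  have -> : Lf1 = RC (q x) * f x - RC (r x) * (z * f x) by rewrite -ef1; field.
  have -> : Lg1 = RC (q x) * g x - RC (r x) * (w * g x) by rewrite -eg1; field.
  by rewrite ef eg; ring.
by apply: has_cderivD; [exact: has_cderivM|apply: has_cderivN; exact: has_cderivM].
Qed.

(** Form of the identity for complex parameters, where only a real integral occurs. For [z = w] it
    says that the Wronskian is constant. *)
Lemma lagrange_le z w f f1 g g1 x y : standing a b p q r ->
  is_sol I p q r z f f1 -> is_sol I p q r w g g1 -> I y -> I x -> y <= x ->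
  cmod (wr f f1 g g1 x - wr f f1 g g1 y) <=
  cmod (z - w) * Rint `[y, x]%classic (fun t => cmod (f t) * cmod (g t) * `|r t|).
Proof.
move=> st fs gs Iy Ix yx.
have mI : measurable (`[y, x]%classic : set LT) := leb_measurable_itv _.
have [[fAC [f1AC _]] _] := fs; have [[gAC [g1AC _]] _] := gs.
have ii : Ln (`[y, x]%classic : set LT) (fun t => cmod (f t) * cmod (g t) * `|r t|).
  have := Ln_AC_mul (AC_locM_real (AC_loc_cmod fAC) (AC_loc_cmod gAC)) (standing_r st) Iy Ix.
  move=> /(Ln_norm mI); apply: Ln_eq => // t _.
  by rewrite normrM ger0_norm// mulr_ge0// cmod_ge0.
rewrite -RintegralZl//; apply: cmod_increment_le => //.
- by apply: AC_loc_wr.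
- exact: LnZ.
- by move=> t _ _; rewrite !mulr_ge0 ?cmod_ge0.
- apply: filterS (wr_deriv st fs gs) => t tP yt tx.
  exists ((z - w) * RC (r t) * (f t * g t)); first exact/tP/(oo_itv_between Iy Ix yt tx).
  by rewrite !cmodM cmod_RC le_eqVlt; apply/orP; left; apply/eqP; ring.
Qed.

Definition rwr (f f1 g g1 : R -> R) x := f x * g1 x - f1 x * g x.

Lemma wr_cf f f1 g g1 : wr (cf f) (cf f1) (cf g) (cf g1) = cf (rwr f f1 g g1).
Proof. by apply/funext => x; rewrite /wr /cf -!RCM -RCB. Qed.

Lemma is_rsol_AC s f f1 : is_rsol I p q r s f f1 -> AC_loc I (cf f).
Proof. by move=> [[]]. Qed.

Lemma lagrange_identity s l f f1 g g1 x y : standing a b p q r ->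
  is_rsol I p q r s f f1 -> is_rsol I p q r l g g1 -> I y -> I x -> y <= x ->
  rwr f f1 g g1 x - rwr f f1 g g1 y = (s - l) * Rint (oo_ax y%:E x) (fun t => f t * g t * r t).
Proof.
move=> st fs gs Iy Ix yx.
have mI : measurable (`[y, x]%classic : set LT) := leb_measurable_itv _.
have [[fAC [f1AC _]] _] := fs; have [[gAC [g1AC _]] _] := gs.
have ii := Ln_AC_mul (AC_locM_real fAC gAC) (standing_r st) Iy Ix.
rewrite -RintegralZl; [|exact: measurable_oo_ax|exact: Ln_cc_oo].
apply: FTC_AC => //.
- by rewrite -wr_cf; apply: AC_loc_wr.
- exact: LnZ.
- apply: filterS (wr_deriv st fs gs) => t tP yt tx.
  have -> : RC ((s - l) * (f t * g t * r t)) = (RC s - RC l) * RC (r t) * (cf f t * cf g t).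
    by rewrite /cf !RCM RCB; ring.
  by rewrite -wr_cf; exact/tP/(oo_itv_between Iy Ix yt tx).
Qed.

End Lagrange.

(** * Integrals of functions with a sign almost everywhere *)

Section AlmostEverywhere.
Context {R : realType}.
Local Notation mu := (@completed_lebesgue_measure R).
Local Notation LT := (LebT R).
Local Notation Rint D f := (Rintegral mu D f).
Implicit Types (D : set LT) (f g : R -> R).

Lemma Rint_ae_eq D f g : measurable D -> Ln D f -> Ln D g ->
  {ae mu, forall x : LT, D x -> f x = g x} -> Rint D f = Rint D g.
Proof.
move=> mD fi gi fg; congr fine.
apply: (@ae_eq_integral _ _ _ mu D (EFin \o g) (EFin \o f) mD (measurable_int mu fi)
  (measurable_int mu gi)).
by apply: filterS fg => x fgx Dx /=; rewrite fgx.
Qed.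

Lemma Rint_ae_ge0 D f : measurable D -> Ln D f ->
  {ae mu, forall x : LT, D x -> 0 <= f x} -> 0 <= Rint D f.
Proof.
move=> mD fi f0; rewrite (@Rint_ae_eq D f (fun x => `|f x|))//.
- by apply: Rintegral_ge0.
- exact: Ln_norm.
- by apply: filterS f0 => x f0x Dx; rewrite ger0_norm// f0x.
Qed.

Lemma Rint_ae_le D f g : measurable D -> Ln D f -> Ln D g ->
  {ae mu, forall x : LT, D x -> f x <= g x} -> Rint D f <= Rint D g.
Proof.
move=> mD fi gi fg; rewrite -subr_ge0 -RintegralB//; apply: Rint_ae_ge0 => //.
- exact: LnB.
- by apply: filterS fg => x fgx Dx; rewrite subr_ge0 fgx.
Qed.

(** A vanishing integral would make [f] zero almost everywhere on [D]; with positivity almost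
    everywhere this leaves [D] null. *)
Lemma Rint_ae_gt0 D f : measurable D -> mu D != 0%E -> Ln D f ->
  {ae mu, forall x : LT, D x -> 0 < f x} -> 0 < Rint D f.
Proof.
move=> mD D0 fi f0; rewrite lt_def; apply/andP; split; last first.
  by apply: Rint_ae_ge0 => //; apply: filterS f0 => x f0x Dx; exact/ltW/f0x.
apply: contra D0 => /eqP fD0; apply/eqP/(negligibleP mu mD).
have fi' := Ln_norm mD fi.
have eqn : Rint D (fun x => `|f x|) = 0.
  rewrite -fD0; apply: Rint_ae_eq => //; apply: filterS f0 => x f0x Dx.
  by rewrite gtr0_norm// f0x.
have : (\int[mu]_(x in D) `|(EFin \o f) x|)%E = 0%E.
  have e : (\int[mu]_(x in D) `|(EFin \o f) x|)%E \is a fin_num.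
    exact: integrable_fin_num fi'.
  by rewrite -(fineK e); congr EFin.
move=> /(ae_eq_integral_abs mu mD (measurable_int mu fi)) ae0.
have : {ae mu, forall x : LT, ~ D x}.
  apply: (filterS _ (filterI f0 ae0)) => x [fx fx0] Dx.
  by have := fx Dx; have [->] := fx0 Dx; rewrite ltxx.
by apply: negligibleS => x Dx /=; exact.
Qed.

Lemma leb_mu_oo_ax_neq0 (a : \bar R) x : (a < x%:E)%E -> mu (oo_ax a x) != 0%E.
Proof.
move=> ax; have [y [ay yx]] : exists y : R, (a < y%:E)%E /\ y < x.
  have h : oo_itv a (x + 1)%:E x by split => //; rewrite lte_fin ltrDl.
  by have [y [ay _] yx] := oo_itv_lt h; exists y.
apply/eqP => m0.
have : (mu (`]y, x[%classic : set LT) <= mu (oo_ax a x))%E.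
  apply: le_measure; rewrite ?inE.
  - exact: leb_measurable_itv.
  - exact: measurable_oo_ax.
  - by move=> t /=; rewrite in_itv/= => /andP[yt tx]; split => //; apply: lt_trans ay _; rewrite lte_fin.
rewrite m0 leb_mu_itv lebesgue_measure_itv/= lte_fin yx -EFinD lee_fin.
by rewrite leNgt subr_gt0 yx.
Qed.

End AlmostEverywhere.

(** * Zeros of solutions, and recognizing solutions by their Wronskian *)

Section Solutions.
Context {R : realType} (a b : \bar R) (p q r : R -> R).
Local Notation mu := (@completed_lebesgue_measure R).
Local Notation LT := (LebT R).
Local Notation I := (@oo_itv R a b).

(** Each point of [A] is singled out by an open interval with rational end points, which injects [A]
    into the pairs of rationals. *)
Lemma countable_isolated (A : set R) :
  (forall x, A x -> exists2 d : R, 0 < d & forall y, A y -> `|y - x| < d -> y = x) ->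
  countable A.
Proof.
move=> iso.
have /choice[e eP] : forall x, exists e : rat * rat, A x ->
    ratr e.1 < x < ratr e.2 /\ forall y, A y -> ratr e.1 < y < ratr e.2 -> y = x.
  move=> x; have [Ax|nAx] := pselect (A x); last by exists (0, 0).
  have [d d0 dP] := iso x Ax.
  have /rat_in_itvoo[q1] : x - d < x by rewrite ltrBlDr ltrDl.
  have /rat_in_itvoo[q2] : x < x + d by rewrite ltrDl.
  rewrite !in_itv/= => /andP[q21 q22] /andP[q11 q12].
  exists (q1, q2) => _ /=; rewrite q12 q21; split => // y Ay /andP[y1 y2].
  by apply: dP => //; rewrite ltr_norml; apply/andP; split; lra.
apply/countable_injP; exists (pickle \o e) => x y /set_mem Ax /set_mem Ay /= /(pcan_inj pickleK) exy.
have [xe xP] := eP x Ax; have [ye yP] := eP y Ay.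
by apply: yP => //; rewrite -exy.
Qed.

Lemma simple_zeros_countable (f : R -> R[i]) :
  countable [set x | f x = 0 /\ exists2 L : R[i], L != 0 & has_cderiv f x L].
Proof.
apply: countable_isolated => x [fx0 [L L0 fL]].
have [d d0 dP] := fL _ (cmod_gt0 L0); exists d => // y [fy0 _] yx.
apply/eqP; rewrite -subr_eq0; apply/negPn/negP => yx0.
have := dP (y - x) yx0 yx.
by rewrite (_ : x + (y - x) = y) ?fy0 ?fx0 ?subrr ?mul0r ?sub0r ?cmodN ?ltxx//; ring.
Qed.

(* Away from the zeros of [f], [g1] equals [(1 + f1 g) / f]; almost every zero
   of [f] is simple because [f1] cannot vanish there. *)
Lemma wr_unit_sol z f f1 g g1 : standing a b p q r ->
  is_sol I p q r z f f1 -> qderiv I p g g1 ->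
  (forall x, I x -> wr f f1 g g1 x = 1) -> is_sol I p q r z g g1.
Proof.
move=> st [[fAC [f1AC fd]] f1d] qg W; split => //; have [gAC [g1AC gd]] := qg.
pose Z := [set x | f x = 0 /\ exists2 L : R[i], L != 0 & has_cderiv f x L].
have Zn : {ae mu, forall x : LT, ~ Z x}.
  have cZ : countable Z := simple_zeros_countable f.
  exists Z; split.
  - by apply: leb_measurable; exact: countable_measurable.
  - exact: leb_mu_countable.
  - by move=> x /= /contrapT.
apply: (filterS _ (filterI (filterI (standing_ae st) Zn) (filterI (filterI fd f1d) gd))).
move=> x [[pr nZ] [[xfd xf1d] xgd]] Ix.
have [p0 r0] := pr Ix; have [Lf hf ef] := xfd Ix; have [Lf1 hf1 ef1] := xf1d Ix.
have [Lg hg eg] := xgd Ix.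
have rr : RC (r x) != 0 by rewrite RC_eq0 gt_eqF.
have pp : RC (p x) != 0 by rewrite RC_eq0 gt_eqF.
have fx0 : f x != 0.
  apply/eqP => fx0; apply: nZ; split => //; exists Lf => //.
  have := W x Ix; rewrite /wr fx0 mul0r sub0r ef => /eqP.
  by apply: contraTneq => ->; rewrite mulr0 mul0r oppr0 eq_sym oner_eq0.
have [d d0 dP] := AC_loc_continuous fAC Ix (cmod_gt0 fx0).
have hinv := has_cderivM (has_cderivD (has_cderiv_cst 1 x) (has_cderivM hf1 hg)) (has_cderivV fx0 hf).
have h := has_cderiv_near d0 _ hinv.
exists ((0 + (Lf1 * g x + f1 x * Lg)) / f x + (1 + f1 x * g x) * (- Lf / f x ^+ 2)).
  apply: h => h hd; have xh : `|x + h - x| < d by rewrite addrAC subrr add0r.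
  have [Ixh fxh] := dP _ xh.
  have fxh0 : f (x + h) != 0.
    by apply: contraTneq fxh => ->; rewrite sub0r cmodN ltxx.
  by rewrite -(W _ Ixh) /wr subrK mulrAC divff// mul1r.
have -> : 1 = f x * g1 x - f1 x * g x by rewrite -(W x Ix).
have -> : Lf1 = RC (q x) * f x - RC (r x) * (z * f x) by rewrite -ef1; field.
by rewrite subrK eg ef; field; rewrite rr fx0.
Qed.

Lemma is_sol_Re s f f1 : is_sol I p q r (RC s) f f1 ->
  is_rsol I p q r s (fun x => complex.Re (f x)) (fun x => complex.Re (f1 x)).
Proof.
move=> [[fAC [f1AC fd]] f1d]; split; first split; [exact: AC_loc_Re|split; first exact: AC_loc_Re|].
- apply: filterS fd => x fx Ix; have [L hL eL] := fx Ix.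
  exists (RC (complex.Re L)); first exact: has_cderiv_Re.
  by rewrite /cf eL ReMRC RCM.
- apply: filterS f1d => x fx Ix; have [L hL eL] := fx Ix.
  exists (RC (complex.Re L)); first exact: has_cderiv_Re.
  rewrite /cf -!RCM -RCN -RCD -RCV -RCM; congr RC.
  move: eL => /(congr1 (@complex.Re R)).
  by rewrite ReMRC -RCV mulrC ReMRC ReD ReN ReMRC mulrC.
Qed.

Lemma oo_itv_below (s : seq R) x : I x -> exists2 y, I y & y <= x /\ forall t, t \in s -> I t -> y < t.
Proof.
move=> Ix; elim: s => [|t s [y Iy [yx yP]]]; first by exists x.
have [It|nIt] := pselect (I t); last first.
  by exists y => //; split => // w; rewrite inE => /predU1P[->|] //; exact: yP.
have [t' It' t't] := oo_itv_lt It.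
exists (Num.min y t').
  by case: (leP y t').
split; first by rewrite ge_min yx.
move=> w; rewrite inE => /predU1P[->|ws] Iw; first by rewrite gt_min t't orbT.
by rewrite gt_min yP.
Qed.

Lemma nonosc_nonzero lam f f1 : nonosc_at_a a b p q r lam ->
  is_rsol I p q r lam f f1 -> nontriv I f ->
  exists2 y, I y & forall x, (a < x%:E)%E -> x < y -> f x != 0.
Proof.
move=> no fs fn; have [c Ic /finite_seqP[s sP]] := no f f1 fs fn.
have [y Iy [yc yP]] := oo_itv_below s Ic; exists y => // x ax xy.
apply/negP => /eqP fx0; have xs : x \in s.
  have : [set` s] x by rewrite -sP /=; split => //; split => //; exact: lt_le_trans yc.
  by [].
have Ix : I x by split => //; apply: le_lt_trans (_ : (y%:E < b)%E); [rewrite lee_fin ltW|case: Iy].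
by have := yP x xs Ix; rewrite ltNge ltW.
Qed.

End Solutions.

(** * The filter at the left end point *)

Section LimitAtLeftEnd.
Context {R : realType} (a b : \bar R).
Local Notation I := (@oo_itv R a b).

(** A single working form of [at_a] for finite and infinite [a]. The point of the interval rules out
    [a = +oo] and keeps the witness [y] below [b]. *)
Lemma near_at_a (P : R -> Prop) : (exists x, I x) ->
  (\forall x \near at_a a, P x) <-> (exists2 y, I y & forall x, (a < x%:E)%E -> x < y -> P x).
Proof.
move=> [x0 Ix0]; have := Ix0; case: a (@oo_itv_lt R a b) => [r0||] lt [ax0 xb] //=.
- rewrite lte_fin in ax0; split.
  + rewrite near_withinE => /nbhs_ballP[d /= d0 dP].
    have m0 : r0 < Num.min (r0 + d) x0 by rewrite lt_min ltrDl d0.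
    exists (Num.min (r0 + d) x0).
      split; first by rewrite lte_fin.
      by apply: le_lt_trans xb; rewrite lee_fin ge_min lexx orbT.
    move=> x; rewrite lte_fin lt_min => rx /andP[xd _]; apply: dP => //.
    by rewrite /ball/= distrC ger0_norm ?subr_ge0 ?ltW// ltrBlDl.
  + move=> [y [ay yb] yP]; rewrite lte_fin in ay.
    rewrite near_withinE; apply/nbhs_ballP; exists (y - r0); rewrite /= ?subr_gt0//.
    move=> x; rewrite /ball/= distrC => xy rx; apply: yP; rewrite ?lte_fin//.
    by rewrite ger0_norm ?subr_ge0 ?ltW// ltrD2r in xy.
- split.
  + move=> [M [_ MP]]; exists (Num.min M x0).
      split; first by rewrite ltNyr.
      by apply: le_lt_trans xb; rewrite lee_fin ge_min lexx orbT.
    by move=> x _; rewrite lt_min => /andP[xM _]; exact: MP.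
  + move=> [y Iy yP]; exists y; split; first exact: num_real.
    by move=> x xy; apply: yP => //; rewrite ltNyr.
Qed.

Global Instance at_a_filter : Filter (at_a a).
Proof. by case: a => [r0||]; rewrite /at_a; typeclasses eauto. Qed.

End LimitAtLeftEnd.

(** * Reciprocals, and integrals shrinking to the left end point *)

Section Reciprocal.
Context {R : realType} (a b : \bar R).
Local Notation I := (@oo_itv R a b).

(** A positive lower bound for the modulus on a compact interval is propagated by Cousin induction,
    which reduces the claim to [AC_onV]. *)
Lemma AC_locV (f : R -> R[i]) : AC_loc I f -> (forall x, I x -> f x != 0) ->
  AC_loc I (fun x => (f x)^-1).
Proof.
move=> fAC f0 c d Ic Id cd.
pose P y := exists2 m : R, 0 < m & forall x, c <= x -> x <= y -> x <= d -> m <= cmod (f x).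
have : P d; last first.
  by move=> [m m0 mP]; apply: (AC_onV m0) => [x cx xd|]; [exact: mP|exact: fAC].
apply: (cousin_induction cd); last first.
  exists (cmod (f c)); first by rewrite cmod_gt0// f0.
  by move=> x cx xc xd; rewrite (_ : x = c)//; apply/le_anti; rewrite cx xc.
move=> x cx xd; have Ix := oo_itv_between Ic Id cx xd.
have fx0 : 0 < cmod (f x) / 2 by rewrite divr_gt0// cmod_gt0// f0.
have [g g0 gP] := AC_loc_continuous fAC Ix fx0.
exists g => // s t cs sx xt td gs tg [m m0 mP].
exists (Num.min m (cmod (f x) / 2)); first by rewrite lt_min m0.
move=> y cy yt yd; rewrite ge_min; have [ys|sy] := leP y s; first by rewrite mP.
apply/orP; right.
have [_] : I y /\ cmod (f y - f x) < cmod (f x) / 2.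
  by apply: gP; rewrite ltr_norml; apply/andP; split; lra.
have := cmodB (f y) (f y - f x); rewrite subKr; lra.
Qed.

(** Provides the monotone sequence tending to [a] along which the convergence theorems for integrals
    are applied. *)
Lemma at_a_seq x0 : I x0 -> exists y : nat -> R, (forall n, (a < (y n)%:E)%E /\ y n <= x0) /\
  (forall n, y n.+1 <= y n) /\ forall t : R, (a < t%:E)%E -> \forall n \near \oo, y n <= t.
Proof.
case: a (@oo_itv_lt R a b) => [r0||] _ [/= ax xb] //.
- rewrite lte_fin in ax; exists (fun n => r0 + (x0 - r0) * n.+1%:R^-1); split.
    move=> n; rewrite lte_fin ltrDl mulr_gt0 ?subr_gt0 ?invr_gt0//; split => //.
    rewrite -lerBrDl ler_piMr ?subr_ge0 ?(ltW ax)//.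
    by rewrite invf_le1// ler1n.
  split=> [n|].
    by rewrite lerD2l ler_wpM2l ?subr_ge0 ?(ltW ax)// lef_pV2 ?posrE// ler_nat.
  move=> t; rewrite lte_fin => rt; near=> n.
  rewrite -lerBrDl ler_pdivrMr// mulrC -ler_pdivrMr ?subr_gt0//.
  apply: (@le_trans _ _ n%:R); last by rewrite ler_nat.
  by near: n; exact: nbhs_infty_ger.
- exists (fun n => x0 - n%:R); split.
    by move=> n; rewrite ltNyr; split => //; rewrite lerBlDr lerDl.
  split=> [n|]; first by rewrite lerD2l lerN2 ler_nat.
  move=> t _; near=> n; rewrite lerBlDr -lerBlDl.
  by near: n; exact: nbhs_infty_ger.
Unshelve. all: by end_near. Qed.

(** Dominated convergence for [|f|] cut off at [y n]: at a fixed [t > a] the truncations are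
    eventually zero. *)
Lemma Rint_left_cvg0 (f : R -> R) x0 : I x0 -> Ln (oo_ax a x0) f -> forall e : R, 0 < e ->
  exists2 y, I y & y <= x0 /\ forall x, (a < x%:E)%E -> x <= y ->
    Rintegral completed_lebesgue_measure (oo_ax a x) (fun t => `|f t|) < e.
Proof.
move=> Ix0 fi e e0; have mo := @measurable_oo_ax R a; have := at_a_seq Ix0.
move=> [y [yP [_ ycvg]]]; pose g n := (fun t => `|f t|) \_ (`]-oo, y n[%classic : set (LebT R)).
have gE0 n t : g n t = if t < y n then `|f t| else 0.
  by rewrite /g patchE mem_setE in_itv.
have fi' := Ln_norm (mo x0) fi.
have gE n : Rintegral completed_lebesgue_measure (oo_ax a x0) (g n) =
            Rintegral completed_lebesgue_measure (oo_ax a (y n)) (fun t => `|f t|).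
  have [ay yx] := yP n.
  rewrite (_ : oo_ax a (y n) = oo_ax a x0 `&` `]-oo, y n[%classic); last first.
    apply/seteqP; split => t; rewrite /= in_itv/= => -[]; last by move=> [at_ tx] ty.
    by move=> at_ ty; split => //; split => //; exact: lt_le_trans yx.
  by rewrite [RHS]Rintegral_mkcondr.
have mg n : measurable_fun (oo_ax a x0) (g n : LebT R -> R).
  apply: (proj1 (measurable_restrict _ (leb_measurable_itv _) (mo x0))).
  apply: measurable_funS (Ln_measurable fi'); first exact: mo.
  by move=> t [].
have [] := @dominated_convergence _ _ _ completed_lebesgue_measure _ (mo x0)
   (fun n t => (g n t)%:E) (cst 0%E) (fun t => `|f t|%:E).
- by move=> n; exact/measurable_EFinP/mg.
- exact: measurable_cst.
- apply: aeW => t [at_ tx]; apply: cvg_near_cst.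
  apply: (filterS _ (ycvg t at_)) => n ynt.
  by rewrite gE0 ltNge ynt.
- exact: fi'.
- apply: aeW => t n _; rewrite gE0 lee_fin; case: ifP => _; first by rewrite normr_id.
  by rewrite normr0.
move=> _ _; rewrite integral0 => /fine_cvg.
have -> : fine \o [sequence (\int[completed_lebesgue_measure]_(t in oo_ax a x0) (g n t)%:E)%E]_n =
   (fun n => Rintegral completed_lebesgue_measure (oo_ax a (y n)) (fun t => `|f t|)).
  by apply/funext => n; rewrite -gE.
move=> /cvgrPdist_lt /(_ e e0)[N _ NP]; have := NP N (leqnn N).
have [ay yx] := yP N; exists (y N).
  by split => //; case: Ix0 => _; apply: le_lt_trans; rewrite lee_fin.
split => // x ax xy; apply: le_lt_trans (NP N (leqnn N)); rewrite /= sub0r normrN.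
apply: le_trans (ler_norm _).
have := Ln_sub yx fi'; move: xy; rewrite le_eqVlt => /predU1P[->//|xy] fy.
by rewrite [leRHS](Rint_split ax xy fy) lerDl; apply: Rintegral_ge0.
Qed.

End Reciprocal.

(** * The basis [u], [v] near [a], and bounds for the iterates [phin] *)

Definition quot {R : realType} (u v : R -> R) (x : R) := u x / v x.

(** Meant for a right end point close to [a], since [u] and [v] may have zeros further away.
    [ls_lim] is the principality of [u] tested against [v]. *)
Record local_setting {R : realType} (a b : \bar R) (p q r : R -> R) (lam : R)
    (u u1 v v1 : R -> R) : Prop := LocalSetting {
  ls_standing : standing a b p q r ;
  ls_u : is_rsol (oo_itv a b) p q r lam u u1 ;
  ls_v : is_rsol (oo_itv a b) p q r lam v v1 ;
  ls_W : forall x, oo_itv a b x -> v x * u1 x - v1 x * u x = 1 ;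
  ls_u0 : forall x, oo_itv a b x -> u x != 0 ;
  ls_v0 : forall x, oo_itv a b x -> v x != 0 ;
  ls_lim : forall e : R, 0 < e -> exists2 y, oo_itv a b y &
    forall x, (a < x%:E)%E -> x < y -> `|u x / v x| < e ;
  ls_uvi : forall x, oo_itv a b x -> Ln (oo_ax a x) (fun t => u t * v t * r t) }.

Section LocalTheory.
Context {R : realType} (a b : \bar R) (p q r : R -> R) (lam : R) (u u1 v v1 : R -> R).
Local Notation mu := (@completed_lebesgue_measure R).
Local Notation LT := (LebT R).
Local Notation I := (@oo_itv R a b).
Local Notation Rint D f := (Rintegral mu (D : set LT) f).
Local Notation J x f := (Rintegral mu (oo_ax a x) f).
Hypothesis ls : local_setting a b p q r lam u u1 v v1.

Let st := ls_standing ls.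
Let us := ls_u ls.
Let vs := ls_v ls.
Let W := ls_W ls.
Let u0 := ls_u0 ls.
Let v0 := ls_v0 ls.
Let uv_lim := ls_lim ls.
Let uvi := ls_uvi ls.

Local Notation h := (quot u v).

Let mo x : measurable (oo_ax a x : set LT).
Proof. exact: measurable_oo_ax. Qed.

Lemma oo_ax_sub x : I x -> forall t, oo_ax a x t -> I t /\ t < x.
Proof. by move=> [ax xb] t [at_ tx]; split => //; split => //; apply: lt_trans xb; rewrite lte_fin. Qed.

Let AC_h : AC_loc I (fun x => cf u x * (cf v x)^-1).
Proof.
apply: AC_locM; first exact: is_rsol_AC us.
by apply: AC_locV; [exact: is_rsol_AC vs|move=> x Ix; rewrite RC_eq0 v0].
Qed.

Lemma AC_loc_h : AC_loc I (cf h).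
Proof. by have := AC_h; congr AC_loc; apply/funext => x; rewrite /cf /quot RCM RCV. Qed.

(** The derivative of [u / v] is [W(v, u) / (p v^2) = 1 / (p v^2)], positive almost everywhere. *)
Lemma h_incr c d : I c -> I d -> c < d -> h c < h d.
Proof.
move=> Ic Id cd; rewrite -subr_gt0.
have AC_v2 : AC_loc I (cf (fun x => (v x)^-1 * (v x)^-1)).
  apply: AC_locM_real; have := AC_locV (is_rsol_AC vs);
    by (rewrite (_ : (fun x => (cf v x)^-1) = cf (fun x => (v x)^-1));
       [apply=> x Ix; rewrite RC_eq0 v0|apply/funext => x; rewrite /cf RCV]).
have p_loc : L1loc I (fun x => (p x)^-1) by case: st => [_ [_ [_ [_ [_ [_ [_ []]]]]]]].
have ii := Ln_AC_mul AC_v2 p_loc Ic Id.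
have [[_ [_ ud]] _] := us; have [[_ [_ vd]] _] := vs.
rewrite (FTC_AC (ltW cd) _ ii).
- apply: Rint_ae_gt0; first exact: measurable_oo_ax.
  + by apply: leb_mu_oo_ax_neq0; rewrite lte_fin.
  + exact: Ln_cc_oo.
  + apply: filterS (standing_ae st) => x px; rewrite oo_axE /= in_itv/= => /andP[/ltW cx /ltW xd].
    have Ix := oo_itv_between Ic Id cx xd; have [p0 _] := px Ix.
    by rewrite mulr_gt0 ?invr_gt0// -expr2 exprn_even_gt0//= invr_eq0 v0.
- by apply: AC_loc_h => //; exact: ltW.
- apply: (filterS _ (filterI (standing_ae st) (filterI ud vd))) => x [pr [xu xv]] cx xd.
  have Ix := oo_itv_between Ic Id cx xd; have [p0 r0] := pr Ix.
  have [Lu hu eu] := xu Ix; have [Lv hv ev] := xv Ix.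
  have pp : RC (p x) != 0 by rewrite RC_eq0 gt_eqF.
  have vv : cf v x != 0 by rewrite RC_eq0 v0.
  have -> : cf h = (fun x => cf u x * (cf v x)^-1).
    by apply/funext => t; rewrite /cf /quot RCM RCV.
  have -> : RC ((v x)^-1 * (v x)^-1 * (p x)^-1) = Lu * (cf v x)^-1 + cf u x * (- Lv / cf v x ^+ 2).
    have : RC (v x * u1 x - v1 x * u x) = 1 by rewrite W.
    rewrite RCB !RCM -/(cf v x) -/(cf u x) -/(cf u1 x) -/(cf v1 x) eu ev !RCV -/(cf v x) => e.
    rewrite -[X in X = _]mulr1 -{1}e; field; by rewrite pp vv.
  by apply: has_cderivM => //; exact: has_cderivV.
Qed.

(** A strictly increasing function that is nonpositive somewhere stays below a negative constant
    further left, which contradicts its limit zero at [a]. *)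
Lemma h_gt0 x : I x -> 0 < h x.
Proof.
move=> Ix; have [y Iy yx] := oo_itv_lt Ix; have hyx := h_incr Iy Ix yx.
rewrite ltNge; apply/negP => hx.
have hy0 : 0 < - h y by rewrite oppr_gt0 (lt_le_trans hyx).
have [z Iz zP] := uv_lim hy0.
have [w Iw] : exists2 w, I w & w < Num.min y z.
  by apply: oo_itv_lt; case: (leP y z).
rewrite lt_min => /andP[wy wz].
have := zP w (proj1 Iw) wz; have := h_incr Iw Iy wy; rewrite -/(h w).
have := ler_norm (- h w); rewrite normrN; lra.
Qed.

Lemma uv_gt0 x : I x -> 0 < u x * v x.
Proof.
move=> Ix; have -> : u x * v x = h x * v x ^+ 2 by rewrite /quot; field; exact: v0.
by rewrite mulr_gt0 ?h_gt0// exprn_even_gt0//= v0.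
Qed.

Lemma h_le x t : I x -> oo_ax a x t -> 0 < h t < h x.
Proof. by move=> Ix xt; have [It tx] := oo_ax_sub Ix xt; rewrite h_gt0// h_incr. Qed.

(** The size, relative to [u], of the integral operator iterated in [phin]; it tends to zero at
    [a]. *)
Definition om x := J x (fun t => `|u t * v t * r t|).

Lemma om_ge0 x : 0 <= om x.
Proof. exact: Rintegral_ge0. Qed.

Lemma om_le x y : (a < x%:E)%E -> I y -> x <= y -> om x <= om y.
Proof.
move=> ax Iy; rewrite le_eqVlt => /predU1P[->//|xy].
by rewrite /om [leRHS](Rint_split ax xy (Ln_norm (mo _) (uvi Iy))) lerDl; exact: Rintegral_ge0.
Qed.

Lemma om_lim x0 : I x0 -> forall e : R, 0 < e ->
  exists2 y, I y & y <= x0 /\ forall x, (a < x%:E)%E -> x <= y -> om x < e.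
Proof. by move=> Ix0 e e0; exact: Rint_left_cvg0 (uvi Ix0) _ e0. Qed.

(** The kernel equals [v t * v x * (h t - h x)] with [0 < h t < h x], so its modulus is at most
    [|v t| |u x|] and each iteration gains a factor [om x]. The geometric bound is enough for
    parameters close to [lam]. *)
Lemma phin_bound n x : I x -> `|phin a r u v n x| <= `|u x| * om x ^+ n.
Proof.
elim: n x => [|n IH] x Ix /=; first by rewrite expr0 mulr1.
have fi := Ln_norm (mo x) (uvi Ix).
have -> : `|u x| * om x ^+ n.+1 = J x (fun t => (`|u x| * om x ^+ n) * `|u t * v t * r t|).
  by rewrite RintegralZl// exprSr mulrA.
apply: normr_Rint_le => //; last exact: LnZ.
move=> t xt; have [It tx] := oo_ax_sub Ix xt; have /andP[ht hx] := h_le Ix xt.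
have -> : u t * v x - v t * u x = v t * v x * (h t - h x).
  by rewrite /quot; field; rewrite !v0.
have k1 : `|v t * v x * (h t - h x)| <= `|v t| * `|u x|.
  have e : `|u x| = h x * `|v x|.
    by rewrite -{1}[u x](divfK (v0 Ix)) normrM -/(h x) gtr0_norm ?h_gt0.
  rewrite e normrM [X in X * _]normrM -mulrA ler_wpM2l// mulrC ler_wpM2r//.
  by rewrite ler_norml; apply/andP; split; lra.
have k2 : `|phin a r u v n t| <= `|u t| * om x ^+ n.
  rewrite (le_trans (IH t It))// ler_wpM2l// lerXn2r ?nnegrE ?om_ge0//.
  by apply: om_le => //; [case: It|exact: ltW].
rewrite normrM [X in X * _]normrM.
have -> : `|u x| * om x ^+ n * `|u t * v t * r t| = (`|v t| * `|u x|) * (`|u t| * om x ^+ n) * `|r t|.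
  by rewrite !normrM; ring.
by rewrite ler_wpM2r// ler_pM.
Qed.

End LocalTheory.

(** * Expansion of phi in the basis [u], [v] *)

Section PhiExpansion.
Context {R : realType} (a b : \bar R) (p q r : R -> R) (lam : R) (u u1 v v1 : R -> R).
Local Notation mu := (@completed_lebesgue_measure R).
Local Notation LT := (LebT R).
Local Notation I := (@oo_itv R a b).
Local Notation Rint D f := (Rintegral mu (D : set LT) f).
Local Notation J x f := (Rintegral mu (oo_ax a x) f).
Hypothesis ls : local_setting a b p q r lam u u1 v v1.

Let st := ls_standing ls.
Let us := ls_u ls.
Let vs := ls_v ls.
Let W := ls_W ls.
Let u0 := ls_u0 ls.
Let v0 := ls_v0 ls.
Let uv_lim := ls_lim ls.
Let uvi := ls_uvi ls.

Local Notation h := (quot u v).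

Local Notation om := (om a r u v).

Let mo x : measurable (oo_ax a x : set LT).
Proof. exact: measurable_oo_ax. Qed.

Lemma small_eq0 (x C : R) : 0 <= C -> (forall e : R, 0 < e -> `|x| <= C * e) -> x = 0.
Proof.
move=> C0 xC; apply/eqP; rewrite -normr_le0; apply/ler_addgt0Pr => e e0; rewrite add0r.
have C1 : 0 < C + 1 by rewrite ltr_wpDl.
apply: (le_trans (xC (e / (C + 1)) _)); first by rewrite divr_gt0.
by rewrite mulrA ler_pdivrMr// mulrC ler_wpM2l ?ltW// ltrDl.
Qed.

Lemma measurable_AC_r (f g : R -> R) x : AC_loc I (cf f) -> AC_loc I (cf g) -> I x ->
  measurable_fun (oo_ax a x) ((fun t => f t * g t * r t) : LT -> R).
Proof.
move=> fAC gAC Ix; have sub : oo_ax a x `<=` (I : set LT).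
  by move=> t /(oo_ax_sub Ix)[].
have mI : measurable (I : set LT) := measurable_oo_itv a b.
apply: measurable_funM.
  by apply: measurable_funS (AC_loc_measurable (AC_locM_real fAC gAC)).
by apply: measurable_funS sub _ => //; case: st => [_ [_ [_ []]]].
Qed.

(** [u^2 r = h u v r], and [h] is bounded by its value at [x]. *)
Lemma Ln_uur x : I x -> Ln (oo_ax a x) (fun t => u t * u t * r t).
Proof.
move=> Ix; apply: (Ln_le (g := fun t => h x * `|u t * v t * r t|) (mo x)).
- by apply: measurable_AC_r => //; exact: is_rsol_AC us.
- move=> t xt; have [It _] := oo_ax_sub Ix xt; have /andP[ht hx] := h_le ls Ix xt.
  have -> : u t * u t * r t = h t * (u t * v t * r t).
    by rewrite /quot; field; exact: v0.
  by rewrite normrM gtr0_norm// ler_wpM2r// ltW.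
- by apply: (LnZ _ (mo _)); apply: (Ln_norm (mo _)); exact: uvi.
Qed.

Lemma sum_geometric_le2 (rho : R) k : 0 <= rho -> rho <= 2^-1 -> \sum_(n < k) rho ^+ n <= 2.
Proof.
move=> r0 r2; elim: k => [|k IH]; first by rewrite big_ord0.
rewrite big_ord_recl expr0; under eq_bigr do rewrite /bump /= exprS.
rewrite -mulr_sumr.
have : rho * \sum_(i < k) rho ^+ i <= 2^-1 * 2 by rewrite ler_pM// sumr_ge0// => i _; exact: exprn_ge0.
by rewrite mulVf//; lra.
Qed.

(** The threshold 1/2 gives a geometric majorant whose sum is at most 2, whence the constant 2. As
    [csum] is a total function, convergence has to be established before its value means
    anything. *)
Lemma phiz_real s x : I x -> `|s - lam| * om x <= 2^-1 ->
  phiz a r u v lam (RC s) x = RC (complex.Re (phiz a r u v lam (RC s) x)) /\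
  `|complex.Re (phiz a r u v lam (RC s) x) - u x| <= 2 * `|s - lam| * om x * `|u x|.
Proof.
move=> Ix sx; pose c n := phin a r u v n x * (s - lam) ^+ n.
have SE m : \sum_(n < m) RC (phin a r u v n x) * (RC s - RC lam) ^+ n = RC (series c m).
  have -> : RC (series c m) = \sum_(n < m) RC (c n).
    by rewrite /series /= big_mkord /RC rmorph_sum.
  by apply: eq_bigr => n _; rewrite /c RCM RCX RCB.
have [ReE ImE] : complex.Re (phiz a r u v lam (RC s) x) = limn (series c) /\
    complex.Im (phiz a r u v lam (RC s) x) = 0.
  rewrite /phiz /csum /=; split; first by congr (limn _); apply/funext => m; rewrite SE.
  by rewrite (_ : (fun m => _) = cst 0) ?lim_cst//; apply/funext => m; rewrite SE.
split; first exact: Im_real.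
rewrite ReE; pose rho := `|s - lam| * om x.
have rho0 : 0 <= rho by rewrite mulr_ge0 ?om_ge0.
have cb n : `|c n| <= `|u x| * rho ^+ n.
  rewrite /c normrM normrX exprMn mulrCA mulrC ler_wpM2l ?exprn_ge0//.
  exact: phin_bound ls n x Ix.
have ccvg : cvgn (series c).
  apply: normed_cvg; apply: (@series_le_cvg _ _ (geometric `|u x| rho)).
  - by move=> n /=.
  - by move=> n; rewrite /geometric /= mulr_ge0// exprn_ge0.
  - exact: cb.
  - apply: is_cvg_geometric_series; rewrite ger0_norm//; apply: (le_lt_trans sx).
    by rewrite invf_lt1// ltr1n.
have cn : (fun m => `|series c m - u x|) @ \oo --> `|limn (series c) - u x|.
  by apply: cvg_norm; apply: cvgB => //; exact: cvg_cst.
have bnd k : `|series c k.+1 - u x| <= 2 * `|s - lam| * om x * `|u x|.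
  rewrite /series /= big_mkord big_ord_recl /c /= expr0 mulr1 addrAC subrr add0r.
  apply: (le_trans (ler_norm_sum _ _ _)).
  apply: (@le_trans _ _ (\sum_(i < k) `|u x| * (rho * rho ^+ i))).
    by apply: ler_sum => i _; have := cb (bump 0 i); rewrite /bump /= add1n exprS.
  rewrite -!mulr_sumr.
  have -> : 2 * `|s - lam| * om x * `|u x| = `|u x| * (rho * 2) by rewrite /rho; ring.
  by rewrite ler_wpM2l// ler_wpM2l// sum_geometric_le2.
apply: cvgr_to_le cn _; near=> m.
have m0 : (0 < m)%N by near: m; exists 1%N.
by rewrite -(prednK m0).
Unshelve. all: by end_near. Qed.

(* In the coordinates [ph = C1 u + C2 v], both [C1] and [C2] are indefinite
   integrals up to constants; dividing by [v] and by [u] and letting the point tend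
   to [a] identifies the constants as [1] and [0]. *)
Lemma phi_coords s ph ph1 x0 : I x0 -> is_rsol I p q r s ph ph1 ->
  (forall x, (a < x%:E)%E -> x <= x0 -> `|ph x - u x| <= 2 * `|s - lam| * om x * `|u x|) ->
  `|s - lam| * om x0 <= 2^-1 ->
  [/\ Ln (oo_ax a x0) (fun t => ph t * u t * r t),
      Ln (oo_ax a x0) (fun t => ph t * v t * r t),
      rwr ph ph1 u u1 x0 = (s - lam) * J x0 (fun t => ph t * u t * r t) &
      - rwr ph ph1 v v1 x0 = 1 - (s - lam) * J x0 (fun t => ph t * v t * r t)].
Proof.
move=> Ix0 phs phu sx0; set ds := s - lam in phu sx0 *.
have below x : (a < x%:E)%E -> x <= x0 -> I x.
  by move=> ax xx; split => //; case: Ix0 => _; apply: le_lt_trans; rewrite lee_fin.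
(* The smallness at [x0] gives [2 |ds| om x <= 1], so [ph] differs from [u] by at most [|u|]. *)
have ph2 x : (a < x%:E)%E -> x <= x0 -> `|ph x| <= 2 * `|u x|.
  move=> ax xx; have k1 := phu x ax xx; have k2 := ler_normD (ph x - u x) (u x).
  rewrite subrK in k2.
  have k3 : 2 * `|ds| * om x * `|u x| <= `|u x|.
    rewrite -[leRHS]mul1r ler_wpM2r// -mulrA mulrC -ler_pdivlMr// mul1r.
    by apply: le_trans sx0; rewrite ler_wpM2l//; exact: om_le ls _ _ ax Ix0 xx.
  by lra.
have phAC := is_rsol_AC phs; have uAC := is_rsol_AC us; have vAC := is_rsol_AC vs.
have uvn t : I t -> `|u t * v t| = u t * v t by move=> It; rewrite gtr0_norm// (uv_gt0 ls).
have bv y t : (a < y%:E)%E -> y <= x0 -> oo_ax a y t ->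
    `|ph t * v t * r t| <= 2 * `|u t * v t * r t|.
  move=> ay yx yt; have [It ty] := oo_ax_sub (below y ay yx) yt.
  rewrite !normrM !mulrA ler_wpM2r// ler_wpM2r//; apply: ph2; first by case: It.
  exact: le_trans (ltW ty) yx.
(* The extra factor [h y], absent from the bound with [v], is what later keeps [J2 y / h y]
   small. *)
have bu y t : (a < y%:E)%E -> y <= x0 -> oo_ax a y t ->
    `|ph t * u t * r t| <= 2 * h y * `|u t * v t * r t|.
  move=> ay yx yt; have [It ty] := oo_ax_sub (below y ay yx) yt.
  have /andP[ht hy] := h_le ls (below y ay yx) yt.
  have e : `|u t| = h t * `|v t|.
    by rewrite -{1}[u t](divfK (v0 It)) normrM -/(h t) gtr0_norm.
  have k : `|ph t| <= 2 * `|u t| by apply: ph2; [case: It|exact: le_trans (ltW ty) yx].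
  rewrite !normrM.
  apply: (@le_trans _ _ (2 * `|u t| * (h y * `|v t|) * `|r t|)).
    by rewrite ler_wpM2r// ler_pM// e ler_wpM2r// ltW.
  by rewrite le_eqVlt; apply/orP; left; apply/eqP; ring.
have iv y : (a < y%:E)%E -> y <= x0 -> Ln (oo_ax a y) (fun t => ph t * v t * r t).
  move=> ay yx; have Iy := below y ay yx.
  apply: (Ln_le (g := fun t => 2 * `|u t * v t * r t|) (mo y)).
  - by apply: measurable_AC_r.
  - by move=> t yt; exact: bv yt.
  - by apply: (LnZ _ (mo _)); apply: (Ln_norm (mo _)); exact: uvi.
have iu y : (a < y%:E)%E -> y <= x0 -> Ln (oo_ax a y) (fun t => ph t * u t * r t).
  move=> ay yx; have Iy := below y ay yx.
  apply: (Ln_le (g := fun t => 2 * h y * `|u t * v t * r t|) (mo y)).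
  - by apply: measurable_AC_r.
  - by move=> t yt; exact: bu yt.
  - by apply: (LnZ _ (mo _)); apply: (Ln_norm (mo _)); exact: uvi.
pose J1 y := J y (fun t => ph t * v t * r t).
pose J2 y := J y (fun t => ph t * u t * r t).
have J1b y : (a < y%:E)%E -> y <= x0 -> `|J1 y| <= 2 * om y.
  move=> ay yx; have Iy := below y ay yx.
  have fi := Ln_norm (mo y) (uvi Iy).
  rewrite /om -RintegralZl//; apply: normr_Rint_le => //; last exact: LnZ.
  by move=> t yt; exact: bv yt.
have J2b y : (a < y%:E)%E -> y <= x0 -> `|J2 y| <= 2 * h y * om y.
  move=> ay yx; have Iy := below y ay yx.
  have fi := Ln_norm (mo y) (uvi Iy).
  rewrite /om -RintegralZl//; apply: normr_Rint_le => //; last exact: LnZ.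
  by move=> t yt; exact: bu yt.
(* Cramer's rule with [W(v, u) = 1]; [E1] and [E2] are what remains of the coordinates after their
   integral parts from [a] are removed. *)
pose C1 y := - rwr ph ph1 v v1 y; pose C2 y := rwr ph ph1 u u1 y.
pose E1 := C1 x0 + ds * J1 x0; pose E2 := C2 x0 - ds * J2 x0.
have E2y y : (a < y%:E)%E -> y < x0 -> E2 = C2 y - ds * J2 y.
  move=> ay yx; have := lagrange_identity st phs us (below y ay (ltW yx)) Ix0 (ltW yx).
  rewrite -/(C2 x0) -/(C2 y) -/ds => k.
  have := Rint_split ay yx (iu x0 (proj1 Ix0) (lexx _)).
  rewrite -/(J2 x0) -/(J2 y) /E2 => ->; rewrite mulrDr -k; ring.
have E1y y : (a < y%:E)%E -> y < x0 -> E1 = C1 y + ds * J1 y.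
  move=> ay yx; have := lagrange_identity st phs vs (below y ay (ltW yx)) Ix0 (ltW yx).
  rewrite -/ds => k.
  have := Rint_split ay yx (iv x0 (proj1 Ix0) (lexx _)).
  rewrite -/(J1 x0) -/(J1 y) /E1 => ->; rewrite mulrDr -k /C1; ring.
have phE y : I y -> ph y = C1 y * u y + C2 y * v y.
  by move=> Iy; rewrite /C1 /C2 /rwr -[LHS]mulr1 -(W Iy); ring.
have E20 : E2 = 0.
  apply: (@small_eq0 _ (2 + (`|E1| + `|ds| * (2 * om x0)) + `|ds| * (2 * om x0))).
    by rewrite !addr_ge0// mulr_ge0// mulr_ge0// om_ge0.
  move=> e e0; have [z Iz zP] := uv_lim e0.
  have [y Iy] : exists2 y, I y & y < Num.min z x0 by apply: oo_itv_lt; case: (leP z x0).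
  rewrite lt_min => /andP[yz yx]; have ay := proj1 Iy.
  have hy0 := h_gt0 ls Iy; have hye : h y <= e.
    by have := zP y ay yz; rewrite -/(h y) gtr0_norm// => /ltW.
  have C1E : C1 y = E1 - ds * J1 y by rewrite (E1y y ay yx) addrK.
  (* All three terms are at most a constant times [h y], which tends to zero at [a]. *)
  have -> : E2 = ph y / v y - (E1 - ds * J1 y) * h y - ds * J2 y.
    rewrite (E2y y ay yx) (phE y Iy) -C1E /quot; field; exact: v0.
  have omy : om y <= om x0 := om_le ls ay Ix0 (ltW yx).
  have k1 : `|ph y / v y| <= 2 * h y.
    rewrite normrM normfV ler_pdivrMr ?normr_gt0 ?v0// -mulrA.
    have -> : h y * `|v y| = `|u y|.
      by rewrite -{1}[u y](divfK (v0 Iy)) normrM -/(h y) gtr0_norm.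
    exact: ph2 y ay (ltW yx).
  have k2 : `|(E1 - ds * J1 y) * h y| <= (`|E1| + `|ds| * (2 * om x0)) * h y.
    rewrite normrM (gtr0_norm hy0) ler_wpM2r ?(ltW hy0)// (le_trans (ler_normB _ _))// lerD2l.
    rewrite normrM ler_wpM2l// (le_trans (J1b y ay (ltW yx)))// ler_wpM2l//.
  have k3 : `|ds * J2 y| <= `|ds| * (2 * om x0) * h y.
    rewrite normrM -mulrA ler_wpM2l// (le_trans (J2b y ay (ltW yx)))// mulrAC ler_wpM2r ?(ltW hy0)//.
    by rewrite ler_wpM2l.
  apply: (@le_trans _ _ ((2 + (`|E1| + `|ds| * (2 * om x0)) + `|ds| * (2 * om x0)) * h y)).
    have k4 := ler_normB (ph y / v y - (E1 - ds * J1 y) * h y) (ds * J2 y).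
    have k5 := ler_normB (ph y / v y) ((E1 - ds * J1 y) * h y).
    apply: (le_trans k4); apply: (le_trans (lerD (le_trans k5 (lerD k1 k2)) k3)).
    by rewrite le_eqVlt; apply/orP; left; apply/eqP; ring.
  rewrite ler_wpM2l// !addr_ge0// mulr_ge0// mulr_ge0// om_ge0//.
have E11 : E1 - 1 = 0.
  apply: (@small_eq0 _ (6 * `|ds|)); first by rewrite mulr_ge0.
  move=> e e0; have [z Iz [zx0 zP]] := om_lim ls Ix0 e0.
  have [y Iy yz] := oo_itv_lt Iz; have ay := proj1 Iy.
  have yx : y < x0 by exact: lt_le_trans zx0.
  have hy0 := h_gt0 ls Iy; have omy := ltW (zP y ay (ltW yz)); rewrite -/(om y) in omy.
  have C2E : C2 y = ds * J2 y by have := E2y y ay yx; rewrite E20 => /esym/subr0_eq.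
  (* Now that [E2 = 0], each of the three terms is at most [2 |ds| om y], whence the constant 6. *)
  have -> : E1 - 1 = (ph y - u y) / u y + ds * J1 y - ds * (J2 y / h y).
    rewrite (E1y y ay yx) (phE y Iy) C2E /quot.
    by field; rewrite u0// v0.
  have k1 : `|(ph y - u y) / u y| <= 2 * `|ds| * om y.
    by rewrite normrM normfV ler_pdivrMr ?normr_gt0 ?u0//; exact: phu y ay (ltW yx).
  have k2 : `|ds * J1 y| <= `|ds| * (2 * om y) by rewrite normrM ler_wpM2l// J1b// ltW.
  have k3 : `|ds * (J2 y / h y)| <= `|ds| * (2 * om y).
    rewrite normrM ler_wpM2l// normrM normfV (gtr0_norm hy0) ler_pdivrMr//.
    by rewrite mulrAC J2b// ltW.
  apply: (@le_trans _ _ (6 * `|ds| * om y)); last by rewrite ler_wpM2l// mulr_ge0.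
  have k4 := ler_normB ((ph y - u y) / u y + ds * J1 y) (ds * (J2 y / h y)).
  have k5 := ler_normD ((ph y - u y) / u y) (ds * J1 y).
  apply: (le_trans k4); apply: (le_trans (lerD (le_trans k5 (lerD k1 k2)) k3)).
  by rewrite le_eqVlt; apply/orP; left; apply/eqP; ring.
split; [exact: iu (proj1 Ix0) _|exact: iv (proj1 Ix0) _| |].
- exact: subr0_eq E20.
- by have /eqP := E11; rewrite subr_eq0 => /eqP <-; rewrite /E1 addrK.
Qed.

End PhiExpansion.

(** * Comparison of solutions for nearby spectral parameters *)

Section ThetaExpansion.
Context {R : realType} (a b : \bar R) (p q r : R -> R) (lam : R) (u u1 v v1 : R -> R).
Local Notation mu := (@completed_lebesgue_measure R).
Local Notation LT := (LebT R).
Local Notation I := (@oo_itv R a b).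
Local Notation Rint D f := (Rintegral mu (D : set LT) f).
Local Notation J x f := (Rintegral mu (oo_ax a x) f).
Hypothesis ls : local_setting a b p q r lam u u1 v v1.

Let st := ls_standing ls.
Let us := ls_u ls.
Let vs := ls_v ls.
Let W := ls_W ls.
Let u0 := ls_u0 ls.
Let v0 := ls_v0 ls.
Let uv_lim := ls_lim ls.
Let uvi := ls_uvi ls.

Local Notation h := (quot u v).

Local Notation om := (om a r u v).

Let mo x : measurable (oo_ax a x : set LT).
Proof. exact: measurable_oo_ax. Qed.

(** Choosing the supremum itself as [B] gives [sup <= e + sup / 2]; the a priori bound makes that
    supremum finite. This plays the part of Gronwall's inequality. *)
Lemma contraction_bound (S : set R) (f : R -> R) (e : R) : (exists B, forall x, S x -> f x <= B) ->
  (forall B, (forall x, S x -> f x <= B) -> forall x, S x -> f x <= e + B / 2) ->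
  forall x, S x -> f x <= 2 * e.
Proof.
move=> [B fB] step x Sx.
have hs : has_sup (f @` S).
  by split; [exists (f x); exists x|exists B => _ [t St <-]; exact: fB].
have fsup t : S t -> f t <= sup (f @` S).
  by move=> St; apply: ub_le_sup; [case: hs|exists t].
have : sup (f @` S) <= e + sup (f @` S) / 2.
  apply: ge_sup; first by case: hs.
  by move=> _ [t St <-]; exact: step.
by have := fsup x Sx; lra.
Qed.

(** The Wronskian is the determinant of the coordinates of [f] and [g] in the basis [u], [v], as
    [W(v, u) = 1]. *)
Lemma wr_plucker (f f1 g g1 : R -> R) x : I x ->
  rwr f f1 g g1 x = rwr f f1 u u1 x * (- rwr g g1 v v1 x) - (- rwr f f1 v v1 x) * rwr g g1 u u1 x.
Proof. by move=> Ix; rewrite -[LHS]mulr1 -(W Ix) /rwr; ring. Qed.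

Lemma sol_coords (f f1 : R -> R) x : I x ->
  f x = (- rwr f f1 v v1 x) * u x + rwr f f1 u u1 x * v x.
Proof. by move=> Ix; rewrite -[LHS]mulr1 -(W Ix) /rwr; ring. Qed.

(** Variation of constants anchored at the interior point [x], so that only integrals over compact
    intervals occur: theta need not be integrable against [v r] up to [a]. *)
Lemma sol_expansion s f f1 x y : is_rsol I p q r s f f1 -> I y -> I x -> y < x ->
  f y = (- rwr f f1 v v1 x + (s - lam) * Rint (oo_ax y%:E x) (fun t => f t * v t * r t)) * u y +
        (rwr f f1 u u1 x - (s - lam) * Rint (oo_ax y%:E x) (fun t => f t * u t * r t)) * v y.
Proof.
move=> fs Iy Ix yx.
rewrite -(lagrange_identity st fs vs Iy Ix (ltW yx)) -(lagrange_identity st fs us Iy Ix (ltW yx)).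
by rewrite {1}(@sol_coords f f1 y Iy); ring.
Qed.

Lemma Ln_mid (f g : R -> R) x y : AC_loc I (cf f) -> AC_loc I (cf g) -> I y -> I x ->
  Ln (oo_ax y%:E x) (fun t => f t * g t * r t).
Proof.
move=> fAC gAC Iy Ix; apply: Ln_cc_oo.
exact: Ln_AC_mul (AC_locM_real fAC gAC) (standing_r st) Iy Ix.
Qed.

Lemma Ln_r x y : I y -> I x -> Ln (oo_ax y%:E x) (fun t => `|r t|).
Proof.
move=> Iy Ix; apply: Ln_norm; first exact: measurable_oo_ax.
by apply: Ln_cc_oo; exact: (standing_r st).
Qed.

(** If [|f - g| <= be] on [[y, x]], then [|f| <= be + B], and the expansion returns a bound in which
    [be] is at most halved. The factor [2 * M * M] counts two integrals, each with one basis
    function inside and one outside. *)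
Lemma sol_close s f f1 g g1 y x (M B : R) : I y -> I x -> y < x ->
  is_rsol I p q r s f f1 -> is_rsol I p q r lam g g1 ->
  (forall t, y <= t -> t <= x -> `|u t| <= M /\ `|v t| <= M) ->
  (forall t, y <= t -> t <= x -> `|g t| <= B) ->
  2 * M * M * Rint (oo_ax y%:E x) (fun t => `|r t|) * `|s - lam| <= 2^-1 ->
  forall t, y <= t -> t <= x -> `|f t - g t| <=
   2 * (M * (`|rwr f f1 v v1 x - rwr g g1 v v1 x| + `|rwr f f1 u u1 x - rwr g g1 u u1 x|)
        + 2 * M * M * Rint (oo_ax y%:E x) (fun t => `|r t|) * `|s - lam| * B).
Proof.
move=> Iy Ix yx fs gs uvM gB small; set e1 := `|_ - rwr g g1 v v1 x|; set e2 := `|_ - rwr g g1 u u1 x|.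
set rho := 2 * M * M * _ * _ in small *.
have [M0 B0] : 0 <= M /\ 0 <= B.
  split; first by apply: le_trans (proj1 (uvM x (ltW yx) (lexx x))).
  by apply: le_trans (gB x (ltW yx) (lexx x)).
have [fAC gAC] := (is_rsol_AC fs, is_rsol_AC gs).
have [uAC vAC] := (is_rsol_AC us, is_rsol_AC vs).
have Rr0 t : 0 <= Rint (oo_ax t%:E x) (fun t => `|r t|) by exact: Rintegral_ge0.
have ew t : y <= t -> t <= x ->
  `|- (rwr f f1 v v1 x - rwr g g1 v v1 x) * u t + (rwr f f1 u u1 x - rwr g g1 u u1 x) * v t| <= M * (e1 + e2).
  move=> yt tx; have [uM vM] := uvM t yt tx.
  rewrite (le_trans (ler_normD _ _))// !normrM normrN mulrDr.
  by apply: lerD; rewrite mulrC ler_wpM2r.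
have key t : y <= t /\ t <= x -> `|f t - g t| <= 2 * (M * (e1 + e2) + rho * B); last first.
  by move=> t yt tx; apply: key.
apply: (contraction_bound (S := [set t | y <= t /\ t <= x]) (f := fun t => `|f t - g t|)).
  have [N _ NP] := AC_on_bounded (fAC y x Iy Ix (ltW yx)).
  exists (N + B) => w [yw wx]; rewrite (le_trans (ler_normB _ _))// lerD ?gB//.
  by rewrite -cmod_RC; exact: NP.
move=> be beP w [yw]; have be0 : 0 <= be by apply: le_trans (beP x (conj (ltW yx) (lexx x))).
rewrite le_eqVlt => /predU1P[->|wx].
  rewrite (sol_coords f f1 Ix) (sol_coords g g1 Ix).
  have -> : - rwr f f1 v v1 x * u x + rwr f f1 u u1 x * v x - (- rwr g g1 v v1 x * u x + rwr g g1 u u1 x * v x)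
    = - (rwr f f1 v v1 x - rwr g g1 v v1 x) * u x + (rwr f f1 u u1 x - rwr g g1 u u1 x) * v x by ring.
  rewrite (le_trans (ew x (ltW yx) (lexx x)))// -addrA lerDl addr_ge0 ?divr_ge0//.
  by rewrite mulr_ge0// !mulr_ge0.
have Iw := oo_itv_between Iy Ix yw (ltW wx).
have Rle : Rint (oo_ax w%:E x) (fun t => `|r t|) <= Rint (oo_ax y%:E x) (fun t => `|r t|).
  move: yw; rewrite le_eqVlt => /predU1P[->//|yw].
  by rewrite [leRHS](Rint_split _ wx (Ln_r Iy Ix)) ?lte_fin// lerDr; exact: Rintegral_ge0.
have Kb k : AC_loc I (cf k) -> (forall t, y <= t -> t <= x -> `|k t| <= M) ->
    `|Rint (oo_ax w%:E x) (fun t => f t * k t * r t)| <= (be + B) * M * Rint (oo_ax y%:E x) (fun t => `|r t|).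
  move=> kAC kM; apply: (@le_trans _ _ ((be + B) * M * Rint (oo_ax w%:E x) (fun t => `|r t|))).
    have ri := Ln_r Iw Ix; have mw := @measurable_oo_ax R w%:E x.
    rewrite -(RintegralZl _ mw ri); apply: normr_Rint_le; [|exact: LnZ|exact: mw].
    move=> {}t; rewrite oo_axE /= in_itv/= => /andP[wt tx].
    have yt := le_trans yw (ltW wt).
    rewrite !normrM ler_wpM2r// ler_pM ?kM ?(ltW tx)//.
    have -> : f t = (f t - g t) + g t by rewrite subrK.
    rewrite (le_trans (ler_normD _ _))// lerD ?gB ?(ltW tx)//.
    by apply: beP; split => //; exact: ltW.
  by rewrite ler_wpM2l// mulr_ge0// addr_ge0.
have Kv := Kb v vAC (fun t yt tx => proj2 (uvM t yt tx)).
have Ku := Kb u uAC (fun t yt tx => proj1 (uvM t yt tx)).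
rewrite (sol_expansion fs Iw Ix wx) (sol_expansion gs Iw Ix wx) !subrr !mul0r addr0 subr0.
set KV := Rint _ _ in Kv *; set KU := Rint _ _ in Ku *; set Rr := Rint _ _ in Kv Ku rho small *.
have -> : (- rwr f f1 v v1 x + (s - lam) * KV) * u w + (rwr f f1 u u1 x - (s - lam) * KU) * v w
   - (- rwr g g1 v v1 x * u w + rwr g g1 u u1 x * v w) =
   (- (rwr f f1 v v1 x - rwr g g1 v v1 x) * u w + (rwr f f1 u u1 x - rwr g g1 u u1 x) * v w)
   + (s - lam) * (KV * u w - KU * v w) by ring.
have [uM vM] := uvM w yw (ltW wx).
have K1 : `|(s - lam) * (KV * u w - KU * v w)| <= rho * (be + B).
  rewrite normrM.
  apply: (@le_trans _ _ (`|s - lam| * ((be + B) * M * Rr * M + (be + B) * M * Rr * M))).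
    rewrite ler_wpM2l// (le_trans (ler_normB _ _))// !normrM.
    by apply: lerD; apply: ler_pM.
  by rewrite le_eqVlt; apply/orP; left; apply/eqP; rewrite /rho; ring.
apply: (le_trans (ler_normD _ _)); apply: (le_trans (lerD (ew w yw (ltW wx)) K1)).
have : rho * be <= 2^-1 * be by rewrite ler_wpM2r.
rewrite mulrDr; lra.
Qed.

End ThetaExpansion.

(** * The first two Taylor coefficients of theta *)

Section ThetaCoefficient.
Context {R : realType} (a b : \bar R) (p q r : R -> R) (lam : R) (u u1 v v1 : R -> R).
Local Notation mu := (@completed_lebesgue_measure R).
Local Notation LT := (LebT R).
Local Notation I := (@oo_itv R a b).
Local Notation Rint D f := (Rintegral mu (D : set LT) f).
Local Notation J x f := (Rintegral mu (oo_ax a x) f).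
Hypothesis ls : local_setting a b p q r lam u u1 v v1.

Let st := ls_standing ls.
Let us := ls_u ls.
Let vs := ls_v ls.
Let W := ls_W ls.
Let u0 := ls_u0 ls.
Let v0 := ls_v0 ls.
Let uv_lim := ls_lim ls.
Let uvi := ls_uvi ls.

Local Notation h := (quot u v).

Local Notation om := (om a r u v).

Let mo x : measurable (oo_ax a x : set LT).
Proof. exact: measurable_oo_ax. Qed.

Lemma cvg_dominated_near (x e : nat -> R) (l : R) : (\forall n \near \oo, `|x n - l| <= e n) ->
  e @ \oo --> (0 : R) -> x @ \oo --> l.
Proof.
move=> xe /cvgrPdist_lt e0; apply/cvgrPdist_lt => d d0.
apply: (filterS _ (filterI xe (e0 _ d0))) => n [xn]; rewrite sub0r normrN distrC => en.
by apply: le_lt_trans xn _; apply: le_lt_trans (ler_norm _) en.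
Qed.

(** [Th n] and [Ph n] stand for the real parts of theta and phi at [lam + d n], [T0] and [F0] for
    those at [lam]. The primed quasi-derivatives are unrelated for different [n], so convergence is
    assumed for values only. *)
Variables (x0 : R) (d : nat -> R) (Th Th' Ph Ph' : nat -> R -> R) (T0 T0' F0 F0' th1 : R -> R).
Hypotheses (Ix0 : I x0) (d0 : forall n, d n != 0) (dcvg : d @ \oo --> (0 : R))
  (dsmall : forall n, `|d n| * om x0 <= 2^-1)
  (Ths : forall n, is_rsol I p q r (lam + d n) (Th n) (Th' n))
  (Phs : forall n, is_rsol I p q r (lam + d n) (Ph n) (Ph' n))
  (Phu : forall n x, (a < x%:E)%E -> x <= x0 -> `|Ph n x - u x| <= 2 * `|d n| * om x * `|u x|)
  (ThPh : forall n, rwr (Th n) (Th' n) (Ph n) (Ph' n) x0 = 1)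
  (T0s : is_rsol I p q r lam T0 T0') (F0s : is_rsol I p q r lam F0 F0')
  (F0u : forall x, (a < x%:E)%E -> x <= x0 -> F0 x = u x)
  (TF0 : rwr T0 T0' F0 F0' x0 = 1)
  (Thcvg : forall x, I x -> Th n x @[n --> \oo] --> T0 x)
  (th1cvg : forall x, I x -> (Th n x - T0 x) / d n @[n --> \oo] --> th1 x).

Let T1 n := - rwr (Th n) (Th' n) v v1 x0.
Let T2 n := rwr (Th n) (Th' n) u u1 x0.
Let t1 := - rwr T0 T0' v v1 x0.
Let aa n := J x0 (fun t => Ph n t * v t * r t).
Let bb n := J x0 (fun t => Ph n t * u t * r t).

Let lamd n : lam + d n - lam = d n. Proof. by rewrite addrAC subrr add0r. Qed.

Let below x : (a < x%:E)%E -> x <= x0 -> I x.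
Proof. by move=> ax xx; split => //; case: Ix0 => _; apply: le_lt_trans; rewrite lee_fin. Qed.

(* The value of [Th n] at [x0] and the normalization of the Wronskian are two
   linear equations for the coordinates [T1 n], [T2 n]; this gives their
   convergence without any control on the quasi-derivatives of [Th n]. *)
Let coordsE n : [/\ Ln (oo_ax a x0) (fun t => Ph n t * u t * r t),
  Ln (oo_ax a x0) (fun t => Ph n t * v t * r t) & T2 n * (1 - d n * aa n) - T1 n * (d n * bb n) = 1].
Proof.
have [] := @phi_coords _ _ _ _ _ _ _ _ _ _ _ ls (lam + d n) (Ph n) (Ph' n) x0 Ix0 (Phs n).
- by rewrite lamd; exact: Phu.
- by rewrite lamd.
by rewrite lamd => iu iv e2 e1; split => //; rewrite -e2 -e1 -(wr_plucker ls).
Qed.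

(** [F0] agrees with [u] on (a, x0], so its coordinates are 1 and 0, and the unit Wronskian reads
    off the [v]-coordinate of [T0]. *)
Let t2E : rwr T0 T0' u u1 x0 = 1.
Proof.
have [] := @phi_coords _ _ _ _ _ _ _ _ _ _ _ ls lam F0 F0' x0 Ix0 F0s.
- by move=> x ax xx; rewrite F0u// !subrr normr0 mulr0 !mul0r.
- by rewrite subrr normr0 mul0r invr_ge0.
rewrite subrr !mul0r subr0 => _ _ e2 e1.
by have := TF0; rewrite (wr_plucker ls)// e1 e2 mulr1 mulr0 subr0.
Qed.

Lemma theta0E x : (a < x%:E)%E -> x <= x0 -> T0 x = t1 * u x + v x.
Proof.
move=> ax; rewrite le_eqVlt => /predU1P[->|xx].
  by rewrite (sol_coords ls T0 T0' Ix0) t2E mul1r.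
rewrite (sol_expansion ls T0s (below ax (ltW xx)) Ix0 xx) subrr !mul0r addr0 subr0.
by rewrite t2E mul1r.
Qed.

Let Ln_uv : Ln (oo_ax a x0) (fun t => u t * v t * r t). Proof. exact: uvi. Qed.
Let Ln_uu : Ln (oo_ax a x0) (fun t => u t * u t * r t). Proof. exact: Ln_uur ls _ Ix0. Qed.

(** The bound on [Ph n - u] is relative to [u], so the integrals converge at the rate [|d n|] on the
    whole of (a, x0). *)
Let coefcvg (k : R -> R) : Ln (oo_ax a x0) (fun t => u t * k t * r t) ->
  (forall n, Ln (oo_ax a x0) (fun t => Ph n t * k t * r t)) ->
  J x0 (fun t => Ph n t * k t * r t) @[n --> \oo] --> J x0 (fun t => u t * k t * r t).
Proof.
move=> iuk iPk.
apply: (@cvg_dominated_near _ (fun n => `|d n| * (2 * om x0 * J x0 (fun t => `|u t * k t * r t|)))).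
  apply: nearW => n; have ni := Ln_norm (mo _) iuk.
  rewrite -(RintegralB (mo x0) (iPk n) iuk) mulrA -(RintegralZl _ (mo x0) ni).
  apply: normr_Rint_le; [|exact: LnZ|exact: mo].
  move=> t xt; have [It tx] := oo_ax_sub Ix0 xt.
  rewrite -!mulrBl [`|u t * _ * _|]normrM !normrM !mulrA ler_wpM2r// ler_wpM2r//.
  apply: (le_trans (Phu n (proj1 It) (ltW tx))).
  have omt : om t <= om x0 := om_le ls (proj1 It) Ix0 (ltW tx).
  apply: (@le_trans _ _ (2 * `|d n| * om x0 * `|u t|)).
    by rewrite ler_wpM2r// ler_wpM2l// mulr_ge0.
  by rewrite le_eqVlt; apply/orP; left; apply/eqP; ring.
rewrite -[X in _ --> X](mul0r (2 * om x0 * J x0 (fun t => `|u t * k t * r t|))).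
by apply: cvgM; [rewrite -(@normr0 _ R); exact: cvg_norm|exact: cvg_cst].
Qed.

Let aacvg : aa @ \oo --> J x0 (fun t => u t * v t * r t).
Proof. by apply: coefcvg => // n; case: (coordsE n). Qed.

Let bbcvg : bb @ \oo --> J x0 (fun t => u t * u t * r t).
Proof. by apply: coefcvg => // n; case: (coordsE n). Qed.

Let P1cvg : (fun n => 1 - d n * aa n) @ \oo --> (1 : R).
Proof.
rewrite -[X in _ --> X]subr0 -(mul0r (J x0 (fun t => u t * v t * r t))).
by apply: cvgB; [exact: cvg_cst|exact: cvgM].
Qed.

Let P2cvg : (fun n => d n * bb n) @ \oo --> (0 : R).
Proof. by rewrite -(mul0r (J x0 (fun t => u t * u t * r t))); exact: cvgM. Qed.

(** Determinant of the linear system for [T1 n] and [T2 n]. Its limit [u x0] is nonzero, so Cramer's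
    quotients are valid for large [n]. *)
Let Del n := u x0 * (1 - d n * aa n) + v x0 * (d n * bb n).

Let Delcvg : Del @ \oo --> u x0.
Proof.
rewrite -[X in _ --> X]addr0 -{1}(mulr1 (u x0)) -(mulr0 (v x0)).
by apply: cvgD; apply: cvgM => //; exact: cvg_cst.
Qed.

Let ThE n : Th n x0 = T1 n * u x0 + T2 n * v x0.
Proof. exact: sol_coords ls _ _ _ Ix0. Qed.

Let T1cvg : T1 @ \oo --> t1.
Proof.
have ux := u0 Ix0.
have -> : t1 = (T0 x0 * 1 - v x0) / u x0.
  by rewrite (theta0E (proj1 Ix0) (lexx _)); field.
have h : (fun n => (Th n x0 * (1 - d n * aa n) - v x0) / Del n) @ \oo --> (T0 x0 * 1 - v x0) / u x0.
  apply: cvgM; last exact: cvgV.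
  by apply: cvgB; [apply: cvgM => //; exact: Thcvg|exact: cvg_cst].
have nE : \forall n \near \oo, (Th n x0 * (1 - d n * aa n) - v x0) / Del n = T1 n.
  apply: (filterS _ (cvgr_neq0 _ Delcvg ux)) => n Dn.
  apply: (mulIf Dn); rewrite divfK// ThE /Del.
  have [_ _ e] := coordsE n; have ve : v x0 = v x0 * (T2 n * (1 - d n * aa n) - T1 n * (d n * bb n)) by rewrite e mulr1.
  rewrite [X in _ - X = _]ve; ring.
by apply: cvg_trans h; exact: near_eq_cvg nE.
Qed.

Let T2cvg : T2 @ \oo --> (1 : R).
Proof.
have ux := u0 Ix0.
have -> : 1 = (u x0 + T0 x0 * 0) / u x0 by field.
have h : (fun n => (u x0 + Th n x0 * (d n * bb n)) / Del n) @ \oo --> (u x0 + T0 x0 * 0) / u x0.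
  apply: cvgM; last exact: cvgV.
  by apply: cvgD; [exact: cvg_cst|apply: cvgM => //; exact: Thcvg].
have nE : \forall n \near \oo, (u x0 + Th n x0 * (d n * bb n)) / Del n = T2 n.
  apply: (filterS _ (cvgr_neq0 _ Delcvg ux)) => n Dn.
  apply: (mulIf Dn); rewrite divfK// ThE /Del.
  have [_ _ e] := coordsE n; have ue : u x0 = u x0 * (T2 n * (1 - d n * aa n) - T1 n * (d n * bb n)) by rewrite e mulr1.
  rewrite [X in X + _ = _]ue; ring.
by apply: cvg_trans h; exact: near_eq_cvg nE.
Qed.

(** The derivative of the coordinate [T2] at [lam]; since [T0 = t1 u + v], it is the integral of
    [T0 u r] over (a, x0). *)
Let c2 := J x0 (fun t => u t * v t * r t) + t1 * J x0 (fun t => u t * u t * r t).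

Let T2diff : (fun n => (T2 n - 1) / d n) @ \oo --> c2.
Proof.
(* The Wronskian equation in [coordsE], solved for [T2 n - 1], carries an exact factor [d n]. *)
rewrite (_ : (fun n => _) = (fun n => T2 n * aa n + T1 n * bb n)).
  rewrite /c2 -(mul1r (J x0 (fun t => u t * v t * r t))).
  by apply: cvgD; exact: cvgM.
apply/funext => n; apply: (mulIf (d0 n)); rewrite divfK//.
have [_ _ e] := coordsE n; rewrite -[X in _ - X = _]e; ring.
Qed.

(** The derivative of [T1] at [lam], forced by the derivative [th1 x0] of the value at [x0]. *)
Let A := (th1 x0 - c2 * v x0) / u x0.

Let T1diff : (fun n => (T1 n - t1) / d n) @ \oo --> A.
Proof.
have ux := u0 Ix0.
rewrite (_ : (fun n => _) = (fun n => ((Th n x0 - T0 x0) / d n - (T2 n - 1) / d n * v x0) / u x0)).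
  apply: cvgM; last exact: cvg_cst.
  by apply: cvgB; [exact: th1cvg|apply: cvgM => //; exact: cvg_cst].
apply/funext => n; rewrite ThE (theta0E (proj1 Ix0) (lexx _)).
by field; rewrite ux d0.
Qed.

(** In the difference quotient at [y], expanded from [x0], the integrals carry a factor [d n] that
    cancels. Their limit therefore requires only uniform convergence of [Th n] on [[y, x0]], which
    [sol_close] supplies. *)
Lemma theta1E : exists A', forall y, (a < y%:E)%E -> y < x0 ->
  th1 y = u y * (A' + Rint (oo_ax y%:E x0) (fun t => T0 t * v t * r t))
        + v y * J y (fun t => T0 t * u t * r t).
Proof.
exists A => y ay yx; have Iy := below ay (ltW yx).
have [uAC vAC] := (is_rsol_AC us, is_rsol_AC vs); have TAC := is_rsol_AC T0s.
have [Mu Mu0 MuP] := AC_loc_bounded uAC Iy Ix0; have [Mv Mv0 MvP] := AC_loc_bounded vAC Iy Ix0.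
have [B B0 BP] := AC_loc_bounded TAC Iy Ix0.
pose M := Mu + Mv.
have uvM t : y <= t -> t <= x0 -> `|u t| <= M /\ `|v t| <= M.
  move=> yt tx; have := MuP t yt tx; have := MvP t yt tx.
  by rewrite /M => k1 k2; split; lra.
pose Rr := Rint (oo_ax y%:E x0) (fun t => `|r t|).
pose E n := 2 * (M * (`|T1 n - t1| + `|T2 n - 1|) + 2 * M * M * Rr * `|d n| * B).
have nd : (fun n => `|d n|) @ \oo --> (0 : R) by rewrite -(@normr0 _ R); exact: cvg_norm.
have Ecvg : E @ \oo --> (0 : R).
  have e : 0 = 2 * (M * (`|t1 - t1| + `|1 - 1|) + 2 * M * M * Rr * 0 * B) :> R.
    by rewrite !subrr normr0; ring.
  rewrite [X in _ --> X]e.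
  apply: cvgM; first exact: cvg_cst.
  apply: cvgD.
    apply: cvgM; first exact: cvg_cst.
    by apply: cvgD; apply: cvg_norm; apply: cvgB => //; exact: cvg_cst.
  by apply: cvgM; [apply: cvgM => //; exact: cvg_cst|exact: cvg_cst].
have close : \forall n \near \oo, forall t, y <= t -> t <= x0 -> `|Th n t - T0 t| <= E n.
  have small : \forall n \near \oo, 2 * M * M * Rr * `|d n| <= 2^-1.
    have : (fun n => 2 * M * M * Rr * `|d n|) @ \oo --> (0 : R).
      rewrite -[X in _ --> X](mulr0 (2 * M * M * Rr)).
      by apply: cvgM => //; exact: cvg_cst.
    by move=> /cvgr_le; apply; rewrite invr_gt0.
  apply: filterS small => n sn t yt tx.
  have := @sol_close _ _ _ _ _ _ _ _ _ _ _ ls (lam + d n) (Th n) (Th' n) T0 T0' y x0 M B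
     Iy Ix0 yx (Ths n) T0s uvM BP.
  rewrite lamd => /(_ sn t yt tx); rewrite t2E -/(T2 n) -/Rr.
  have -> : rwr (Th n) (Th' n) v v1 x0 - rwr T0 T0' v v1 x0 = - (T1 n - t1).
    by rewrite /T1 /t1; ring.
  by rewrite normrN.
have Kcvg k : AC_loc I (cf k) ->
    Rint (oo_ax y%:E x0) (fun t => Th n t * k t * r t) @[n --> \oo] -->
    Rint (oo_ax y%:E x0) (fun t => T0 t * k t * r t).
  move=> kAC; have my := @measurable_oo_ax R y%:E x0.
  have ik : Ln (oo_ax y%:E x0) (fun t => `|k t * r t|).
    by apply: (Ln_norm my); apply: Ln_cc_oo; exact: Ln_AC_mul kAC (standing_r st) Iy Ix0.
  apply: (@cvg_dominated_near _ (fun n => E n * Rint (oo_ax y%:E x0) (fun t => `|k t * r t|))).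
    apply: filterS close => n cn.
    have i1 := Ln_mid ls (is_rsol_AC (Ths n)) kAC Iy Ix0.
    have i2 := Ln_mid ls TAC kAC Iy Ix0.
    rewrite -(RintegralB my i1 i2) -(RintegralZl _ my ik).
    apply: normr_Rint_le; [|exact: LnZ|exact: my].
    move=> t; rewrite oo_axE /= in_itv/= => /andP[/ltW yt /ltW tx].
    by rewrite -!mulrBl -mulrA normrM ler_wpM2r// cn.
  rewrite -[X in _ --> X](mul0r (Rint (oo_ax y%:E x0) (fun t => `|k t * r t|))).
  by apply: cvgM => //; exact: cvg_cst.
set Kv := Rint _ _; pose Ku := Rint (oo_ax y%:E x0) (fun t => T0 t * u t * r t).
have lim2 : (fun n => (Th n y - T0 y) / d n) @ \oo --> A * u y + c2 * v y + (Kv * u y - Ku * v y).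
  rewrite (_ : (fun n => _) = (fun n => (T1 n - t1) / d n * u y + (T2 n - 1) / d n * v y
     + (Rint (oo_ax y%:E x0) (fun t => Th n t * v t * r t) * u y
       - Rint (oo_ax y%:E x0) (fun t => Th n t * u t * r t) * v y))).
    apply: cvgD.
      by apply: cvgD; apply: cvgM => //; exact: cvg_cst.
    by apply: cvgB; (apply: cvgM; [exact: Kcvg|exact: cvg_cst]).
  apply/funext => n; rewrite (sol_expansion ls (Ths n) Iy Ix0 yx) lamd -/(T1 n) -/(T2 n).
  rewrite (theta0E ay (ltW yx)).
  by field; exact: d0.
have -> := cvg_unique (@Rhausdorff R) (th1cvg Iy) lim2.
have T0i : Ln (oo_ax a x0) (fun t => T0 t * u t * r t).
  apply: (Ln_eq (f := fun t => u t * v t * r t + t1 * (u t * u t * r t)) (mo x0)).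
    move=> t xt; have [It tx] := oo_ax_sub Ix0 xt.
    by rewrite (theta0E (proj1 It) (ltW tx)); ring.
  by apply: (LnD (mo x0)) => //; exact: (LnZ _ (mo x0)).
have c2E : c2 = J x0 (fun t => T0 t * u t * r t).
  rewrite /c2 -(RintegralZl _ (mo x0) Ln_uu) -(RintegralD (mo x0) Ln_uv (LnZ _ (mo x0) Ln_uu)).
  apply: eq_Rintegral => t /set_mem xt; have [It tx] := oo_ax_sub Ix0 xt.
  by rewrite (theta0E (proj1 It) (ltW tx)); ring.
(* [c2] integrates over all of (a, x0); subtracting [Ku] leaves the part over (a, y). *)
have := Rint_split ay yx T0i; rewrite -c2E -/Ku => ->; ring.
Qed.

End ThetaCoefficient.

(** * The ratio of [u] to the coefficients of theta, and square integrability of [v] *)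

Section RatioLimit.
Context {R : realType} (a b : \bar R) (p q r : R -> R) (lam : R) (u u1 v v1 : R -> R).
Local Notation mu := (@completed_lebesgue_measure R).
Local Notation LT := (LebT R).
Local Notation I := (@oo_itv R a b).
Local Notation Rint D f := (Rintegral mu (D : set LT) f).
Local Notation J x f := (Rintegral mu (oo_ax a x) f).
Hypothesis ls : local_setting a b p q r lam u u1 v v1.

Let st := ls_standing ls.
Let us := ls_u ls.
Let vs := ls_v ls.
Let W := ls_W ls.
Let u0 := ls_u0 ls.
Let v0 := ls_v0 ls.
Let uv_lim := ls_lim ls.
Let uvi := ls_uvi ls.

Local Notation h := (quot u v).

Let mo x : measurable (oo_ax a x : set LT).
Proof. exact: measurable_oo_ax. Qed.

(** Monotone convergence along intervals [(y n, x)] exhausting (a, x). *)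
Lemma Ln_of_bounded (f : R -> R) x y0 (B : R) : I x -> I y0 ->
  measurable_fun (oo_ax a x) (f : LT -> R) ->
  (forall y, I y -> y < y0 -> Ln (oo_ax y%:E x) f /\ Rint (oo_ax y%:E x) (fun t => `|f t|) <= B) ->
  Ln (oo_ax a x) f.
Proof.
move=> Ix Iy0 mf fB; have [z Iz zy] := oo_itv_lt Iy0.
have [y [yP [ynd ycvg]]] := at_a_seq Iz.
have Iy n : I (y n) /\ y n < y0.
  have [ay yz] := yP n; split; last exact: le_lt_trans zy.
  by split => //; case: Iz => _; apply: le_lt_trans; rewrite lee_fin.
pose F n : set LT := oo_ax (y n)%:E x.
have FU : \bigcup_i F i = oo_ax a x.
  apply/seteqP; split => t.
    by move=> [n _ [yt tx]]; split => //; apply: lt_trans yt; case: (yP n).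
  move=> xt; have [It tx] := oo_ax_sub Ix xt; have [w Iw wt] := oo_itv_lt It.
  have [N _ NP] := ycvg w (proj1 Iw); exists N => //; split => //.
  by rewrite lte_fin; apply: le_lt_trans wt; exact: NP N (leqnn N).
have ndF : nondecreasing_seq F.
  apply/nondecreasing_seqP => n; apply/subsetPset => t [yt tx]; split => //.
  by apply: le_lt_trans yt; rewrite lee_fin.
have mF n : measurable (F n) by exact: measurable_oo_ax.
have mfF n : measurable_fun (F n) (fun t => `|f t|%:E).
  apply/measurable_EFinP/measurableT_comp => //.
  apply: measurable_funS mf; first exact: mo.
  by rewrite -FU; exact: bigcup_sup.
have f0 i t : F i t -> (0 <= `|f t|%:E)%E by rewrite lee_fin.
have := @ge0_nondecreasing_set_cvg_integral _ _ _ F (fun t => `|f t|%:E) mu ndF mF mfF f0.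
rewrite FU => H.
apply: (Ln_lty (mo x) mf); apply: (@le_lt_trans _ _ B%:E); last exact: ltry.
apply: (@cvge_to_le _ _ _ _ _ _ _ H); apply: nearW => n.
have [Iyn yn] := Iy n; have [fi fb] := fB _ Iyn yn.
by rewrite -[leLHS]fineK ?lee_fin//; exact: integrable_fin_num (Ln_norm (mF n) fi).
Qed.

Variables (x0 al A : R) (T0 th1 : R -> R).
Hypotheses (Ix0 : I x0) (T0AC : AC_loc I (cf T0))
  (T0E : forall x, (a < x%:E)%E -> x <= x0 -> T0 x = al * u x + v x)
  (th1E : forall y, (a < y%:E)%E -> y < x0 ->
    th1 y = u y * (A + Rint (oo_ax y%:E x0) (fun t => T0 t * v t * r t))
          + v y * J y (fun t => T0 t * u t * r t)).

Let uAC : AC_loc I (cf u) := is_rsol_AC us.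
Let vAC : AC_loc I (cf v) := is_rsol_AC vs.

Let below x : (a < x%:E)%E -> x <= x0 -> I x.
Proof. by move=> ax xx; split => //; case: Ix0 => _; apply: le_lt_trans; rewrite lee_fin. Qed.

(** [T0 v = (1 + al h) v^2] and [h] tends to zero at [a]; the bounds 1/2 and 2 follow from
    [|al h| <= 1/2]. *)
Lemma theta0_comparable : exists2 x1, I x1 & x1 < x0 /\ forall t, (a < t%:E)%E -> t <= x1 ->
  2^-1 * v t ^+ 2 <= T0 t * v t /\ T0 t * v t <= 2 * v t ^+ 2 /\ T0 t * u t = h t * (T0 t * v t).
Proof.
(* The threshold for [h] that makes [|al h| <= 1/2]; the [+ 1] covers [al = 0]. *)
have e0 : 0 < (2 * (`|al| + 1))^-1 by rewrite invr_gt0 mulr_gt0// ltr_wpDl.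
have [z Iz zP] := uv_lim e0.
have [x1 Ix1] : exists2 y, I y & y < Num.min z x0 by apply: oo_itv_lt; case: (leP z x0).
rewrite lt_min => /andP[x1z x1x0]; exists x1 => //; split => // t at_ tx1.
have It : I t by apply: below => //; exact: le_trans (ltW x1x0).
have hk := zP t at_ (le_lt_trans tx1 x1z); rewrite -/(h t) gtr0_norm ?(h_gt0 ls It)// in hk.
have uE : u t = h t * v t by rewrite /quot divfK// v0.
have k : `|al * h t| <= 2^-1.
  rewrite normrM (gtr0_norm (h_gt0 ls It)).
  apply: (@le_trans _ _ ((`|al| + 1) * (2 * (`|al| + 1))^-1)).
    by apply: ler_pM => //; [exact/ltW/(h_gt0 ls It)|rewrite lerDl|exact: ltW].
  have : `|al| + 1 != 0 by rewrite gt_eqF// ltr_wpDl.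
  by move: (`|al| + 1) => w w0; rewrite le_eqVlt; apply/orP; left; apply/eqP; field.
rewrite (T0E at_ (le_trans tx1 (ltW x1x0))) {1 2}uE.
have -> : (al * (h t * v t) + v t) * v t = (1 + al * h t) * v t ^+ 2 by ring.
have v2 : 0 <= v t ^+ 2 by exact: sqr_ge0.
move: k; rewrite ler_norml => /andP[k1 k2].
split; first by apply: ler_wpM2r => //; lra.
split; first by apply: ler_wpM2r => //; lra.
by rewrite {2}uE; ring.
Qed.

Let Ln_T0u x : (a < x%:E)%E -> x <= x0 -> Ln (oo_ax a x) (fun t => T0 t * u t * r t).
Proof.
move=> ax xx; have Ix := below ax xx.
apply: (Ln_eq (f := fun t => u t * v t * r t + al * (u t * u t * r t)) (mo x)).
  move=> t xt; have [It tx] := oo_ax_sub Ix xt.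
  by rewrite (T0E (proj1 It) (le_trans (ltW tx) xx)); ring.
by apply: (LnD (mo x)); [exact: uvi|apply: (LnZ _ (mo x)); exact: Ln_uur ls _ Ix].
Qed.

(** Cutting at [x1] separates a constant from the integrals over the region where
    [theta0_comparable] will provide a sign. *)
Lemma theta1_ratio x1 y : I x1 -> x1 < x0 -> (a < y%:E)%E -> y < x1 ->
  th1 y / u y = A + Rint (oo_ax x1%:E x0) (fun t => T0 t * v t * r t)
    + Rint (oo_ax y%:E x1) (fun t => T0 t * v t * r t) + J y (fun t => T0 t * u t * r t) / h y.
Proof.
move=> Ix1 x10 ay y1; have yx0 := lt_trans y1 x10; have Iy := below ay (ltW yx0).
rewrite th1E//.
have yx1 : (y%:E < x1%:E)%E by rewrite lte_fin.
rewrite (Rint_split yx1 x10 (Ln_mid ls T0AC vAC Iy Ix0)) /quot.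
by field; rewrite u0// v0.
Qed.

Let ae_r : {ae mu, forall x : LT, I x -> 0 < r x}.
Proof. by apply: (filterS _ (standing_ae st)) => x px Ix; have [] := px Ix. Qed.

Lemma ratio_away_from0 (L : \bar R) : L != 0%E -> ratio_lim a u th1 L ->
  exists2 y, I y & exists K : R, forall x, (a < x%:E)%E -> x < y -> `|th1 x / u x| <= K.
Proof.
move=> L0 rL; have Inon : exists x, I x by exists x0.
suff : exists2 e : R, 0 < e & \forall x \near at_a a, e <= `|u x / th1 x|.
  move=> [e e0 /(near_at_a _ Inon)[y Iy yP]]; exists y => //.
  have [z Iz] : exists2 z, I z & z < Num.min y x0 by apply: oo_itv_lt; case: (leP y x0).
  exists e^-1 => x ax xy; have := yP x ax xy.
  have Ix : I x by split => //; case: Iy => _; apply: lt_trans; rewrite lte_fin.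
  (* The lower bound also excludes [th1 x = 0], where the quotient would be 0 by convention. *)
  move=> ex; have : 0 < `|u x / th1 x| by exact: lt_le_trans ex.
  rewrite -[th1 x / u x]invrK invf_div normfV => qpos.
  by rewrite lef_pV2 ?posrE.
case: L L0 rL => [l||] l0 rL.
- have l0' : 0 < `|l| / 2 by rewrite divr_gt0// normr_gt0.
  exists (`|l| / 2) => //; have fL := fine_cvg rL.
  have /cvgrPdist_lt rL' := fL (at_a_filter a).
  apply: (filterS _ (rL' _ l0')) => x /=; have := ler_normD (l - u x / th1 x) (u x / th1 x).
  by rewrite subrK; lra.
- exists 1 => //; move/cvgeyPge in rL; apply: (filterS _ (rL 1)) => x; rewrite lee_fin => k.
  exact: le_trans k (ler_norm _).
- exists 1 => //; move/cvgeNyPle in rL; apply: (filterS _ (rL (-1))) => x; rewrite lee_fin => k.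
  by rewrite -normrN; apply: le_trans (ler_norm _); lra.
Qed.

Lemma summand_le (s x y k : R) : 0 <= x -> `|s + y + x| <= k -> y <= k + `|s|.
Proof.
move=> x0' /(le_trans (ler_norm _)) k1; have := ler_norm (- s); rewrite normrN.
by move=> k2; lra.
Qed.

Lemma L2_of_ratio (L : \bar R) : L != 0%E -> ratio_lim a u th1 L ->
  exists2 x1, I x1 & Ln (oo_ax a x1) (fun t => v t * v t * r t).
Proof.
move=> L0 rL; have [y Iy [K KP]] := ratio_away_from0 L0 rL.
have [x1 Ix1 [x10 x1P]] := theta0_comparable; exists x1 => //.
pose A1 := A + Rint (oo_ax x1%:E x0) (fun t => T0 t * v t * r t).
have [y0 Iy0] : exists2 z, I z & z < Num.min y x1 by apply: oo_itv_lt; case: (leP y x1).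
rewrite lt_min => /andP[y0y y0x1].
(* The 2 undoes [2^-1 * v t ^+ 2 <= T0 t * v t]; [K] bounds [th1 / u], whose constant part is
   [A1]. *)
apply: (@Ln_of_bounded _ _ y0 (2 * (K + `|A1|)) Ix1 Iy0); first exact: measurable_AC_r ls _ _ _ vAC vAC Ix1.
move=> w Iw wy0; have wx1 := lt_trans wy0 y0x1; have aw := proj1 Iw.
have mw := @measurable_oo_ax R w%:E x1.
have fi := Ln_mid ls vAC vAC Iw Ix1; split => //.
have fn := Ln_norm mw fi; have Ti := Ln_mid ls T0AC vAC Iw Ix1.
have sub t : oo_ax w%:E x1 t -> [/\ I t, (a < t%:E)%E & t <= x1].
  move=> [wt tx1]; have at_ : (a < t%:E)%E by exact: lt_trans aw wt.
  by split => //; [apply: below => //; exact: le_trans (ltW tx1) (ltW x10)|exact: ltW].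
apply: (@le_trans _ _ (2 * Rint (oo_ax w%:E x1) (fun t => T0 t * v t * r t))).
  rewrite -(RintegralZl _ mw Ti); apply: (Rint_ae_le mw) => //; first exact: LnZ.
  apply: (filterS _ ae_r) => t rt /sub[It at_ tx1].
  have [k _] := x1P t at_ tx1; have rt0 := rt It.
  rewrite normrM (gtr0_norm rt0) mulrA ler_wpM2r ?(ltW rt0)//.
  by rewrite ger0_norm -expr2 ?sqr_ge0//; lra.
rewrite ler_wpM2l//.
have J0 : 0 <= J w (fun t => T0 t * u t * r t) / h w.
  rewrite divr_ge0 ?(ltW (h_gt0 ls Iw))//; apply: (Rint_ae_ge0 (mo w)).
    by apply: Ln_T0u => //; exact/ltW/(lt_trans wx1 x10).
  apply: (filterS _ ae_r) => t rt wt; have [It tw] := oo_ax_sub Iw wt.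
  have [k1 [_ ->]] := x1P t (proj1 It) (ltW (lt_trans tw wx1)).
  rewrite mulr_ge0 ?(ltW (rt It))// mulr_ge0 ?(ltW (h_gt0 ls It))//.
  by apply: le_trans k1; rewrite mulr_ge0 ?invr_ge0 ?sqr_ge0.
have := KP w aw (lt_trans wy0 y0y).
by rewrite (theta1_ratio Ix1 x10 aw wx1); exact: summand_le.
Qed.

Lemma ratio_theta0 : ratio_lim a u T0 0%E.
Proof.
have Inon : exists x, I x by exists x0.
apply: cvg_EFin; first exact: nearW.
apply/cvgrPdist_lt => e e0; apply/(near_at_a _ Inon).
have e20 : 0 < e / 2 by rewrite divr_gt0.
have [z Iz zP] := uv_lim e20; have [x1 Ix1 [x10 x1P]] := theta0_comparable.
have [y Iy] : exists2 y, I y & y < Num.min z x1 by apply: oo_itv_lt; case: (leP z x1).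
rewrite lt_min => /andP[yz yx1]; exists y => // x ax xy.
have Ix : I x by apply: below => //; rewrite ltW// (lt_trans xy)// (lt_trans yx1).
have [k1 _] := x1P x ax (ltW (lt_trans xy yx1)).
have := zP x ax (lt_trans xy yz); rewrite sub0r normrN /=.
have v2 : 0 < v x ^+ 2 by rewrite exprn_even_gt0//= v0.
have T0v : 0 < T0 x * v x by apply: lt_le_trans k1; rewrite mulr_gt0.
have T00 : T0 x != 0 by apply: contraTneq T0v => ->; rewrite mul0r ltxx.
have -> : u x / T0 x = u x / v x * (v x ^+ 2 / (T0 x * v x)) by field; rewrite T00 v0.
rewrite [X in _ -> X < _]normrM => hx; rewrite (@le_lt_trans _ _ (`|u x / v x| * 2))//.
  rewrite ler_wpM2l// ger0_norm; last by rewrite divr_ge0// ltW.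
  by rewrite ler_pdivrMr//; move: k1; lra.
by rewrite -ltr_pdivlMr.
Qed.

(* [th1 / u = A1 - ep] with [ep > 0] tending to [0]; the strict sign makes
   [u / th1] converge (to [-oo]) even when [A1 = 0]. *)
Lemma ratio_of_L2 x2 : I x2 -> Ln (oo_ax a x2) (fun t => v t * v t * r t) ->
  exists2 L : \bar R, L != 0%E & ratio_lim a u th1 L.
Proof.
move=> Ix2 vi.
have Inon : exists x, I x by exists x0.
have [x1' Ix1' [x10' x1P']] := theta0_comparable.
have [x1 Ix1] : exists2 y, I y & y < Num.min x1' x2 by apply: oo_itv_lt; case: (leP x1' x2).
rewrite lt_min => /andP[x1x1' x12].
have x10 := lt_trans x1x1' x10'.
have x1P t : (a < t%:E)%E -> t <= x1 -> _ := fun at_ tx => x1P' t at_ (le_trans tx (ltW x1x1')).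
have Ti : Ln (oo_ax a x1) (fun t => T0 t * v t * r t).
  apply: (Ln_le (g := fun t => 2 * `|v t * v t * r t|) (mo x1)).
  - exact: measurable_AC_r ls _ _ _ T0AC vAC Ix1.
  - move=> t xt; have [It tx] := oo_ax_sub Ix1 xt.
    have [k1 [k2 _]] := x1P t (proj1 It) (ltW tx).
    have v2 : 0 <= v t ^+ 2 by exact: sqr_ge0.
    rewrite normrM [`|v t * v t * _|]normrM mulrA ler_wpM2r//.
    rewrite -expr2 (ger0_norm v2) ger0_norm//.
    by apply: le_trans k1; rewrite mulr_ge0// invr_ge0.
  - by apply: (LnZ _ (mo x1)); apply: (Ln_norm (mo x1)); exact: Ln_sub (ltW x12) vi.
pose A1 := A + Rint (oo_ax x1%:E x0) (fun t => T0 t * v t * r t) + J x1 (fun t => T0 t * v t * r t).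
(* [ep y] is the integral over (a, y) of [(1 - h t / h y) T0 v r], and the first factor is positive
   because [h] increases strictly. *)
pose ep y := J y (fun t => T0 t * v t * r t) - J y (fun t => T0 t * u t * r t) / h y.
have E1 y : (a < y%:E)%E -> y < x1 -> th1 y / u y = A1 - ep y.
  move=> ay yx1; rewrite (theta1_ratio Ix1 x10 ay yx1) /A1 /ep (Rint_split ay yx1 Ti); ring.
have ep_bound y : (a < y%:E)%E -> y < x1 ->
    0 < ep y /\ ep y <= J y (fun t => `|T0 t * v t * r t|).
  move=> ay yx1; have yx0 := ltW (lt_trans yx1 x10); have Iy := below ay yx0.
  have hy := h_gt0 ls Iy; have Tiy := Ln_sub (ltW yx1) Ti; have Tuy := Ln_T0u ay yx0.
  have pos : {ae mu, forall t : LT, oo_ax a y t -> 0 < T0 t * v t * r t}.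
    apply: (filterS _ ae_r) => t rt yt; have [It ty] := oo_ax_sub Iy yt.
    have [k1 _] := x1P t (proj1 It) (ltW (lt_trans ty yx1)).
    rewrite mulr_gt0 ?rt//; apply: lt_le_trans k1.
    by rewrite mulr_gt0 ?invr_gt0// exprn_even_gt0//= v0.
  have hle t : oo_ax a y t -> T0 t * u t * r t = h t * (T0 t * v t * r t).
    move=> yt; have [It ty] := oo_ax_sub Iy yt.
    have [_ [_ e]] := x1P t (proj1 It) (ltW (lt_trans ty yx1)).
    by rewrite e !mulrA.
  have Thi := LnZ (h y)^-1 (mo y) Tuy.
  have epE : ep y = J y (fun t => T0 t * v t * r t - (h y)^-1 * (T0 t * u t * r t)).
    by rewrite (RintegralB (mo y) Tiy Thi) (RintegralZl _ (mo y) Tuy) /ep mulrC.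
  split.
    rewrite epE; apply: (Rint_ae_gt0 (mo y)); first exact: leb_mu_oo_ax_neq0.
      exact: LnB.
    apply: (filterS _ pos) => t tp yt; have /andP[ht hty] := h_le ls Iy yt.
    rewrite (hle t yt).
    have -> : T0 t * v t * r t - (h y)^-1 * (h t * (T0 t * v t * r t)) =
      (1 - h t / h y) * (T0 t * v t * r t) by ring.
    by rewrite mulr_gt0 ?tp// subr_gt0 ltr_pdivrMr// mul1r.
  have J0 : 0 <= J y (fun t => T0 t * u t * r t) / h y.
    rewrite divr_ge0 ?(ltW hy)//; apply: (Rint_ae_ge0 (mo y)) => //.
    apply: (filterS _ pos) => t tp yt; have /andP[ht hty] := h_le ls Iy yt.
    by rewrite (hle t yt) mulr_ge0 ?(ltW ht)// ltW// tp.
  rewrite /ep lerBlDr (le_trans _ (_ : J y (fun t => `|T0 t * v t * r t|) <= _))// ?lerDl//.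
  apply: (le_trans (ler_norm _)); apply: normr_Rint_le => //; exact: Ln_norm.
have ep_lim e : 0 < e -> exists2 y, I y & y <= x1 /\ forall x, (a < x%:E)%E -> x < y -> 0 < ep x /\ ep x < e.
  move=> e0; have [y Iy [yx1 yP]] := Rint_left_cvg0 Ix1 Ti e0.
  exists y => //; split => // x ax xy; have [k1 k2] := ep_bound x ax (lt_le_trans xy yx1).
  by split => //; apply: le_lt_trans k2 (yP x ax (ltW xy)).
have inv x : (a < x%:E)%E -> x < x1 -> u x / th1 x = (A1 - ep x)^-1.
  by move=> ax xx; rewrite -E1// invf_div.
have [A10|A10] := eqVneq A1 0.
  exists -oo%E => //; apply/cvgeNyPle => B; apply/(near_at_a _ Inon).
  have B0 : 0 < (`|B| + 1)^-1 by rewrite invr_gt0 ltr_wpDl.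
  have [y Iy [yx1 yP]] := ep_lim _ B0; exists y => // x ax xy.
  have [k1 k2] := yP x ax xy.
  rewrite lee_fin inv ?(lt_le_trans xy)// A10 sub0r invrN lerNl.
  apply: (@le_trans _ _ (`|B| + 1)).
    by rewrite -normrN; apply: (le_trans (ler_norm _)); rewrite lerDl.
  by rewrite -[leLHS]invrK lef_pV2 ?posrE// ltW.
exists (A1^-1)%:E; first by rewrite eqe invr_eq0.
apply: cvg_EFin; first exact: nearW.
have lim : (fun x => A1 - ep x) @ at_a a --> A1.
  apply/cvgrPdist_lt => e e0; apply/(near_at_a _ Inon).
  have [y Iy [yx1 yP]] := ep_lim _ e0; exists y => // x ax xy.
  by have [k1 k2] := yP x ax xy; rewrite opprB addrC subrK gtr0_norm.
have nE : \forall x \near at_a a, (A1 - ep x)^-1 = u x / th1 x.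
  by apply/(near_at_a _ Inon); exists x1 => // x ax xx; rewrite inv.
by apply: cvg_trans (cvgV A10 lim); exact: near_eq_cvg nE.
Qed.

End RatioLimit.

(** * Square integrability and the limit circle case *)

Section LimitCircle.
Context {R : realType} (a b : \bar R) (p q r : R -> R).
Local Notation mu := (@completed_lebesgue_measure R).
Local Notation LT := (LebT R).
Local Notation I := (@oo_itv R a b).
Local Notation Rint D f := (Rintegral mu (D : set LT) f).
Local Notation J x f := (Rintegral mu (oo_ax a x) f).
Hypothesis st : standing a b p q r.

Let mo x : measurable (oo_ax a x : set LT).
Proof. exact: measurable_oo_ax. Qed.

Let oo_ax_I x : I x -> forall t, oo_ax a x t -> I t /\ t < x.
Proof. exact: oo_ax_sub. Qed.

Lemma measurable_cmod2_r (f : R -> R[i]) x : AC_loc I f -> I x ->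
  measurable_fun (oo_ax a x) ((fun t => cmod (f t) ^+ 2 * r t) : LT -> R).
Proof.
move=> fAC Ix; have sub : oo_ax a x `<=` (I : set LT) by move=> t /(oo_ax_I Ix)[].
have mI : measurable (I : set LT) := measurable_oo_itv a b.
have cAC := AC_loc_cmod fAC.
apply: measurable_funM; last by apply: measurable_funS mI sub _; case: st => [_ [_ [_ []]]].
exact: measurable_funS mI sub (AC_loc_measurable (AC_locM_real cAC cAC)).
Qed.

(** [r] is positive only almost everywhere; with [|r|] the integrand is nonnegative at every point,
    as the pointwise estimates require. *)
Lemma L2_Ln (f : R -> R[i]) x : AC_loc I f -> I x ->
  (\int[mu]_(t in oo_ax a x) (cmod (f t) ^+ 2 * r t)%:E < +oo)%E ->
  Ln (oo_ax a x) (fun t => cmod (f t) ^+ 2 * `|r t|).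
Proof.
move=> fAC Ix foo; have mf := measurable_cmod2_r fAC Ix.
have mg : measurable_fun (oo_ax a x) ((fun t => `|cmod (f t) ^+ 2 * r t|) : LT -> R).
  by apply: measurableT_comp.
suff : Ln (oo_ax a x) (fun t => cmod (f t) ^+ 2 * r t).
  move=> /(Ln_norm (mo x)); apply: (Ln_eq (mo x)) => t _.
  by rewrite normrM ger0_norm// sqr_ge0.
apply: (Ln_lty (mo x) mf); apply: le_lt_trans foo; rewrite le_eqVlt; apply/orP; left; apply/eqP.
apply: (@ae_eq_integral _ _ _ mu (oo_ax a x) (EFin \o (fun t => cmod (f t) ^+ 2 * r t))
  (EFin \o (fun t => `|cmod (f t) ^+ 2 * r t|)) (mo x)).
- exact/measurable_EFinP.
- exact/measurable_EFinP.
- apply: filterS (standing_ae st) => t rt xt /=; have [It _] := oo_ax_I Ix xt.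
  by have [_ r0] := rt It; rewrite ger0_norm// mulr_ge0 ?sqr_ge0// ltW.
Qed.

(* With [W(f, g) = 1], the quotient [|v| / (|f| + |g|)] satisfies a contraction
   estimate on [[y, x0]] uniformly in [y], by variation of constants. *)
Lemma L2_of_limit_circle z f f1 g g1 lam v v1 : is_sol I p q r z f f1 -> is_sol I p q r z g g1 ->
  (forall x, I x -> wr f f1 g g1 x = 1) -> is_rsol I p q r lam v v1 ->
  (exists2 x, I x & Ln (oo_ax a x) (fun t => cmod (f t) ^+ 2 * `|r t|) /\
                    Ln (oo_ax a x) (fun t => cmod (g t) ^+ 2 * `|r t|)) ->
  exists2 x, I x & Ln (oo_ax a x) (fun t => v t * v t * r t).
Proof.
move=> fs gs W vs [c Ic [fi gi]].
have [[fAC [f1AC _]] _] := fs; have [[gAC [g1AC _]] _] := gs.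
have vAC := is_rsol_AC vs.
pose F t := cmod (f t) + cmod (g t).
(* The unit Wronskian forbids a common zero of [f] and [g]. *)
have F0 t : I t -> 0 < F t.
  move=> It; rewrite lt_def addr_ge0 ?cmod_ge0// andbT; apply/eqP => F0.
  have [f0 g0] : f t = 0 /\ g t = 0.
    have := cmod_ge0 (f t); have := cmod_ge0 (g t); rewrite /F in F0.
    by split; apply: cmod_eq0; lra.
  by have /eqP := W t It; rewrite /wr f0 g0 mul0r mulr0 subrr eq_sym oner_eq0.
have FAC : AC_loc I (cf F).
  have := AC_locD (AC_loc_cmod fAC) (AC_loc_cmod gAC).
  by congr AC_loc; apply/funext => t; rewrite /cf RCD.
have F2i : Ln (oo_ax a c) (fun t => F t ^+ 2 * `|r t|).
  have mF : measurable_fun (oo_ax a c) ((fun t => F t ^+ 2 * `|r t|) : LT -> R).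
    have sub : oo_ax a c `<=` (I : set LT) by move=> t /(oo_ax_I Ic)[].
    have mI : measurable (I : set LT) := measurable_oo_itv a b.
    apply: measurable_funM.
      exact: measurable_funS mI sub (AC_loc_measurable (AC_locM_real FAC FAC)).
    apply: measurableT_comp => //.
    by apply: measurable_funS mI sub _; case: st => [_ [_ [_ []]]].
  apply: (Ln_le (g := fun t => 2 * (cmod (f t) ^+ 2 * `|r t| + cmod (g t) ^+ 2 * `|r t|)) (mo c)) => //.
    move=> t ct; rewrite ger0_norm; last by rewrite mulr_ge0// sqr_ge0.
    rewrite -mulrDl mulrA ler_wpM2r// /F -subr_ge0.
    have -> : 2 * (cmod (f t) ^+ 2 + cmod (g t) ^+ 2) - (cmod (f t) + cmod (g t)) ^+ 2 =
      (cmod (f t) - cmod (g t)) ^+ 2 by ring.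
    exact: sqr_ge0.
  by apply: (LnZ _ (mo c)); exact: LnD.
pose kap := cmod (RC lam - z).
(* [x0] is taken so close to [a] that [kap] times the integral of [F^2 |r|] is at most 1/2, the
   contraction factor. *)
have kap0 : 0 < (2 * (kap + 1))^-1 by rewrite invr_gt0 mulr_gt0// ltr_wpDl ?cmod_ge0.
have [x0 Ix0 [x0c Nx0]] := Rint_left_cvg0 Ic F2i kap0.
have F2x0 := Ln_sub x0c F2i.
pose N := J x0 (fun t => F t ^+ 2 * `|r t|).
have N0 : 0 <= N by apply: Rintegral_ge0 => t _; rewrite mulr_ge0 ?sqr_ge0.
have kN : kap * N <= 2^-1.
  have NE : N <= (2 * (kap + 1))^-1.
    apply: ltW; have := Nx0 x0 (proj1 Ix0) (lexx _); congr (_ < _).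
    by apply: eq_Rintegral => t _; rewrite ger0_norm// mulr_ge0 ?sqr_ge0.
  apply: (@le_trans _ _ ((kap + 1) * (2 * (kap + 1))^-1)).
    by rewrite ler_pM ?cmod_ge0// lerDl.
  have : kap + 1 != 0 by rewrite gt_eqF// ltr_wpDl ?cmod_ge0.
  by move: (kap + 1) => w w0; rewrite le_eqVlt; apply/orP; left; apply/eqP; field.
pose K := cmod (wr (cf v) (cf v1) g g1 x0) + cmod (wr (cf v) (cf v1) f f1 x0).
have K0 : 0 <= K by rewrite addr_ge0 ?cmod_ge0.
have below x : (a < x%:E)%E -> x <= x0 -> I x.
  by move=> ax xx; split => //; case: Ix0 => _; apply: le_lt_trans; rewrite lee_fin.
have step w B : I w -> w <= x0 -> (forall t, w <= t -> t <= x0 -> `|v t| <= B * F t) ->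
    `|v w| <= (K + kap * (B * N)) * F w.
  move=> Iw wx0 vB; have mw : measurable (`[w, x0]%classic : set LT) := leb_measurable_itv _.
  have FFi : Ln (`[w, x0]%classic : set LT) (fun t => F t ^+ 2 * `|r t|).
    have := Ln_norm mw (Ln_AC_mul (AC_locM_real FAC FAC) (standing_r st) Iw Ix0).
    by apply: (Ln_eq mw) => t _; rewrite normrM ger0_norm ?expr2// -expr2 sqr_ge0.
  have B0 : 0 <= B.
    have := vB x0 wx0 (lexx _); have := normr_ge0 (v x0) => k1 k2.
    by have := le_trans k1 k2; rewrite pmulr_lge0 ?F0.
  have NN : Rint `[w, x0]%classic (fun t => F t ^+ 2 * `|r t|) <= N.
    rewrite (Rint_cc FFi); move: wx0; rewrite le_eqVlt => /predU1P[->|wx0].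
      by rewrite oo_axE set_itvoo0// Rintegral_set0.
    by rewrite /N (Rint_split (proj1 Iw) wx0 F2x0) lerDr; apply: Rintegral_ge0 => t _; rewrite mulr_ge0 ?sqr_ge0.
  have Wb k k1 : is_sol I p q r z k k1 -> (forall t, cmod (k t) <= F t) ->
      cmod (wr (cf v) (cf v1) k k1 w) <= cmod (wr (cf v) (cf v1) k k1 x0) + kap * (B * N).
    move=> ks kF; have := lagrange_le st vs ks Iw Ix0 wx0.
    rewrite -/kap => k2.
    have k3 := cmodB (wr (cf v) (cf v1) k k1 x0) (wr (cf v) (cf v1) k k1 x0 - wr (cf v) (cf v1) k k1 w).
    rewrite subKr in k3; apply: (le_trans k3); rewrite lerD2l; apply: (le_trans k2).
    rewrite ler_wpM2l ?cmod_ge0//; apply: (@le_trans _ _ (B * Rint `[w, x0]%classic (fun t => F t ^+ 2 * `|r t|))).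
      have BF := LnZ B mw FFi.
      rewrite -(RintegralZl _ mw FFi); apply: (le_trans (ler_norm _)).
      apply: normr_Rint_le => //.
      move=> t /=; rewrite in_itv/= => /andP[wt tx].
      rewrite ger0_norm; last by rewrite !mulr_ge0 ?cmod_ge0.
      rewrite mulrA ler_wpM2r// expr2 mulrA ler_pM ?cmod_ge0//.
      by rewrite /cf cmod_RC vB.
    by rewrite ler_wpM2l.
  (* The coordinates of [v] in the basis [f], [g] are its Wronskians, which by Lagrange's estimate
     move by at most [kap * (B * N)] between [w] and [x0]. *)
  have vE : cf v w = wr (cf v) (cf v1) g g1 w * f w - wr (cf v) (cf v1) f f1 w * g w.
    by rewrite -[LHS]mulr1 -(W w Iw) /wr; ring.
  rewrite -cmod_RC -[RC _]/(cf v w) vE; apply: (le_trans (cmodB _ _)); rewrite !cmodM.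
  have h1 := Wb g g1 gs (fun t => _); have h2 := Wb f f1 fs (fun t => _).
  have {}h1 : cmod (wr (cf v) (cf v1) g g1 w) <= K + kap * (B * N).
    apply: (le_trans (h1 _)) => [t|]; first by rewrite /F lerDr cmod_ge0.
    by rewrite lerD2r /K lerDl cmod_ge0.
  have {}h2 : cmod (wr (cf v) (cf v1) f f1 w) <= K + kap * (B * N).
    apply: (le_trans (h2 _)) => [t|]; first by rewrite /F lerDl cmod_ge0.
    by rewrite lerD2r /K lerDr cmod_ge0.
  by rewrite /F mulrDr; apply: lerD; rewrite ler_wpM2r ?cmod_ge0.
have FiAC : AC_loc I (fun t => (cf F t)^-1).
  by apply: AC_locV => // t It; rewrite RC_eq0 gt_eqF ?F0.
(* [K] is computed at [x0], so the bound is uniform on (a, x0] and [F^2 |r|] majorizes [v^2 r] there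
   up to a constant. *)
have vF y : I y -> y <= x0 -> `|v y| <= 2 * K * F y.
  move=> Iy yx0; rewrite -ler_pdivrMr ?F0//.
  apply: (contraction_bound (S := [set t | y <= t /\ t <= x0]) (f := fun t => `|v t| / F t)) => //.
    have [M1 M10 M1P] := AC_loc_bounded vAC Iy Ix0.
    have [M2 M20 M2P] := AC_on_bounded (FiAC y x0 Iy Ix0 yx0).
    exists (M1 * M2) => t [yt tx]; have It := oo_itv_between Iy Ix0 yt tx.
    apply: ler_pM => //; [by rewrite invr_ge0 ltW ?F0|exact: M1P|].
    have := M2P t yt tx; rewrite /cf cmodV cmod_RC gtr0_norm ?F0//.
  move=> B BP t [yt tx]; have It := oo_itv_between Iy Ix0 yt tx.
  have BP' w : t <= w -> w <= x0 -> `|v w| <= B * F w.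
    move=> tw wx; rewrite -ler_pdivrMr; first by apply: BP; split => //; exact: le_trans tw.
    exact/F0/(oo_itv_between It Ix0 tw wx).
  rewrite ler_pdivrMr ?F0//; apply: (le_trans (step t B It tx BP')).
  have B0 : 0 <= B by apply: le_trans (BP t (conj yt tx)); rewrite divr_ge0 ?(ltW (F0 _ It)).
  by rewrite ler_wpM2r ?(ltW (F0 _ It))// lerD2l mulrCA ler_wpM2l.
exists x0 => //.
apply: (Ln_le (g := fun t => 4 * K ^+ 2 * (F t ^+ 2 * `|r t|)) (mo x0)).
- have sub : oo_ax a x0 `<=` (I : set LT) by move=> t /(oo_ax_I Ix0)[].
  have mI : measurable (I : set LT) := measurable_oo_itv a b.
  apply: measurable_funM.
    exact: measurable_funS mI sub (AC_loc_measurable (AC_locM_real vAC vAC)).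
  by apply: measurable_funS mI sub _; case: st => [_ [_ [_ []]]].
- move=> t xt; have [It tx] := oo_ax_I Ix0 xt; have vt := vF t It (ltW tx).
  rewrite !normrM mulrA ler_wpM2r//.
  have -> : 4 * K ^+ 2 * F t ^+ 2 = (2 * K * F t) * (2 * K * F t) by ring.
  by apply: ler_pM.
- exact: (LnZ _ (mo x0)).
Qed.

Lemma Ln_extend (f : R -> R) x c : I x -> I c -> measurable_fun (oo_ax a c) (f : LT -> R) ->
  Ln (oo_ax a x) f -> Ln (`[x, c]%classic : set LT) f -> Ln (oo_ax a c) f.
Proof.
move=> Ix Ic mf f1 f2; have [cx|xc] := leP c x; first exact: Ln_sub cx f1.
have mi : measurable (`[x, c[%classic : set LT) := leb_measurable_itv _.
have U : oo_ax a x `|` `[x, c[%classic = oo_ax a c.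
  apply/seteqP; split => t.
    move=> [[at_ tx]|]; first by split => //; exact: lt_trans xc.
    rewrite /= in_itv/= => /andP[xt tc]; split => //; apply: lt_le_trans (proj1 Ix) _.
    by rewrite lee_fin.
  move=> [at_ tc]; case: (ltP t x) => tx; first by left.
  by right; rewrite /= in_itv/= tx.
apply: (Ln_lty (mo c) mf); rewrite -U ge0_integral_setU; last 5 first.
- exact: mo.
- exact: mi.
- by rewrite U; apply/measurable_EFinP; exact: measurableT_comp.
- by move=> t _; rewrite lee_fin.
- apply/disj_set2P/seteqP; split => t //= [[_ tx]]; rewrite in_itv/= => /andP[xt _].
  by move: tx; rewrite ltNge xt.
- apply: lte_add_pinfty; first by case/integrableP: f1.
  have : Ln (`[x, c[%classic : set LT) f.
    apply: LnS f2 => //; first exact: leb_measurable_itv.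
    by move=> t /=; rewrite !in_itv/= => /andP[-> /ltW].
  by case/integrableP.
Qed.

(** The parameter [lam] itself is the witness: a complex solution has constant Wronskians with [u]
    and [v], hence is a combination of them with constant complex coefficients. *)
Lemma limit_circle_of_L2 lam u u1 v v1 x : is_rsol I p q r lam u u1 -> is_rsol I p q r lam v v1 ->
  (forall x, I x -> v x * u1 x - v1 x * u x = 1) -> I x ->
  Ln (oo_ax a x) (fun t => u t * u t * r t) -> Ln (oo_ax a x) (fun t => v t * v t * r t) ->
  limit_circle_at_a a b p q r.
Proof.
move=> us vs W Ix ui vi; exists (RC lam) => f f1 fs c Ic.
have [[fAC [f1AC _]] _] := fs.
have const k k1 : is_rsol I p q r lam k k1 -> forall t, I t ->
    wr f f1 (cf k) (cf k1) t = wr f f1 (cf k) (cf k1) x.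
  move=> ks.
  have key s t : I s -> I t -> s <= t -> wr f f1 (cf k) (cf k1) t = wr f f1 (cf k) (cf k1) s.
    move=> Is It st'; apply/eqP; rewrite -subr_eq0; apply/eqP/cmod_eq0/le_anti.
    by rewrite cmod_ge0 andbT (le_trans (lagrange_le st fs ks Is It st'))// subrr cmod0 mul0r.
  by move=> t It; case: (leP x t) => xt; [exact: key|rewrite (key t x)// ltW].
pose C1 := - wr f f1 (cf v) (cf v1) x; pose C2 := wr f f1 (cf u) (cf u1) x.
have fE t : I t -> f t = C1 * RC (u t) + C2 * RC (v t).
  move=> It; rewrite /C1 /C2 -(const v v1 vs t It) -(const u u1 us t It).
  have e : RC (v t) * RC (u1 t) - RC (v1 t) * RC (u t) = 1 by rewrite -!RCM -RCB W.
  by rewrite -[LHS]mulr1 -e /wr /cf; ring.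
pose K := cmod C1 + cmod C2.
have Ln_uv : Ln (oo_ax a x) (fun t => cmod (f t) ^+ 2 * r t).
  apply: (Ln_le (g := fun t => 2 * K ^+ 2 * (`|u t * u t * r t| + `|v t * v t * r t|)) (mo x)).
  - exact: measurable_cmod2_r.
  - move=> t xt; have [It tx] := oo_ax_I Ix xt.
    rewrite normrM ger0_norm ?sqr_ge0// !normrM -mulrDl mulrA ler_wpM2r//.
    have k : cmod (f t) <= K * (`|u t| + `|v t|).
      rewrite (fE t It) (le_trans (cmodD _ _))// !cmodM !cmod_RC /K mulrDl.
      by apply: lerD; apply: ler_wpM2l; rewrite ?cmod_ge0 ?lerDl ?lerDr.
    apply: (@le_trans _ _ ((K * (`|u t| + `|v t|)) ^+ 2)).
      by rewrite lerXn2r ?nnegrE ?cmod_ge0// (le_trans (cmod_ge0 _) k).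
    rewrite -subr_ge0.
    have -> : 2 * K ^+ 2 * (`|u t| * `|u t| + `|v t| * `|v t|) - (K * (`|u t| + `|v t|)) ^+ 2 =
       (K * (`|u t| - `|v t|)) ^+ 2 by ring.
    exact: sqr_ge0.
  - apply: (LnZ _ (mo x)); apply: (LnD (mo x)); exact: (Ln_norm (mo x)).
have cAC := AC_loc_cmod fAC.
have : Ln (oo_ax a c) (fun t => cmod (f t) ^+ 2 * r t).
  apply: (Ln_extend Ix Ic _ Ln_uv); first exact: measurable_cmod2_r.
  exact: Ln_AC_mul (AC_locM_real cAC cAC) (standing_r st) Ix Ic.
by move=> /(integrable_lty (mo c)).
Qed.

End LimitCircle.

(** * Moving the right end point towards [a] *)

Section Restriction.
Context {R : realType} (a b b' : \bar R) (p q r : R -> R).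
Local Notation mu := (@completed_lebesgue_measure R).
Hypotheses (ab' : (a < b')%E) (b'b : (b' <= b)%E).

Lemma oo_itv_restrict x : oo_itv a b' x -> oo_itv a b x.
Proof. by move=> [ax xb]; split => //; exact: lt_le_trans b'b. Qed.

Lemma AC_loc_restrict (f : R -> R[i]) : AC_loc (oo_itv a b) f -> AC_loc (oo_itv a b') f.
Proof. by move=> fAC c d Ic Id; apply: fAC; exact: oo_itv_restrict. Qed.

Lemma standing_restrict : standing a b p q r -> standing a b' p q r.
Proof.
move=> [_ [mp [mq [mr [r0 [ri [p0 [pi qi]]]]]]]].
have mI := measurable_oo_itv a b; have sub : oo_itv a b' `<=` oo_itv a b by exact: oo_itv_restrict.
split; first exact: ab'.
split; first exact: measurable_funS mI sub mp.
split; first exact: measurable_funS mI sub mq.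
split; first exact: measurable_funS mI sub mr.
split; first by apply: filterS r0 => x rx /oo_itv_restrict.
split; first by move=> c d /oo_itv_restrict Ic /oo_itv_restrict; exact: ri.
split; first by apply: filterS p0 => x px /oo_itv_restrict.
by split=> c d /oo_itv_restrict Ic /oo_itv_restrict; [exact: pi|exact: qi].
Qed.

Lemma is_sol_restrict z f f1 : is_sol (oo_itv a b) p q r z f f1 -> is_sol (oo_itv a b') p q r z f f1.
Proof.
move=> [[fAC [f1AC fd]] f1d]; split; first split; [exact: AC_loc_restrict|split; first exact: AC_loc_restrict|].
  by apply: filterS fd => x fx /oo_itv_restrict.
by apply: filterS f1d => x fx /oo_itv_restrict.
Qed.

Lemma is_rsol_restrict s f f1 :
  is_rsol (oo_itv a b) p q r s f f1 -> is_rsol (oo_itv a b') p q r s f f1.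
Proof. exact: is_sol_restrict. Qed.

End Restriction.

(** * Taylor estimates from pointwise convergent power series *)

Section PowerSeries.
Context {R : realType}.

Lemma cseries_real (c : nat -> R) (w : R[i]) (s lam : R) :
  cseries_to (fun n => RC (c n) * (RC s - RC lam) ^+ n) w ->
  forall e : R, 0 < e -> exists N : nat, forall m : nat, (N <= m)%N ->
    `|\sum_(n < m) c n * (s - lam) ^+ n - complex.Re w| < e.
Proof.
move=> cw e e0; have [N NP] := cw e e0; exists N => m Nm; apply: le_lt_trans (NP m Nm).
have -> : \sum_(n < m) RC (c n) * (RC s - RC lam) ^+ n = RC (\sum_(n < m) c n * (s - lam) ^+ n).
  have -> : RC (\sum_(n < m) c n * (s - lam) ^+ n) = \sum_(n < m) RC (c n * (s - lam) ^+ n).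
    by rewrite /RC rmorph_sum.
  by apply: eq_bigr => n _; rewrite RCM RCX RCB.
by apply: le_trans (Re_le_cmod _); rewrite ReB.
Qed.

(** Convergence at [lam + 1] bounds all coefficients; for [|s - lam| <= 1/2] the terms of degree at
    least two are then dominated by a geometric series of sum at most 2. *)
Lemma taylor_bound (c : nat -> R) (lam : R) (w : R -> R[i]) :
  (forall s, cseries_to (fun n => RC (c n) * (RC s - RC lam) ^+ n) (w s)) ->
  complex.Re (w lam) = c 0%N /\
  exists M : R, forall s, `|s - lam| <= 2^-1 ->
    `|complex.Re (w s) - c 0%N - c 1%N * (s - lam)| <= M * `|s - lam| ^+ 2.
Proof.
move=> cw; have cr s := cseries_real (cw s); split.
  apply/eqP; rewrite -subr_eq0 -normr_eq0; apply/eqP/le_anti; rewrite normr_ge0 andbT.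
  apply/ler_addgt0Pr => e e0; rewrite add0r; have [N NP] := cr lam e e0.
  have := NP N.+1 (leqnSn N).
  rewrite big_ord_recl expr0 mulr1 big1 ?addr0 => [|i _]; last by rewrite subrr expr0n mulr0.
  by rewrite distrC => /ltW.
have [N NP] := cr (lam + 1) 1 ltr01.
pose S m := \sum_(n < m) c n * (lam + 1 - lam) ^+ n.
(* At [lam + 1] all powers are 1, so for [n >= N] the coefficient [c n] is a difference of two
   partial sums within 1 of the limit, whence the 2; the sum covers the earlier coefficients. *)
pose M0 := \sum_(n < N) `|c n| + 2.
have M00 : 0 <= M0 by rewrite addr_ge0// sumr_ge0.
have cM n : `|c n| <= M0.
  have [Nn|nN] := leqP N n.
    have k1 := NP n Nn; have k2 := NP n.+1 (leqW Nn).
    have e : c n = S n.+1 - S n.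
      have one : lam + 1 - lam = 1 by ring.
      by rewrite /S big_ord_recr /= one expr1n mulr1 addrAC subrr add0r.
    move: k1 k2; rewrite -/(S n) -/(S n.+1) => k1 k2.
    have k3 := ler_normB (S n.+1 - complex.Re (w (lam + 1))) (S n - complex.Re (w (lam + 1))).
    have k4 : 0 <= \sum_(n < N) `|c n| by exact: sumr_ge0.
    rewrite e; rewrite opprB addrA subrK in k3; rewrite /M0; lra.
  rewrite /M0 (bigD1 (Ordinal nN))//= -addrA lerDl addr_ge0// sumr_ge0//.
exists (2 * M0) => s s2; set d := s - lam in s2 *.
apply/ler_addgt0Pr => e e0; have [K KP] := cr s e e0.
have := KP K.+2 (leqW (leqnSn K)); rewrite -/d.
rewrite !big_ord_recl /= expr0 mulr1 /bump /= add1n expr1.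
set T := \sum_(i < K) _ => h.
have Tb : `|T| <= 2 * M0 * `|d| ^+ 2.
  apply: (le_trans (ler_norm_sum _ _ _)).
  apply: (@le_trans _ _ (\sum_(i < K) M0 * `|d| ^+ 2 * `|d| ^+ i)).
    apply: ler_sum => i _; rewrite normrM normrX -mulrA -exprD.
    by rewrite !add1n add2n ler_wpM2r// exprn_ge0.
  rewrite -mulr_sumr [leRHS](_ : _ = M0 * `|d| ^+ 2 * 2); last by ring.
  rewrite ler_wpM2l ?mulr_ge0 ?exprn_ge0//.
  exact: sum_geometric_le2.
have -> : complex.Re (w s) - c 0%N - c 1%N * d = T - (c 0%N + (c 1%N * d + T) - complex.Re (w s)) by ring.
by apply: (le_trans (ler_normB _ _)); rewrite lerD// ltW.
Qed.

End PowerSeries.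

(** * Theta and phi as solutions *)

Section Assembly.
Context {R : realType} (a b : \bar R) (p q r u v : R -> R) (lam : R)
    (th : R[i] -> R -> R[i]) (thn : nat -> R -> R).
Local Notation I := (@oo_itv R a b).
Hypotheses (st : standing a b p q r) (thA : theta_admissible a b p q r u v lam th thn).

(** Admissibility gives phi a quasi-derivative and a unit Wronskian with the solution theta;
    [wr_unit_sol] turns this into the equation for every complex [z], whereas the series of phi is
    estimated only near [lam]. *)
Lemma theta_phi_sol z : exists th1 phi1, [/\ is_sol I p q r z (th z) th1,
  is_sol I p q r z (phiz a r u v lam z) phi1 &
  forall x, I x -> wr (th z) th1 (phiz a r u v lam z) phi1 x = 1].
Proof.
have [/(_ z)[th1 [phi1 [ts [qp W]]]] _] := thA.
by exists th1, phi1; split => //; exact: wr_unit_sol st ts qp W.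
Qed.

(** Theta is real for real [s], but phi is known to be real only where its series is controlled,
    hence the premise on its imaginary part. The quasi-derivatives are replaced by their real
    parts. *)
Lemma theta_phi_real s : exists th1 phi1 : R -> R,
  [/\ is_rsol I p q r s (fun x => complex.Re (th (RC s) x)) th1,
      is_rsol I p q r s (fun x => complex.Re (phiz a r u v lam (RC s) x)) phi1 &
      forall x, I x -> complex.Im (phiz a r u v lam (RC s) x) = 0 ->
        rwr (fun x => complex.Re (th (RC s) x)) th1
            (fun x => complex.Re (phiz a r u v lam (RC s) x)) phi1 x = 1].
Proof.
have [th1 [phi1 [ts ps W]]] := theta_phi_sol (RC s).
exists (fun x => complex.Re (th1 x)), (fun x => complex.Re (phi1 x)); split.
- exact: is_sol_Re.
- exact: is_sol_Re.
move=> x Ix /Im_real phR; have [_ [_ [/(_ s x Ix)/Im_real thR _]]] := thA.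
have := congr1 (@complex.Re R) (W x Ix); rewrite /wr /rwr ReB thR phR ReMRC /=.
by rewrite -/(RC _) [in X in _ - X](mulrC (th1 x)) ReMRC [X in _ - X]mulrC.
Qed.

End Assembly.

(** * Reduction to a neighbourhood of [a], and conclusion *)

Section Assembly.
Context {R : realType} (a b : \bar R) (p q r u u1 v v1 : R -> R) (lam : R)
    (th : R[i] -> R -> R[i]) (thn : nat -> R -> R).
Local Notation mu := (@completed_lebesgue_measure R).
Local Notation I := (@oo_itv R a b).
Local Notation J x f := (Rintegral mu (oo_ax a x) f).
Hypotheses (st : standing a b p q r).

Lemma local_setting_exists c : nonosc_at_a a b p q r lam ->
  is_rsol I p q r lam u u1 -> principal_at_a a b p q r lam u ->
  is_rsol I p q r lam v v1 -> lin_indep I u v -> I c ->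
  (\int[mu]_(x in oo_ax a c) `|u x * v x * r x|%:E < +oo)%E ->
  (forall x, I x -> v x * u1 x - v1 x * u x = 1) ->
  exists b' : \bar R, [/\ (a < b')%E, (b' <= b)%E & local_setting a b' p q r lam u u1 v v1].
Proof.
move=> no us [_ [un pr]] vs lin Ic uvoo W.
have vn : nontriv I v.
  apply: contrapT => nv; have [_ /eqP] : (0 : R) = 0 /\ (1 : R) = 0.
    apply: lin => x Ix; rewrite mul0r add0r mul1r; apply: contrapT => vx.
    by apply: nv; exists x; split => //; exact/eqP.
  by rewrite oner_eq0.
have [y1 Iy1 y1P] := nonosc_nonzero no us un.
have [y2 Iy2 y2P] := nonosc_nonzero no vs vn.
(* The new right end point: below [c] for the integrability of [u v r], below [y1] and [y2] for the
   absence of zeros. *)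
have [w Iw] : exists2 w, I w & w < Num.min c (Num.min y1 y2).
  by apply: oo_itv_lt; case: (leP y1 y2) => _; case: leP.
rewrite !lt_min => /and3P[wc wy1 wy2]; have [aw wb] := Iw.
have wb' : (w%:E <= b)%E by exact: ltW.
exists w%:E; split => //.
have sub x : oo_itv a w%:E x -> [/\ I x, (a < x%:E)%E & x < w].
  by move=> Ix; split; [exact: oo_itv_restrict wb' _ Ix|case: Ix|case: Ix].
have muv : measurable_fun (oo_ax a c) ((fun t => u t * v t * r t) : LebT R -> R).
  have sub' : oo_ax a c `<=` (I : set (LebT R)) by move=> t /(oo_ax_sub Ic)[].
  have mI : measurable (I : set (LebT R)) := measurable_oo_itv a b.
  apply: measurable_funM; last by apply: measurable_funS mI sub' _; case: st => [_ [_ [_ []]]].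
  exact: measurable_funS mI sub' (AC_loc_measurable (AC_locM_real (is_rsol_AC us) (is_rsol_AC vs))).
split.
- exact: standing_restrict aw wb' st.
- exact: is_rsol_restrict wb' _ _ _ us.
- exact: is_rsol_restrict wb' _ _ _ vs.
- by move=> x /sub[Ix _ _]; exact: W.
- by move=> x /sub[Ix ax xw]; apply: y1P => //; exact: lt_trans wy1.
- by move=> x /sub[Ix ax xw]; apply: y2P => //; exact: lt_trans wy2.
- move=> e e0; have := pr v v1 vs lin; move=> /cvgrPdist_lt /(_ e e0) k.
  have [w' Iw'] : exists x, oo_itv a w%:E x.
    by have [z Iz zw] := oo_itv_lt Iw; exists z; split; [case: Iz|rewrite lte_fin].
  have [y Iy yP] := (near_at_a _ (ex_intro _ w' Iw')).1 k.
  by exists y => // x ax xy; have := yP x ax xy; rewrite sub0r normrN.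
- move=> x /sub[Ix ax xw]; apply: (Ln_sub (ltW (lt_trans xw wc))).
  exact: (Ln_lty (@measurable_oo_ax R a c) muv).
Qed.

Hypothesis thA : theta_admissible a b p q r u v lam th thn.

Lemma theta_coefficients b' : (a < b')%E -> (b' <= b)%E -> local_setting a b' p q r lam u u1 v v1 ->
  exists x0 al A (T0 : R -> R), [/\ oo_itv a b' x0, AC_loc (oo_itv a b') (cf T0),
    (forall x, (a < x%:E)%E -> x <= x0 -> T0 x = al * u x + v x),
    (forall x, I x -> thn 0%N x = T0 x) &
    (forall y, (a < y%:E)%E -> y < x0 ->
      thn 1%N y = u y * (A + Rintegral mu (oo_ax y%:E x0) (fun t => T0 t * v t * r t))
                + v y * J y (fun t => T0 t * u t * r t))].
Proof.
move=> ab' b'b ls; have IE := oo_itv_restrict b'b.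
have [x0 Ix0] : exists x0, oo_itv a b' x0.
  move: ab'; case: (b') => [w||] aw; last by rewrite ltNge leNye in aw.
  - have h : oo_itv a (w + 1)%:E w by split => //; rewrite lte_fin ltrDl.
    by have [z [az _] zw] := oo_itv_lt h; exists z; split => //; rewrite lte_fin.
  - case: a aw => [x||] _ //; first by exists (x + 1); split; rewrite ?ltry// lte_fin ltrDl.
    by exists 0; split; rewrite ?ltry ?ltNyr.
pose Om := om a r u v x0; have Om0 : 0 <= Om by exact: om_ge0.
(* Two demands are met at once: [|d n| * om x0 <= 1/2] for the series of phi and [|d n| <= 1/2] for
   the Taylor bound on theta. *)
pose d (n : nat) : R := (2 * (Om + 1))^-1 * n.+1%:R^-1.
have d00 : 0 < (2 * (Om + 1))^-1 by rewrite invr_gt0 mulr_gt0// ltr_wpDl.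
have dpos n : 0 < d n by rewrite mulr_gt0// invr_gt0.
have d0 n : d n != 0 by rewrite gt_eqF.
have dle n : d n <= (2 * (Om + 1))^-1.
  by rewrite /d ler_piMr ?(ltW d00)// invf_le1// ler1n.
have dcvg : d @ \oo --> (0 : R).
  rewrite -(mulr0 (2 * (Om + 1))^-1); apply: cvgM; first exact: cvg_cst.
  exact: cvg_harmonic.
have inv2 : (2 * (Om + 1))^-1 * (Om + 1) = 2^-1.
  have : Om + 1 != 0 by rewrite gt_eqF// ltr_wpDl.
  by move: (Om + 1) => w w0; field.
have dsmall n : `|d n| * om a r u v x0 <= 2^-1.
  rewrite gtr0_norm// -inv2 ler_pM ?(ltW (dpos n)) ?lerDl//.
have dhalf n : `|d n| <= 2^-1.
  rewrite gtr0_norm// (le_trans (dle n))// lef_pV2 ?posrE ?mulr_gt0 ?ltr_wpDl//.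
  by rewrite ler_peMr// lerDr.
have /choice[thp thpP] : forall s, exists pr : (R -> R) * (R -> R),
  [/\ is_rsol (oo_itv a b') p q r s (fun x => complex.Re (th (RC s) x)) pr.1,
      is_rsol (oo_itv a b') p q r s (fun x => complex.Re (phiz a r u v lam (RC s) x)) pr.2 &
      forall x, oo_itv a b' x -> complex.Im (phiz a r u v lam (RC s) x) = 0 ->
        rwr (fun x => complex.Re (th (RC s) x)) pr.1
            (fun x => complex.Re (phiz a r u v lam (RC s) x)) pr.2 x = 1].
  move=> s; have [t1 [f1 [ts ps W]]] := theta_phi_real st thA s; exists (t1, f1); split => /=.
  - exact: is_rsol_restrict b'b _ _ _ ts.
  - exact: is_rsol_restrict b'b _ _ _ ps.
  - by move=> x /IE; exact: W.
have phib s x : `|s - lam| * om a r u v x0 <= 2^-1 -> (a < x%:E)%E -> x <= x0 ->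
    complex.Im (phiz a r u v lam (RC s) x) = 0 /\
    `|complex.Re (phiz a r u v lam (RC s) x) - u x| <= 2 * `|s - lam| * om a r u v x * `|u x|.
  move=> sx ax xx; have Ix : oo_itv a b' x.
    by split => //; case: Ix0 => _; apply: le_lt_trans; rewrite lee_fin.
  have omx : om a r u v x <= om a r u v x0 := om_le ls ax Ix0 xx.
  have [|e1 e2] := @phiz_real _ _ _ _ _ _ _ _ _ _ _ ls s x Ix.
    by apply: le_trans sx; rewrite ler_wpM2l.
  by split => //; rewrite e1.
have lamd n : lam + d n - lam = d n by rewrite addrAC subrr add0r.
have small n : `|lam + d n - lam| * om a r u v x0 <= 2^-1 by rewrite lamd.
have small0 : `|lam - lam| * om a r u v x0 <= 2^-1 by rewrite subrr normr0 mul0r invr_ge0.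
pose T0 x := complex.Re (th (RC lam) x).
have [T0s F0s TF0] := thpP lam.
have F0u x : (a < x%:E)%E -> x <= x0 -> complex.Re (phiz a r u v lam (RC lam) x) = u x.
  move=> ax xx; have [_] := phib lam x small0 ax xx.
  by rewrite subrr normr0 mulr0 !mul0r normr_le0 subr_eq0 => /eqP.
have Tay x : I x -> T0 x = thn 0%N x /\ exists M : R, forall s, `|s - lam| <= 2^-1 ->
    `|complex.Re (th (RC s) x) - thn 0%N x - thn 1%N x * (s - lam)| <= M * `|s - lam| ^+ 2.
  move=> Ix; have [_ [_ [_ ser]]] := thA.
  by apply: (@taylor_bound _ (thn^~ x) lam (fun s => th (RC s) x)) => s; exact: ser.
have nd : (fun n => `|d n|) @ \oo --> (0 : R) by rewrite -(@normr0 _ R); exact: cvg_norm.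
have Thcvg x : oo_itv a b' x -> complex.Re (th (RC (lam + d n)) x) @[n --> \oo] --> T0 x.
  move=> /IE Ix; have [-> [M MP]] := Tay x Ix.
  apply: (@cvg_dominated_near _ _ (fun n => `|thn 1%N x| * `|d n| + M * `|d n| * `|d n|)).
    apply: nearW => n; have := MP (lam + d n); rewrite lamd => /(_ (dhalf n)) k.
    have := ler_normD (complex.Re (th (RC (lam + d n)) x) - thn 0%N x - thn 1%N x * d n) (thn 1%N x * d n).
    rewrite subrK normrM => k2; apply: (le_trans k2).
    by rewrite addrC lerD2l (le_trans k)// expr2 mulrA.
  have -> : 0 = `|thn 1%N x| * 0 + M * 0 * 0 :> R by rewrite !mulr0 addr0.
  apply: cvgD; first by apply: cvgM => //; exact: cvg_cst.
  by apply: cvgM => //; apply: cvgM => //; exact: cvg_cst.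
have th1cvg x : oo_itv a b' x ->
    (complex.Re (th (RC (lam + d n)) x) - T0 x) / d n @[n --> \oo] --> thn 1%N x.
  move=> /IE Ix; have [-> [M MP]] := Tay x Ix.
  apply: (@cvg_dominated_near _ _ (fun n => M * `|d n|)).
    apply: nearW => n; have := MP (lam + d n); rewrite lamd => /(_ (dhalf n)) k.
    set X := complex.Re _ in k *.
    have -> : (X - thn 0%N x) / d n - thn 1%N x = (X - thn 0%N x - thn 1%N x * d n) / d n.
      by field; exact: d0.
    rewrite normrM normfV ler_pdivrMr ?normr_gt0//.
    by rewrite -mulrA -expr2.
  by rewrite -[X in _ --> X](mulr0 M); apply: cvgM => //; exact: cvg_cst.
have [ax0 _] := Ix0.
have TF0' := TF0 x0 Ix0 (proj1 (phib lam x0 small0 ax0 (lexx _))).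
pose s n := lam + d n.
pose Th n x := complex.Re (th (RC (s n)) x).
pose Ph n x := complex.Re (phiz a r u v lam (RC (s n)) x).
have Ths n : is_rsol (oo_itv a b') p q r (s n) (Th n) (thp (s n)).1 by case: (thpP (s n)).
have Phs n : is_rsol (oo_itv a b') p q r (s n) (Ph n) (thp (s n)).2 by case: (thpP (s n)).
have Phu n x : (a < x%:E)%E -> x <= x0 -> `|Ph n x - u x| <= 2 * `|d n| * om a r u v x * `|u x|.
  by move=> ax xx; have [_] := phib (s n) x (small n) ax xx; rewrite lamd.
have ThPh n : rwr (Th n) (thp (s n)).1 (Ph n) (thp (s n)).2 x0 = 1.
  by case: (thpP (s n)) => _ _; apply=> //; exact: proj1 (phib _ x0 (small n) ax0 (lexx _)).
have [A AP] := theta1E ls Ix0 d0 dcvg dsmall Ths Phs Phu ThPh T0s F0s F0u TF0' Thcvg th1cvg.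
exists x0, (- rwr T0 (thp lam).1 v v1 x0), A, T0; split => //.
- exact: is_rsol_AC T0s.
- by move=> x ax xx; exact (theta0E ls Ix0 T0s F0s F0u TF0' ax xx).
- by move=> x /Tay[-> _].
Qed.

End Assembly.

Theorem mainTheorem12 (R : realType) (a b : \bar R) (p q r : R -> R)
    (lam c : R) (u u1 v v1 : R -> R)
    (th : R[i] -> R -> R[i]) (thn : nat -> R -> R) :
  standing a b p q r ->
  (* Hypothesis (H_a), with the data of Construction (C) *)
  nonosc_at_a a b p q r lam ->
  is_rsol (oo_itv a b) p q r lam u u1 ->
  principal_at_a a b p q r lam u ->
  is_rsol (oo_itv a b) p q r lam v v1 ->
  lin_indep (oo_itv a b) u v ->
  oo_itv a b c ->
  (\int[@completed_lebesgue_measure R]_(x in oo_ax a c) `|u x * v x * r x|%:E < +oo)%E ->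
  (forall x, oo_itv a b x -> v x * u1 x - v1 x * u x = 1) ->
  (* theta as in Definition (RI) *)
  theta_admissible a b p q r u v lam th thn ->
  (limit_circle_at_a a b p q r <-> reg_index a (phin a r u v 0) thn 0).
Proof.
move=> st no us pu vs lin Ic uvoo W thA.
have [b' [ab' b'b ls]] := local_setting_exists st no us pu vs lin Ic uvoo W.
have [x0 [al [A [T0 [Ix0 T0AC T0E th0E th1E]]]]] := theta_coefficients st thA ab' b'b ls.
have IE := oo_itv_restrict b'b.
split.
- move=> [z LC]; split.
    move=> n; rewrite leqn0 => /eqP ->; have r0 : ratio_lim a u T0 0%E by exact: (ratio_theta0 ls Ix0 T0E).
    rewrite /ratio_lim in r0 *; apply: cvg_trans r0.
    apply: near_eq_cvg; apply/(near_at_a _ (ex_intro _ x0 Ix0)); exists x0 => // x ax xx.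
    by rewrite th0E//; apply: IE; split => //; case: Ix0 => _; apply: lt_trans; rewrite lte_fin.
  (* The parameter [z] of the limit circle case may be complex and far from [lam]; theta(z) and
     phi(z) are a fundamental system there, and both are square integrable near [a]. *)
  have [t1 [f1 [ts fs Wz]]] := theta_phi_sol st thA z.
  have [x Ix vvi] : exists2 x, oo_itv a b x & Ln (oo_ax a x) (fun t => v t * v t * r t).
    apply: (L2_of_limit_circle st ts fs Wz vs); exists c => //; split.
      by apply: (L2_Ln st _ Ic (LC _ _ ts c Ic)); case: ts => [[]].
    by apply: (L2_Ln st _ Ic (LC _ _ fs c Ic)); case: fs => [[]].
  (* [x] is only known to lie in (a, b); the smaller of [x] and [x0] lies in (a, b'), where the
     local theory applies. *)
  have [xx0|x0x] := leP x x0.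
    apply: (ratio_of_L2 ls Ix0 T0AC T0E th1E _ vvi).
    by split; [case: Ix|case: Ix0 => _; apply: le_lt_trans; rewrite lee_fin].
  exact: (ratio_of_L2 ls Ix0 T0AC T0E th1E Ix0 (Ln_sub (ltW x0x) vvi)).
- move=> [_ [L L0 rL]].
  have [x Ix vvi] := L2_of_ratio ls Ix0 T0AC T0E th1E L0 rL.
  have uui : Ln (oo_ax a x) (fun t => u t * u t * r t) by apply: Ln_uur ls _ Ix.
  exact (limit_circle_of_L2 st us vs W (IE _ _ Ix) uui vvi).
Qed.
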